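(* Let $n\ge 1$, $T>0$, and let $H:\mathbb{R}\times\mathbb{R}^n\times\mathbb{R}\times\mathbb{R}^n\to\mathbb{R}$ and $u_0:\mathbb{R}^n\to\mathbb{R}$ satisfy assumptions (A1)-(A5) listed in the context. For $\epsilon\in(0,e^{-1})$ let $u^\epsilon\in C_b([0,T]\times\mathbb{R}^n)$ be the unique viscosity solution of $$u^\epsilon_t+H(t,x,u^\epsilon,\nabla u^\epsilon)+\epsilon(-\Delta)^{1/2}u^\epsilon=0\ \text{ in }(0,T]\times\mathbb{R}^n,\qquad u^\epsilon(0,x)=u_0(x),$$ and let $u\in C_b([0,T]\times\mathbb{R}^n)$ be the unique viscosity solution of $$u_t+H(t,x,u,\nabla u)=0\ \text{ in }(0,T]\times\mathbb{R}^n,\qquad u(0,x)=u_0(x).$$ Then there exists a constant $C$, depending on the data ($n$, $T$ and the constants in (A1)-(A5)) but not on $\epsilon$, such that $$|u^\epsilon(t,x)-u(t,x)|\le C\,\epsilon\,|\log\epsilon|\qquad\text{for all }(t,x)\in[0,T]\times\mathbb{R}^n.$$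
   Context: Assumptions: (A1) $H$ is continuous and there is $K>0$ with $\sup_{t\in[0,T],x\in\mathbb{R}^n}|H(t,x,0,0)|<K$. (A2) There is $\lambda\ge 0$ such that $H(t,x,v,p)-H(t,x,u,p)=\lambda(v-u)$ for all $t\in\mathbb{R}$, $x,p\in\mathbb{R}^n$, $u,v\in\mathbb{R}$. (A3) There is $C>0$ such that $|H(t,x,u,p)-H(s,y,u,p)|\le C(1+|p|)(|x-y|+|t-s|)$ for all $t,s,u\in\mathbb{R}$, $x,y,p\in\mathbb{R}^n$. (A4) For every $R>0$ there is a constant $A_R$ such that $|H(t,x,u,p)-H(t,x,u,q)|\le A_R|p-q|$ for all $|p|,|q|<R$ and all $(t,x,u)$. (A5) There is $K_0>0$ with $\|u_0\|_{W^{1,\infty}(\mathbb{R}^n)}\le K_0$. Fractional Laplacian: $(-\Delta)^{1/2}w(x)=C(n,1)\,\mathrm{P.V.}\int_{\mathbb{R}^n}\frac{w(x)-w(x+y)}{|y|^{n+1}}dy$, where $C(n,1)>0$ is the usual normalizing constant depending only on $n$; it acts in the space variable $x$. Viscosity solutions (for $\epsilon\ge 0$; $\epsilon=0$ gives the first order equation): for $\kappa\in(0,1)$ set $\mathcal{I}^\epsilon_\kappa(\varphi)(t,x)=-\epsilon C(n,1)\,\mathrm{P.V.}\int_{|z|<\kappa}\frac{\varphi(t,x+z)-\varphi(t,x)}{|z|^{n+1}}dz$ and $\mathcal{I}^{\kappa,\epsilon}(u)(t,x)=-\epsilon C(n,1)\int_{|z|\ge\kappa}\frac{u(t,x+z)-u(t,x)}{|z|^{n+1}}dz$.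 A bounded upper semicontinuous function $u$ on $[0,T]\times\mathbb{R}^n$ is a viscosity subsolution of the equation if, for every $\varphi\in C^{1,2}([0,T]\times\mathbb{R}^n)$ ($C^1$ in $t$, $C^2$ in $x$), whenever $(t,x)\in(0,T)\times\mathbb{R}^n$ is a global maximum point of $u-\varphi$, one has $\varphi_t(t,x)+H(t,x,u(t,x),\nabla\varphi(t,x))+\mathcal{I}^\epsilon_\kappa(\varphi)(t,x)+\mathcal{I}^{\kappa,\epsilon}(u)(t,x)\le 0$ for all $\kappa\in(0,1)$. A bounded lower semicontinuous function is a viscosity supersolution if the reverse inequality $\ge 0$ holds at global minimum points of $u-\varphi$. A viscosity solution is a bounded continuous function that is both; it solves the initial value problem if also $u(0,\cdot)=u_0$. $C_b$ denotes bounded continuous functions. *)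

(* Defs.v *)
From HB Require Import structures.
From mathcomp Require Import all_boot all_order all_algebra.
From mathcomp Require Import all_classical all_reals all_analysis.

Set Implicit Arguments.
Unset Strict Implicit.
Unset Printing Implicit Defensive.

Import Order.TTheory GRing.Theory Num.Theory.
Import numFieldNormedType.Exports.

Local Open Scope classical_set_scope.
Local Open Scope ring_scope.

(* The library norm on 'rV[R]_n is the sup norm. *)
Definition enorm (R : realType) (n : nat) (x : 'rV[R]_n) : R :=
  Num.sqrt (\sum_(i < n) x ord0 i ^+ 2).

(* Borel sigma-algebra on row vectors, following the library's n.-tuple one. *)
Definition rV_display : measure_display -> measure_display.
Proof. exact. Qed.

Section measurable_rV.
Context {d} {T : measurableType d} (n : nat).

Let coord (i : 'I_n) (x : 'rV[T]_n) : T := x ord0 i.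

Let rV_set0 : g_sigma_preimage coord set0.
Proof. exact: sigma_algebra0. Qed.

Let rV_setC A : g_sigma_preimage coord A -> g_sigma_preimage coord (~` A).
Proof. exact: sigma_algebraC. Qed.

Let rV_bigcup (F : (set _)^nat) : (forall i, g_sigma_preimage coord (F i)) ->
  g_sigma_preimage coord (\bigcup_i F i).
Proof. exact: sigma_algebra_bigcup. Qed.

HB.instance Definition _ := @isMeasurable.Build (rV_display d)
  'rV[T]_n (g_sigma_preimage coord) rV_set0 rV_setC rV_bigcup.

End measurable_rV.

Lemma measurable_coord d (T : measurableType d) n (i : 'I_n) :
  measurable_fun [set: 'rV[T]_n] (fun x : 'rV[T]_n => x ord0 i).
Proof.
move=> _ Y mY; rewrite setTI; apply: sub_sigma_algebra => /=.
rewrite -bigcup_seq/=; exists i => /=; first by rewrite mem_index_enum.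
by exists Y => //; rewrite setTI.
Qed.

Lemma measurable_fun_coordP d1 d2 (T1 : measurableType d1)
    (T2 : measurableType d2) n (f : T1 -> 'rV[T2]_n) :
  (forall i, measurable_fun [set: T1] (fun x => f x ord0 i)) ->
  measurable_fun [set: T1] f.
Proof.
move=> mf _ A mA; rewrite setTI.
have /= := g_sigma_preimage_comp (fun (i : 'I_n) (x : 'rV[T2]_n) => x ord0 i) f.
set L := g_sigma_preimage _ => LE.
have : L (f @^-1` A) by rewrite LE; exists A => //; rewrite setTI.
rewrite {LE}/L; apply: smallest_sub; first exact: sigma_algebra_measurable.
rewrite -bigcup_seq /=; apply: bigcup_sub => i _ B [C mC <-].
exact: mf.
Qed.

Section lebesgue_rV.
Context {R : realType}.

Definition row_cons n (p : R * 'rV[R]_n) : 'rV[R]_n.+1 :=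
  \row_i if unlift ord0 i is Some j then p.2 ord0 j else p.1.

Definition row_uncons n (x : 'rV[R]_n.+1) : R * 'rV[R]_n :=
  (x ord0 ord0, \row_i x ord0 (lift ord0 i)).

Lemma row_cons0 n (p : R * 'rV[R]_n) : row_cons p ord0 ord0 = p.1.
Proof. by rewrite mxE unlift_none. Qed.

Lemma row_consS n (p : R * 'rV[R]_n) i :
  row_cons p ord0 (lift ord0 i) = p.2 ord0 i.
Proof. by rewrite mxE liftK. Qed.

Lemma row_consK n : cancel (@row_cons n) (@row_uncons n).
Proof.
move=> [a v]; rewrite /row_uncons row_cons0; congr pair.
by apply/rowP => i; rewrite mxE row_consS.
Qed.

Lemma measurable_row_cons n : measurable_fun [set: R * 'rV[R]_n] (@row_cons n).
Proof.
apply: measurable_fun_coordP => i; case: (unliftP ord0 i) => [j|] ->.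
  apply: (eq_measurable_fun ((fun x : 'rV[R]_n => x ord0 j) \o snd)).
    by move=> p _; rewrite row_consS.
  by apply: measurableT_comp => //; exact: measurable_coord.
by apply: (eq_measurable_fun fst) => // p _; rewrite row_cons0.
Qed.

Lemma measurable_row_uncons n :
  measurable_fun [set: 'rV[R]_n.+1] (@row_uncons n).
Proof.
apply/measurable_fun_pairP; split; first exact: measurable_coord.
apply: measurable_fun_coordP => i.
apply: (eq_measurable_fun (fun x : 'rV[R]_n.+1 => x ord0 (lift ord0 i))).
  by move=> x _; rewrite /= mxE.
exact: measurable_coord.
Qed.

Section step.
Variables (n : nat) (mu : {sigma_finite_measure set 'rV[R]_n -> \bar R}).

Definition lebesgue_rV_step : set 'rV[R]_n.+1 -> \bar R :=
  pushforward (lebesgue_measure \x mu)%E (@row_cons n).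

Let step0 : lebesgue_rV_step set0 = 0%E.
Proof. by rewrite /lebesgue_rV_step /pushforward preimage_set0 measure0. Qed.

Let step_ge0 A : (0 <= lebesgue_rV_step A)%E.
Proof. exact: (measure_ge0 (lebesgue_measure \x mu)%E). Qed.

Let step_sigma_additive : semi_sigma_additive lebesgue_rV_step.
Proof.
have mc A : measurable A -> measurable (@row_cons n @^-1` A).
  by move=> mA; rewrite -[X in measurable X]setTI; exact: measurable_row_cons.
move=> F mF tF mUF; rewrite /lebesgue_rV_step /pushforward preimage_bigcup.
apply: (measure_semi_sigma_additive (s := lebesgue_measure \x mu)%E).
- by move=> k; exact: mc.
- apply/trivIsetP => /= i j _ _ ij; rewrite -preimage_setI.
  by move/trivIsetP : tF => /(_ _ _ _ _ ij) ->//; rewrite preimage_set0.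
- by rewrite -preimage_bigcup; exact: mc.
Qed.

HB.instance Definition _ := isMeasure.Build _ _ _ lebesgue_rV_step
  step0 step_ge0 step_sigma_additive.

Let step_sigma_finite : sigma_finite setT lebesgue_rV_step.
Proof.
have /sigma_finiteP[F [FT ndF Foo]] := sigma_finiteT (@lebesgue_measure R).
have /sigma_finiteP[G [GT ndG Goo]] := sigma_finiteT mu.
exists (fun k => @row_uncons n @^-1` (F k `*` G k)).
  rewrite -preimage_bigcup (_ : \bigcup_k _ = setT) ?preimage_setT//.
  rewrite -subTset => -[x y] _.
  have [i _ Fix] : (\bigcup_i F i) x by rewrite -FT.
  have [j _ Gjy] : (\bigcup_j G j) y by rewrite -GT.
  exists (maxn i j) => //; split.
    by move: x Fix; exact/subsetPset/ndF/leq_maxl.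
  by move: y Gjy; exact/subsetPset/ndG/leq_maxr.
move=> k; have [mF Fk] := Foo k; have [mG Gk] := Goo k; split.
  by rewrite -[X in measurable X]setTI; apply: measurable_row_uncons => //;
    exact: measurableX.
rewrite /lebesgue_rV_step /pushforward -comp_preimage.
rewrite (_ : _ \o _ = id) ?preimage_id; last first.
  by apply/funext => p; rewrite /= row_consK.
by rewrite product_measure1E// lte_mul_pinfty// ge0_fin_numE.
Qed.

HB.instance Definition _ := Measure_isSigmaFinite.Build _ _ _ lebesgue_rV_step
  step_sigma_finite.

End step.
Fixpoint lebesgue_rV n : {sigma_finite_measure set 'rV[R]_n -> \bar R} :=
  match n with
  | 0 => \d_(0 : 'rV[R]_0)
  | m.+1 => lebesgue_rV_step (lebesgue_rV m)
  end.

End lebesgue_rV.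

(* Sanity check: lebesgue_rV gives boxes their volume. *)
Lemma lebesgue_rV_box (R : realType) n (a b : 'rV[R]_n) :
  (forall i, a ord0 i <= b ord0 i) ->
  lebesgue_rV n [set x | forall i, a ord0 i <= x ord0 i <= b ord0 i] =
  (\prod_(i < n) (b ord0 i - a ord0 i))%:E.
Proof.
elim: n a b => [|n IH] a b ab.
  rewrite big_ord0 /= diracE mem_set//= => -[] //.
pose tl (x : 'rV[R]_n.+1) : 'rV[R]_n := (row_uncons x).2.
rewrite big_ord_recl /= /lebesgue_rV_step /pushforward.
set B := [set x : 'rV[R]_n | forall i,
  tl a ord0 i <= x ord0 i <= tl b ord0 i].
rewrite (_ : _ @^-1` _ = `[a ord0 ord0, b ord0 ord0] `*` B); last first.
  apply/seteqP; split => [p|p [/= p1 p2] i].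
    move=> /= H; split.
      by move: (H ord0); rewrite row_cons0 /= in_itv.
    by move=> i; move: (H (lift ord0 i)); rewrite row_consS !mxE.
  case: (unliftP ord0 i) => [j|] ->.
    by move: (p2 j); rewrite row_consS !mxE.
  by rewrite row_cons0; move: p1; rewrite in_itv.
have mB : measurable B.
  rewrite (_ : B = \bigcap_(i in [set: 'I_n])
      ((fun x : 'rV[R]_n => x ord0 i) @^-1` `[tl a ord0 i, tl b ord0 i])).
    apply: fin_bigcap_measurable => [|i _]; first exact: finite_finset.
    rewrite -[X in measurable X]setTI.
    by apply: measurable_coord => //; exact: measurable_itv.
  apply/seteqP; split => x /=.
    by move=> + i _ => /(_ i) /=; rewrite in_itv.
  by move=> + i => /(_ i Logic.I) /=; rewrite in_itv.
rewrite product_measure1E//.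
rewrite IH; last by move=> i; rewrite !mxE.
rewrite EFinM; congr (_ * _)%E; last first.
  by congr EFin; apply: eq_bigr => i _; rewrite !mxE.
apply: (etrans (lebesgue_measure_itv `[a ord0 ord0, b ord0 ord0])).
rewrite /= lte_fin; case: ifPn => // h.
rewrite (_ : b ord0 ord0 = a ord0 ord0) ?subrr//.
by apply/eqP; rewrite eq_le ab leNgt h.
Qed.

Section weak_derivatives.
Context {R : realType} {n : nat}.
Implicit Types (f g phi : 'rV[R]_n -> R) (i : 'I_n).

Definition partial i f (x : 'rV[R]_n) : R := 'D_(delta_mx ord0 i) f x.

Definition grad f (x : 'rV[R]_n) : 'rV[R]_n := \row_i partial i f x.

Fixpoint Ck (k : nat) f : Prop :=
  continuous f /\
  if k is k'.+1 then
    forall i, (forall x, derivable f x (delta_mx ord0 i)) /\ Ck k' (partial i f)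
  else True.

Definition test_function phi : Prop :=
  (forall k, Ck k phi) /\ compact (closure [set x | phi x != 0]).

Definition weak_partial i f g : Prop :=
  forall phi, test_function phi ->
    \int[lebesgue_rV n]_x (f x * partial i phi x) =
    - \int[lebesgue_rV n]_x (g x * phi x).

(* f belongs to W^{1,oo}(R^n) and ||f||_oo + \sum_i ||d_i f||_oo <= K0, the
   d_i f being weak derivatives. *)
Definition W1inf_norm_le f (K0 : R) : Prop :=
  measurable_fun setT f /\
  exists g : 'I_n -> 'rV[R]_n -> R,
    [/\ forall i, measurable_fun setT (g i),
        forall i, weak_partial i f (g i) &
        ('N[lebesgue_rV n]_(+oo)[EFin \o f] +
         \sum_(i < n) 'N[lebesgue_rV n]_(+oo)[EFin \o g i] <= K0%:E)%E].

End weak_derivatives.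

Section nonlocal_operator.
Context {R : realType} {n : nat}.
Implicit Types (w : 'rV[R]_n -> R) (x : 'rV[R]_n).

(* C(n,1) is the constant for which (-Delta)^{1/2} has Fourier symbol |xi|,
   i.e. the inverse of \int (1 - cos z_1) / |z|^(n+1) dz; dimension 0 is junk. *)
Definition frac_const (m : nat) : R :=
  if m is m'.+1 then
    (\int[lebesgue_rV m'.+1]_z
       ((1 - cos (z ord0 ord0)) / enorm z ^+ m'.+2))^-1
  else 0.

Definition kernel_integral (D : set 'rV[R]_n) w x : R :=
  \int[lebesgue_rV n]_(z in D) ((w (x + z) - w x) / enorm z ^+ n.+1).

Definition nonlocal_near (eps kappa : R) w x : R :=
  - (eps * frac_const n *
     lim (kernel_integral [set z | delta < enorm z < kappa] w x
            @[delta --> 0^'+])).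

Definition nonlocal_far (eps kappa : R) w x : R :=
  - (eps * frac_const n * kernel_integral [set z | kappa <= enorm z] w x).

End nonlocal_operator.

Section viscosity.
Context {R : realType} {n : nat}.
Variable T : R.
Implicit Types (u phi : R -> 'rV[R]_n -> R) (t : R) (x : 'rV[R]_n).

(* Functions on [0,T] x R^n are curried and total in t; only their values on
   strip are ever used. *)
Definition strip : set (R * 'rV[R]_n) := `[0, T]%classic `*` setT.

Definition continuous_on_strip u : Prop :=
  {within strip, continuous (fun p : R * 'rV[R]_n => u p.1 p.2)}.

Definition bounded_on_strip u : Prop :=
  exists M : R, forall t x, 0 <= t <= T -> `|u t x| <= M.

Definition lsc_on_strip u : Prop :=
  lower_semicontinuous
    ((fun p : R * 'rV[R]_n => (u p.1 p.2)%:E) : subspace strip -> \bar R).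

Definition usc_on_strip u : Prop := lsc_on_strip (fun t x => - u t x).

(* The time derivative is one-sided at t = 0 and t = T. *)
Definition C12 phi : Prop :=
  [/\ continuous_on_strip phi,
      exists phit : R -> 'rV[R]_n -> R,
        continuous_on_strip phit /\
        forall t x, 0 <= t <= T ->
          (phi s x - phi t x) / (s - t) @[s --> within `[0, T] t^'] --> phit t x,
      forall i : 'I_n,
        (forall t x, 0 <= t <= T -> derivable (phi t) x (delta_mx ord0 i)) /\
        continuous_on_strip (fun t => partial i (phi t)) &
      forall i j : 'I_n,
        (forall t x, 0 <= t <= T ->
           derivable (partial i (phi t)) x (delta_mx ord0 j)) /\
        continuous_on_strip (fun t => partial j (partial i (phi t)))].

Variable H : R -> 'rV[R]_n -> R -> 'rV[R]_n -> R.

(* Left-hand side of phi_t + H(t,x,u,Dphi) + I_kappa^eps(phi) + I^{kappa,eps}(u) *)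
Definition visc_operator (eps kappa : R) u phi t x : R :=
  derive1 (fun s => phi s x) t + H t x (u t x) (grad (phi t) x) +
  nonlocal_near eps kappa (phi t) x + nonlocal_far eps kappa (u t) x.

Definition viscosity_subsolution (eps : R) u : Prop :=
  [/\ bounded_on_strip u, usc_on_strip u &
      forall phi, C12 phi -> forall t x, 0 < t < T ->
        (forall s y, 0 <= s <= T -> u s y - phi s y <= u t x - phi t x) ->
        forall kappa, 0 < kappa < 1 -> visc_operator eps kappa u phi t x <= 0].

Definition viscosity_supersolution (eps : R) u : Prop :=
  [/\ bounded_on_strip u, lsc_on_strip u &
      forall phi, C12 phi -> forall t x, 0 < t < T ->
        (forall s y, 0 <= s <= T -> u t x - phi t x <= u s y - phi s y) ->
        forall kappa, 0 < kappa < 1 -> 0 <= visc_operator eps kappa u phi t x].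

(* eps = 0 is the first order equation. *)
Definition viscosity_solution (eps : R) (u0 : 'rV[R]_n -> R) u : Prop :=
  [/\ bounded_on_strip u, continuous_on_strip u,
      viscosity_subsolution eps u, viscosity_supersolution eps u &
      forall x, u 0 x = u0 x].

End viscosity.

(* Main.v *)
(* Only the limit u needs regularity: comparison with K0 + K t bounds it, and
   doubling the variables in the first order equation makes it M1-Lipschitz in
   space.  Then one maximizes
     ueps(t,x) - u(s,y) - e^(3 L t) |x-y|^2 / (2 delta) - ...
   With the nonlocal operator split at radius kappa, the penalty contributes
   eps kappa / delta over |z| < kappa.  Over |z| >= kappa, comparing the maximum
   point with its translate by (z, z) bounds the increments of ueps by those of
   u, hence by min(M1 |z|, 2 |u|_oo), whose integral against |z|^(-n-1) is of
   order |log kappa|.  Taking delta = kappa = eps gives the rate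
   eps |log eps|.  The other inequality follows from the same argument applied
   to -ueps, -u and the Hamiltonian -H(t,x,-u,-p). *)

Require Import Defs.
From HB Require Import structures.
From mathcomp Require Import all_boot all_order all_algebra.
From mathcomp Require Import all_classical all_reals all_analysis measurable_realfun ess_sup_inf.
From mathcomp Require Import ring lra.
Import Order.TTheory GRing.Theory Num.Theory.
Import numFieldNormedType.Exports.
Local Open Scope classical_set_scope.
Local Open Scope ring_scope.

(** * Lebesgue measure on row vectors *)

(** The doubling argument is carried out once, in [doubling_comparison], and applied three times:
    against the barrier, to the first order solution against itself, and for the rate. Since space
    is unbounded, maxima are localized by the bounded bump [hb] at scale [rho ^+ 2]; its gradient
    and the kernel integral of its increments are both of order at most 1 / [rho], so it disappears
    as [rho] grows. Time is doubled as well, because each viscosity inequality must be written at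
    its own point; the time penalties have opposite derivatives and cancel. [delta], [kappa] and
    [eps] stay fixed while [rho] and then the time gap are sent to their limits.

    Integrals and limits are total functions with default values. Nonlocal terms are therefore only
    estimated from one side, by integrals of explicit measurable majorants, and these estimates
    remain true at the default values. *)

Lemma lebesgue_measure_shift (R : realType) (c : R) (A : set R) :
  measurable (A : set (measurableTypeR R)) ->
  lebesgue_measure ((fun x => x + c) @^-1` A) = lebesgue_measure A.
Proof.
move=> mA.
have mf : measurable_fun [set: measurableTypeR R]
    ((fun x => x + c) : measurableTypeR R -> measurableTypeR R).
  exact: measurable_funD.
pose mu' := pushforward (@lebesgue_measure R)
  ((fun x => x + c) : measurableTypeR R -> measurableTypeR R).
rewrite -[LHS]/(mu' A); apply/esym/lebesgue_measure_unique => //= _ [[a b]] _ <-.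
rewrite /mu' /pushforward /=.
rewrite (_ : _ @^-1` _ = `]a - c, b - c]%classic); last first.
  by apply/seteqP; split => x /=; rewrite !in_itv/= ltrBlDr lerBrDr.
rewrite !lebesgue_measure_itv/= !lte_fin ltrD2r.
by case: ifP => // _; rewrite opprB -EFinD; congr (_%:E); ring.
Qed.

Section coordinatewise_maps.
Context {R : realType}.

Definition coord_map n (f : 'I_n -> R -> R) (x : 'rV[R]_n) : 'rV[R]_n :=
  \row_i f i (x ord0 i).

Lemma measurable_coord_map n (f : 'I_n -> R -> R) :
  (forall i, measurable_fun [set: R] (f i)) ->
  measurable_fun [set: 'rV[R]_n] (coord_map n f).
Proof.
move=> mf; apply: measurable_fun_coordP => i.
apply: (eq_measurable_fun (f i \o (fun x : 'rV[R]_n => x ord0 i))).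
  by move=> x _; rewrite /= mxE.
by apply: measurableT_comp => //; exact: measurable_coord.
Qed.

(** By induction on the dimension: through [row_cons] the map becomes a product map, and the image
    of the product measure under it agrees with the product measure on rectangles, hence everywhere.
    Translations and the reflection are both of this form. *)
Lemma lebesgue_rV_coord_map n (f : 'I_n -> R -> R) :
  (forall i, measurable_fun [set: R] (f i)) ->
  (forall i (A : set R), measurable A ->
     lebesgue_measure (f i @^-1` A) = lebesgue_measure A) ->
  forall A, measurable A -> lebesgue_rV n (coord_map n f @^-1` A) = lebesgue_rV n A.
Proof.
elim: n f => [|n IH] f mf pf A mA.
  congr (lebesgue_rV 0 _); rewrite (_ : coord_map 0 f = id)//.
  by apply/funext => x; apply/rowP => -[].
pose f' i := f (lift ord0 i).
have mf' : measurable_fun setT (coord_map n f').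
  by apply: measurable_coord_map => i; exact: mf.
pose g (p : measurableTypeR R * 'rV[R]_n) : measurableTypeR R * 'rV[R]_n := (f ord0 p.1, coord_map n f' p.2).
have mg : measurable_fun setT g.
  apply/measurable_fun_pairP; split.
    exact: (measurableT_comp (mf ord0) measurable_fst).
  exact: (measurableT_comp mf' measurable_snd).
have mB : measurable (@row_cons R n @^-1` A).
  by rewrite -[X in measurable X]setTI; exact: measurable_row_cons.
rewrite /= /lebesgue_rV_step /pushforward.
have -> : @row_cons R n @^-1` (coord_map n.+1 f @^-1` A) =
          g @^-1` (@row_cons R n @^-1` A).
  apply/funext => p; rewrite /preimage/mkset; congr (A _); apply/rowP => i.
  rewrite [LHS]mxE; case: (unliftP ord0 i) => [j|] ->.
    by rewrite !row_consS mxE.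
  by rewrite !row_cons0.
rewrite -[LHS]/(pushforward (lebesgue_measure \x lebesgue_rV n)%E g _).
apply/esym/product_measure_unique => // {mA mB} {}A B mA mB.
transitivity ((lebesgue_measure \x lebesgue_rV n)%E
  ((f ord0 @^-1` A) `*` (coord_map n f' @^-1` B))) => //.
have mfA : measurable (f ord0 @^-1` A) by rewrite -[X in measurable X]setTI; exact: mf.
have mfB : measurable (coord_map n f' @^-1` B).
  by rewrite -[X in measurable X]setTI; exact: mf'.
rewrite product_measure1E//.
rewrite [X in (_ * X = _)%E]IH//.
  congr (_ * _)%E; exact: pf.
- by move=> i; exact: mf.
- by move=> i; exact: pf.
Qed.

Lemma measurable_opp_rV n : measurable_fun [set: 'rV[R]_n] (fun x : 'rV[R]_n => - x).
Proof.
rewrite (_ : (fun x => - x) = coord_map n (fun=> -%R)).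
  exact: measurable_coord_map.
by apply/funext => x; apply/rowP => i; rewrite !mxE.
Qed.

Lemma measurable_shift_rV n (c : 'rV[R]_n) :
  measurable_fun [set: 'rV[R]_n] (fun x : 'rV[R]_n => x + c).
Proof.
rewrite (_ : (fun x => x + c) = coord_map n (fun i x => x + c ord0 i)).
  by apply: measurable_coord_map => i; exact: measurable_funD.
by apply/funext => x; apply/rowP => i; rewrite !mxE.
Qed.

Lemma lebesgue_rV_opp n (A : set 'rV[R]_n) : measurable A ->
  lebesgue_rV n ((fun x => - x) @^-1` A) = lebesgue_rV n A.
Proof.
rewrite (_ : (fun x => - x) = coord_map n (fun=> -%R)); last first.
  by apply/funext => x; apply/rowP => i; rewrite !mxE.
apply: lebesgue_rV_coord_map => // i B mB; exact: lebesgue_measureN.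
Qed.

Lemma lebesgue_rV_shift n (c : 'rV[R]_n) (A : set 'rV[R]_n) : measurable A ->
  lebesgue_rV n ((fun x => x + c) @^-1` A) = lebesgue_rV n A.
Proof.
rewrite (_ : (fun x => x + c) = coord_map n (fun i x => x + c ord0 i)); last first.
  by apply/funext => x; apply/rowP => i; rewrite !mxE.
apply: lebesgue_rV_coord_map => // i; first exact: measurable_funD.
by move=> B mB; exact: lebesgue_measure_shift.
Qed.

End coordinatewise_maps.

(** * Integrals of the kernel *)

Section unmeasurable_bounds.
Local Open Scope ereal_scope.
Context d (X : measurableType d) (R : realType).
Variable mu : {measure set X -> \bar R}.

(* Integrals are suprema over simple functions below the integrand, so they
   are monotone even on functions that are not measurable. *)
Lemma ge0_le_integral_any (D : set X) (f g : X -> \bar R) :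
  (forall x, D x -> 0 <= f x) -> (forall x, D x -> f x <= g x) ->
  \int[mu]_(x in D) f x <= \int[mu]_(x in D) g x.
Proof.
move=> f0 fg; rewrite (integral_mkcond D f) (integral_mkcond D g).
have F0 x : 0 <= (f \_ D) x by exact: erestrict_ge0.
have FG x : (f \_ D) x <= (g \_ D) x by exact: lee_restrict.
rewrite !ge0_integralTE//; last by move=> x; exact: le_trans (F0 x) (FG x).
by apply: le_ereal_sup => _ [h hf <-]; exists h => // x; exact: le_trans (hf x) (FG x).
Qed.

(** Only the positive part is controlled. If the negative part has infinite integral, [fine] sends
    the value to 0, and this still respects the bound because [S] is nonnegative. *)
Lemma Rintegral_le_any (D : set X) (f g : X -> R) (S : R) :
  (forall x, D x -> (0 <= g x)%R) -> (forall x, D x -> (f x <= g x)%R) ->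
  \int[mu]_(x in D) (g x)%:E <= S%:E -> (Rintegral mu D f <= S)%R.
Proof.
move=> g0 fg gS.
have S0 : (0 <= S)%R.
  by rewrite -lee_fin; apply: le_trans gS; apply: integral_ge0 => x /g0; rewrite lee_fin.
rewrite /Rintegral integralE.
set P := \int[mu]_(x in D) _^\+ x; set N := \int[mu]_(x in D) _^\- x.
have P0 : 0 <= P by apply: integral_ge0 => x _; exact: funepos_ge0.
have N0 : 0 <= N by apply: integral_ge0 => x _; exact: funeneg_ge0.
have PS : P <= S%:E.
  apply: le_trans gS; apply: ge0_le_integral_any => x Dx; first exact: funepos_ge0.
  by rewrite funeposE ge_max !lee_fin fg// g0.
move: P N P0 N0 PS => [p| |] [q| |]//=; rewrite ?lee_fin => p0 q0 pS //.
by apply: le_trans pS; rewrite gerBl.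
Qed.

Lemma Rintegral_ge_any (D : set X) (f g : X -> R) (S : R) :
  (forall x, D x -> (0 <= g x)%R) -> (forall x, D x -> (- g x <= f x)%R) ->
  \int[mu]_(x in D) (g x)%:E <= S%:E -> (- S <= Rintegral mu D f)%R.
Proof.
move=> g0 fg gS.
have S0 : (0 <= S)%R.
  by rewrite -lee_fin; apply: le_trans gS; apply: integral_ge0 => x /g0; rewrite lee_fin.
rewrite /Rintegral integralE.
set P := \int[mu]_(x in D) _^\+ x; set N := \int[mu]_(x in D) _^\- x.
have P0 : 0 <= P by apply: integral_ge0 => x _; exact: funepos_ge0.
have N0 : 0 <= N by apply: integral_ge0 => x _; exact: funeneg_ge0.
have NS : N <= S%:E.
  apply: le_trans gS; apply: ge0_le_integral_any => x Dx; first exact: funeneg_ge0.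
  by rewrite funenegE ge_max -EFinN !lee_fin lerNl fg// g0.
move: P N P0 N0 NS => [p| |] [q| |]//=; rewrite ?lee_fin => p0 q0 pS //; rewrite ?oppr_le0//.
by rewrite (le_trans (y := (- q)%R)) ?lerN2// lerDr.
Qed.

End unmeasurable_bounds.

(** * Dyadic estimates of the kernel *)

Section kernel_bounds.
Context {R : realType} {n : nat}.
Local Notation mu := (@lebesgue_rV R n).
Implicit Types (x z : 'rV[R]_n).

Lemma enorm_ge0 z : 0 <= enorm z. Proof. exact: sqrtr_ge0. Qed.

Lemma enorm_sqr z : enorm z ^+ 2 = \sum_i z ord0 i ^+ 2.
Proof. by rewrite sqr_sqrtr// sumr_ge0// => i _; exact: sqr_ge0. Qed.

Lemma enormN z : enorm (- z) = enorm z.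
Proof. by congr Num.sqrt; apply: eq_bigr => i _; rewrite mxE sqrrN. Qed.

Lemma enorm_coord z i : `|z ord0 i| <= enorm z.
Proof.
rewrite -ler_sqr ?nnegrE ?enorm_ge0// enorm_sqr real_normK ?num_real//.
by rewrite (bigD1 i)//= lerDl sumr_ge0// => j _; exact: sqr_ge0.
Qed.

Lemma enorm_le_sum z : enorm z <= \sum_i `|z ord0 i|.
Proof.
have S0 (s : seq 'I_n) : 0 <= \sum_(i <- s) `|z ord0 i| by exact: sumr_ge0.
rewrite -ler_sqr ?nnegrE ?enorm_ge0// enorm_sqr.
elim: (index_enum _) => [|i s IH]; first by rewrite !big_nil expr0n.
rewrite !big_cons sqrrD real_normK ?num_real// -addrA lerD2l.
by rewrite (le_trans IH)// lerDr mulrn_wge0// mulr_ge0.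
Qed.

Lemma measurable_enorm (D : set 'rV[R]_n) : measurable_fun D (@enorm R n).
Proof.
apply: measurable_funTS; apply: (measurableT_comp (f := @Num.sqrt R)).
  by apply: continuous_measurable_fun; exact: sqrt_continuous.
apply: measurable_sum => i; apply: measurable_funX; exact: measurable_coord.
Qed.

Lemma measurable_enorm_preimage (Y : set R) : measurable Y ->
  measurable [set z : 'rV[R]_n | Y (enorm z)].
Proof. by move=> mY; rewrite -[X in measurable X]setTI; exact: measurable_enorm. Qed.

Lemma measurable_enorm_ge (s : R) : measurable [set z : 'rV[R]_n | s <= enorm z].
Proof.
have := @measurable_enorm_preimage `[s, +oo[%classic.
rewrite (_ : [set z | _] = [set z : 'rV[R]_n | s <= enorm z]); first exact.
by apply/seteqP; split => z /=; rewrite in_itv/= andbT.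
Qed.

Lemma measurable_box (a b : 'rV[R]_n) :
  measurable [set x : 'rV[R]_n | forall i, a ord0 i <= x ord0 i <= b ord0 i].
Proof.
rewrite (_ : [set x | _] = \bigcap_(i in [set: 'I_n])
    ((fun x : 'rV[R]_n => x ord0 i) @^-1` `[a ord0 i, b ord0 i]%classic)).
  apply: fin_bigcap_measurable => [|i _]; first exact: finite_finset.
  by rewrite -[X in measurable X]setTI; apply: measurable_coord => //; exact: measurable_itv.
apply/seteqP; split => x /=.
  by move=> + i _ => /(_ i) /=; rewrite in_itv.
by move=> + i => /(_ i Logic.I) /=; rewrite in_itv.
Qed.

Lemma lebesgue_rV_ball (r : R) : 0 <= r ->
  (mu [set z : 'rV[R]_n | (enorm z < r)%R] <= ((2 * r) ^+ n)%:E)%E.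
Proof.
move=> r0.
pose a : 'rV[R]_n := const_mx (- r); pose b : 'rV[R]_n := const_mx r.
have ab i : a ord0 i <= b ord0 i by rewrite !mxE; lra.
have := lebesgue_rV_box ab.
have -> : \prod_(i < n) (b ord0 i - a ord0 i) = (2 * r) ^+ n.
  rewrite (eq_bigr (fun=> 2 * r)); last by move=> i _; rewrite !mxE; ring.
  by rewrite prodr_const card_ord.
move=> <-; apply: le_measure; rewrite ?inE.
- by apply: (measurable_enorm_preimage `]-oo, r[%classic).
- exact: measurable_box.
- move=> z /= zr i; rewrite !mxE -ler_norml.
  exact: le_trans (enorm_coord _ _) (ltW zr).
Qed.

Lemma measurable_kernel (j : nat) (D : set 'rV[R]_n) :
  measurable_fun D (fun z => enorm z ^+ j / enorm z ^+ n.+1).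
Proof.
apply: measurable_funTS; apply: measurable_funM.
  by apply: measurable_funX; exact: measurable_enorm.
rewrite (_ : (fun _ => _^-1) = (fun z : 'rV[R]_n => (enorm z ^+ n.+1) `^ (- 1))).
  apply: (measurableT_comp (f := @powR R ^~ (- 1))); first exact: measurable_powR.
  by apply: measurable_funX; exact: measurable_enorm.
by apply/funext => z; rewrite powR_inv1// exprn_ge0// enorm_ge0.
Qed.

Lemma kernel_ge0 (j : nat) z : 0 <= enorm z ^+ j / enorm z ^+ n.+1.
Proof. by rewrite divr_ge0// exprn_ge0// enorm_ge0. Qed.

(** Half-open, so that consecutive dyadic annuli are disjoint and leave no gap. *)
Definition annulus (a b : R) : set 'rV[R]_n := [set z | a <= enorm z < b].

Lemma measurable_annulus a b : measurable (annulus a b).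
Proof.
have := @measurable_enorm_preimage `[a, b[%classic.
rewrite (_ : [set z | _] = annulus a b); first by apply; exact: measurable_itv.
by apply/seteqP; split => z /=; rewrite in_itv.
Qed.

(** The integrand is at most (2r)^j / r^(n+1) and the annulus fits in a cube of side 4r. The
    resulting power r^(j-1) is written [r ^+ j / r] so that j = 0 is included. *)
Lemma kernel_annulus (j : nat) (r : R) : 0 < r ->
  (\int[mu]_(z in annulus r (2 * r)) (enorm z ^+ j / enorm z ^+ n.+1)%:E
    <= (2 ^+ j * 4 ^+ n * (r ^+ j / r))%:E)%E.
Proof.
move=> r0.
have mA := measurable_annulus r (2 * r).
apply: (@le_trans _ _ (\int[mu]_(z in annulus r (2 * r)) ((2 * r) ^+ j / r ^+ n.+1)%:E)%E).
  apply: ge0_le_integral_any => z /=; first by rewrite lee_fin kernel_ge0.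
  move=> /andP[rz zr]; rewrite lee_fin ler_pM ?exprn_ge0 ?enorm_ge0 ?invr_ge0//.
  - by rewrite exprn_ge0 ?enorm_ge0.
  - by rewrite lerXn2r ?nnegrE ?enorm_ge0// ltW// (le_lt_trans _ zr) ?enorm_ge0.
  - rewrite lef_pV2 ?posrE ?exprn_gt0//; last exact: lt_le_trans rz.
    by rewrite lerXn2r ?nnegrE ?enorm_ge0// ltW.
rewrite integral_cst//.
have H : (mu (annulus r (2 * r)) <= ((4 * r) ^+ n)%:E)%E.
  apply: (@le_trans _ _ (mu [set z : 'rV[R]_n | (enorm z < 2 * r)%R])).
    apply: le_measure; rewrite ?inE//.
    - by apply: (measurable_enorm_preimage `]-oo, (2 * r)[%classic).
    - by move=> z /andP[].
  apply: (le_trans (lebesgue_rV_ball (2 * r) _)); first lra.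
  by rewrite lee_fin mulrA -natrM.
have c0 : 0 <= (2 * r) ^+ j / r ^+ n.+1.
  by rewrite divr_ge0// exprn_ge0//; lra.
apply: (le_trans (lee_wpmul2l _ H)); first by rewrite lee_fin.
rewrite -EFinM lee_fin !exprMn exprS.
have rn : r ^+ n != 0 by rewrite expf_neq0// gt_eqF.
have rne : r != 0 by rewrite gt_eqF.
rewrite le_eqVlt; apply/orP; left; apply/eqP; field.
by rewrite rne.
Qed.

(** The three exponents in use match three sizes of increments: j = 0 for bounded ones (the sum
    decreases geometrically), j = 1 for Lipschitz ones (constant terms, hence a logarithm), j = 2
    for second differences (the sum increases geometrically). *)
Lemma kernel_dyadic (j k : nat) (r : R) : 0 < r ->
  (\int[mu]_(z in annulus r (2 ^+ k * r)) (enorm z ^+ j / enorm z ^+ n.+1)%:E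
    <= (2 ^+ j * 4 ^+ n * \sum_(i < k) ((2 ^+ i * r) ^+ j / (2 ^+ i * r)))%:E)%E.
Proof.
move=> r0; elim: k => [|k IH].
  rewrite big_ord0 mulr0 expr0 mul1r (_ : annulus r r = set0) ?integral_set0//.
  by apply/seteqP; split => z //= /andP[a b]; move: (le_lt_trans a b); rewrite ltxx.
have k0 : 0 < 2 ^+ k * r by rewrite mulr_gt0// exprn_gt0.
have k1 : r <= 2 ^+ k * r by rewrite ler_peMl ?(ltW r0)// exprn_ege1// ler1n.
have -> : annulus r (2 ^+ k.+1 * r) =
    annulus r (2 ^+ k * r) `|` annulus (2 ^+ k * r) (2 * (2 ^+ k * r)).
  apply/seteqP; split => z /=; rewrite exprS -mulrA.
    move=> /andP[a b]; case: (ltP (enorm z) (2 ^+ k * r)) => h; [left|right].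
      by apply/andP.
    by apply/andP.
  move=> [|] /andP[a b]; apply/andP; split => //.
    by rewrite (lt_le_trans b)//; lra.
  exact: le_trans a.
rewrite ge0_integral_setU//=; first last.
- apply/disj_setPRL => z /= /andP[a b]; apply/negP; rewrite negb_and -!leNgt.
  by rewrite a orbT.
- by move=> z _; rewrite lee_fin kernel_ge0.
- by apply/measurable_EFinP; exact: measurable_kernel.
- exact: measurable_annulus.
- exact: measurable_annulus.
rewrite big_ord_recr/= mulrDr EFinD; apply: leeD => //.
exact: kernel_annulus.
Qed.
End kernel_bounds.

Section kernel_integrals.
Context {R : realType} {n : nat}.
Local Notation mu := (@lebesgue_rV R n).
Implicit Types (x z : 'rV[R]_n) (f : 'rV[R]_n -> R).

Lemma kernel_tail (r : R) : 0 < r ->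
  (\int[mu]_(z in [set z | (r <= enorm z)%R]) (enorm z ^+ 0 / enorm z ^+ n.+1)%:E
    <= (2 * 4 ^+ n / r)%:E)%E.
Proof.
move=> r0; pose F k := annulus (n := n) r (2 ^+ k * r).
have -> : [set z : 'rV[R]_n | r <= enorm z] = \bigcup_k F k.
  apply/seteqP; split => z /=; last by move=> [k _ /andP[]].
  (* [archi_bound q] is an exponent at which the power of 2 exceeds [q]. *)
  move=> rz; exists (Num.Def.archi_bound (enorm z / r)) => //.
  apply/andP; split => //; rewrite -ltr_pdivrMr//.
  exact: upper_nthrootP.
have ndF : nondecreasing_seq F.
  move=> i j ij; rewrite subsetEset => z /= /andP[a b]; apply/andP; split => //.
  by rewrite (lt_le_trans b)// ler_pM2r// ler_eXn2l// ltr1n.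
have mF k : measurable (F k) by exact: measurable_annulus.
have := @ge0_nondecreasing_set_cvg_integral _ _ R F
  (fun z => (enorm z ^+ 0 / enorm z ^+ n.+1)%:E) mu ndF mF.
move=> /(_ _ _)/cvg_lim <-//; first last.
- by move=> k z _; rewrite lee_fin kernel_ge0.
- by move=> k; apply/measurable_EFinP; exact: measurable_kernel.
apply: lime_le.
  apply: ereal_nondecreasing_is_cvgn.
  apply: ge0_nondecreasing_set_nondecreasing_integral => //.
  - by move=> k; apply/measurable_EFinP; exact: measurable_kernel.
  - by move=> k z _; rewrite lee_fin kernel_ge0.
apply: nearW => k; apply: (le_trans (kernel_dyadic 0 k r r0)).
rewrite lee_fin expr0 mul1r (mulrC 2) -mulrA ler_wpM2l ?exprn_ge0//.
under eq_bigr do rewrite expr0 mul1r invfM -exprVn.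
rewrite -mulr_suml ler_wpM2r ?invr_ge0 ?(ltW r0)//.
have := @geometric_le_lim R k 1 2^-1.
rewrite /series/= /geometric/= big_mkord.
rewrite (eq_bigr (fun i : 'I_k => 2^-1 ^+ i)); last by move=> i _; rewrite mul1r.
have -> : 1 / (1 - 2^-1) = 2 :> R by field.
apply => //; rewrite ?invr_gt0// ger0_norm ?invr_ge0//.
by rewrite invf_lt1// ltr1n.
Qed.

(** Every dyadic annulus contributes the same amount, and about log2(1/k) of them lie between radii
    k and 1. This is the source of the logarithm in the rate. *)
Lemma kernel_middle (k : R) : 0 < k < 1 ->
  (\int[mu]_(z in annulus k 1) (enorm z ^+ 1 / enorm z ^+ n.+1)%:E
    <= (2 * 4 ^+ n * (`|ln k| / ln 2 + 1))%:E)%E.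
Proof.
move=> /andP[k0 k1].
have l2 : 0 < ln 2 :> R by rewrite ln_gt0// ltr1n.
have q0 : 0 <= `|ln k| / ln 2 by rewrite divr_ge0// ltW.
have /andP[m1 m2] := truncn_itv q0.
set m := Num.truncn _ in m1 m2.
have H : 1 <= 2 ^+ m.+1 * k.
  rewrite -ler_pdivrMr// div1r -[X in _ <= X]lnK ?posrE ?exprn_gt0//.
  rewrite -[X in X <= _](lnK (x := k^-1)) ?posrE ?invr_gt0// ler_expR.
  rewrite lnV ?posrE// lnXn// -[X in _ <= X]mulr_natl.
  rewrite -ler_pdivrMr//; apply: le_trans (ltW m2).
  by rewrite ler_pM2r ?invr_gt0// -normrN ler_norm.
apply: (@le_trans _ _ (\int[mu]_(z in annulus k (2 ^+ m.+1 * k))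
    (enorm z ^+ 1 / enorm z ^+ n.+1)%:E)%E).
  apply: ge0_subset_integral.
  - exact: measurable_annulus.
  - exact: measurable_annulus.
  - by apply/measurable_EFinP; exact: measurable_kernel.
  - by move=> z _; rewrite lee_fin kernel_ge0.
  - by move=> z /= /andP[a b]; apply/andP; split => //; exact: lt_le_trans b H.
apply: (le_trans (kernel_dyadic 1 m.+1 k k0)).
rewrite lee_fin expr1 ler_wpM2l ?mulr_ge0 ?exprn_ge0//.
rewrite (eq_bigr (fun=> 1)); last first.
  by move=> i _; rewrite expr1 divff// mulf_neq0 ?expf_neq0// gt_eqF.
by rewrite sumr_const card_ord -[X in X <= _]natr1 lerD2r.
Qed.

(** The annuli are counted inwards from radius [k]; the outermost ones dominate the sum, so the
    bound is uniform in the inner radius [d], as the principal value requires. *)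
Lemma kernel_core (d k : R) : 0 < d -> 0 < k ->
  (\int[mu]_(z in [set z | (d < enorm z < k)%R]) (enorm z ^+ 2 / enorm z ^+ n.+1)%:E
    <= (4 * 4 ^+ n * k)%:E)%E.
Proof.
move=> d0 k0.
pose m := Num.Def.archi_bound (k / d).
have kd : 0 <= k / d by rewrite divr_ge0// ltW.
have H : k / 2 ^+ m <= d.
  rewrite ler_pdivrMr ?exprn_gt0// mulrC -ler_pdivrMr//.
  by rewrite ltW//; exact: upper_nthrootP.
have r0 : 0 < k / 2 ^+ m by rewrite divr_gt0// exprn_gt0.
have E2 : 2 ^+ m * (k / 2 ^+ m) = k.
  by rewrite mulrC divfK// expf_neq0.
apply: (@le_trans _ _ (\int[mu]_(z in annulus (k / 2 ^+ m) (2 ^+ m * (k / 2 ^+ m)))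
    (enorm z ^+ 2 / enorm z ^+ n.+1)%:E)%E).
  apply: ge0_subset_integral.
  - by apply: (measurable_enorm_preimage `]d, k[%classic) => //.
  - exact: measurable_annulus.
  - by apply/measurable_EFinP; exact: measurable_kernel.
  - by move=> z _; rewrite lee_fin kernel_ge0.
  - move=> z /= /andP[a b]; apply/andP; split; last by rewrite E2.
    by rewrite (le_trans H)// ltW.
apply: (le_trans (kernel_dyadic 2 m _ r0)).
rewrite lee_fin -natrX ler_wpM2l ?mulr_ge0 ?exprn_ge0//.
rewrite (eq_bigr (fun i : 'I_m => 2 ^+ i * (k / 2 ^+ m))); last first.
  by move=> i _; rewrite expr2 mulfK// mulf_neq0 ?expf_neq0// gt_eqF.
rewrite -mulr_suml.
have : \sum_(i < m) 2 ^+ i <= 2 ^+ m :> R.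
  elim: m {kd H r0 E2} => [|m IH]; first by rewrite big_ord0 expr0.
  by rewrite big_ord_recr/= exprS mulr_natl mulr2n lerD2r.
by move=> h; rewrite -[X in _ <= X]E2 ler_wpM2r// ltW.
Qed.

Lemma integral_opp_rV (D : set 'rV[R]_n) (g : 'rV[R]_n -> \bar R) :
  measurable D -> (forall z, D z -> D (- z)) -> measurable_fun setT g ->
  mu.-integrable D (g \o (fun z : 'rV[R]_n => - z)) ->
  (\int[mu]_(z in D) g z = \int[mu]_(z in D) g (- (z : 'rV[R]_n))%R)%E.
Proof.
move=> mD sD mg ig.
have DE : (fun z : 'rV[R]_n => - z) @^-1` D = D.
  by apply/seteqP; split => z /=; [move=> /sD; rewrite opprK|exact: sD].
have E : forall A, measurable A -> A `<=` D ->
    mu A = pushforward mu (fun z : 'rV[R]_n => - z) A.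
  by move=> A mA _; rewrite /pushforward lebesgue_rV_opp.
rewrite (eq_measure_integral _ E); first exact: measurable_opp_rV.
by move=> mo; rewrite [LHS](integral_pushforward mo) ?DE.
Qed.

Lemma kernel_integralZ_le (D : set 'rV[R]_n) (j : nat) (c S : R) :
  0 <= c -> measurable D ->
  (\int[mu]_(z in D) (enorm z ^+ j / enorm z ^+ n.+1)%:E <= S%:E)%E ->
  (\int[mu]_(z in D) (c * (enorm z ^+ j / enorm z ^+ n.+1))%:E <= (c * S)%:E)%E.
Proof.
move=> c0 mD IS.
rewrite (eq_integral (fun z => c%:E * (enorm z ^+ j / enorm z ^+ n.+1)%:E)%E); last first.
  by move=> z _; rewrite EFinM.
rewrite ge0_integralZl_EFin//.
- by rewrite EFinM lee_wpmul2l.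
- by move=> z _; rewrite lee_fin kernel_ge0.
- by apply/measurable_EFinP; exact: measurable_kernel.
Qed.

Lemma frac_const_ge0 : 0 <= frac_const n :> R.
Proof.
case: n => [|m] //=; rewrite invr_ge0 Rintegral_ge0// => z _.
by rewrite divr_ge0 ?exprn_ge0 ?enorm_ge0// subr_ge0 cos_le1.
Qed.

(** Averaging the integral with its image under z -> -z replaces the first difference by the second
    difference, which is quadratic in z. The local bound [Q] does not enter the estimate: it makes
    the integrand bounded off the ball of radius [d], so that the two integrals may be added. *)
Lemma kernel_integral_annulus_bound f x (N Q d k : R) :
  0 <= N -> 0 < d -> 0 < k -> measurable_fun setT f ->
  (forall z, enorm z < k -> `|f (x + z) - f x| <= Q) ->
  (forall z, `|f (x + z) + f (x - z) - 2 * f x| <= 2 * N * enorm z ^+ 2) ->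
  `|kernel_integral [set z | d < enorm z < k] f x| <= N * (4 * 4 ^+ n * k).
Proof.
move=> N0 d0 k0 mf fQ fN.
pose D := [set z : 'rV[R]_n | d < enorm z < k].
have mD : measurable D by exact: (measurable_enorm_preimage `]d, k[%classic).
pose g z := (f (x + z) - f x) / enorm z ^+ n.+1.
have mker : measurable_fun setT (fun z : 'rV[R]_n => (enorm z ^+ n.+1)^-1).
  have := @measurable_kernel R n 0 setT; apply: eq_measurable_fun => z _.
  by rewrite expr0 mul1r.
have mg : measurable_fun setT g.
  apply: measurable_funM => //; apply: measurable_funB => //.
  apply: (eq_measurable_fun (f \o (fun z => z + x))).
    by move=> z _; rewrite /= addrC.
  by apply: measurableT_comp => //; exact: measurable_shift_rV.
have mgN : measurable_fun setT (g \o -%R).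
  by apply: measurableT_comp => //; exact: measurable_opp_rV.
have muD : (mu D < +oo)%E.
  apply: (@le_lt_trans _ _ ((2 * k) ^+ n)%:E); last exact: ltry.
  apply: le_trans (lebesgue_rV_ball _ (ltW k0)); apply: le_measure; rewrite ?inE//.
    exact: (measurable_enorm_preimage `]-oo, k[%classic).
  by move=> z /andP[].
have gQ z : D z -> `|g z| <= `|Q| / d ^+ n.+1.
  move=> /andP[dz zk]; rewrite normrM ler_pM//.
    exact: le_trans (fQ _ zk) (ler_norm _).
  rewrite ger0_norm ?invr_ge0 ?exprn_ge0 ?enorm_ge0//.
  rewrite lef_pV2 ?posrE ?exprn_gt0//; last exact: lt_trans dz.
  by rewrite lerXn2r ?nnegrE ?enorm_ge0// ltW.
have sD z : D z -> D (- z) by rewrite /D /= enormN.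
have ig : mu.-integrable D (EFin \o g).
  apply: measurable_bounded_integrable => //; first exact: measurable_funTS.
  by exists (`|Q| / d ^+ n.+1); split; rewrite ?num_real// => M hM z Dz; exact: le_trans (gQ _ Dz) (ltW hM).
have igN : mu.-integrable D (EFin \o (g \o -%R)).
  apply: measurable_bounded_integrable => //; first exact: measurable_funTS.
  by exists (`|Q| / d ^+ n.+1); split; rewrite ?num_real// => M hM z Dz; exact: le_trans (gQ _ (sD _ Dz)) (ltW hM).
have E1 : kernel_integral D f x = \int[mu]_(z in D) g (- z).
  rewrite /kernel_integral /Rintegral (integral_opp_rV D (EFin \o g))//.
  exact/measurable_EFinP.
have E0 : kernel_integral D f x = \int[mu]_(z in D) g z by [].
have E2 : 2 * kernel_integral D f x = \int[mu]_(z in D) (g z + g (- z)).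
  by rewrite [RHS]RintegralD// mulr_natl mulr2n {2}E1 E0.
have sumE z : g z + g (- z) = (f (x + z) + f (x - z) - 2 * f x) / enorm z ^+ n.+1.
  by rewrite /g enormN; ring.
have B z : `|g z + g (- z)| <= 2 * N * (enorm z ^+ 2 / enorm z ^+ n.+1).
  rewrite sumE normrM mulrA ler_pM//.
  by rewrite (ger0_norm (x := _^-1))// invr_ge0 exprn_ge0// enorm_ge0.
have G0 z : 0 <= 2 * N * (enorm z ^+ 2 / enorm z ^+ n.+1) by exact: le_trans (B z).
have S : (\int[mu]_(z in D) (2 * N * (enorm z ^+ 2 / enorm z ^+ n.+1))%:E <=
    (2 * N * (4 * 4 ^+ n * k))%:E)%E.
  by apply: kernel_integralZ_le; [exact: mulr_ge0|exact: mD|exact: kernel_core].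
have H : - (2 * N * (4 * 4 ^+ n * k)) <= 2 * kernel_integral D f x <= 2 * N * (4 * 4 ^+ n * k).
  rewrite E2; apply/andP; split.
    apply: Rintegral_ge_any S => // z _; rewrite lerNl.
    by apply: le_trans (B z); rewrite -normrN ler_norm.
  by apply: Rintegral_le_any S => // z _; apply: le_trans (B z); exact: ler_norm.
by rewrite ler_norml; lra.
Qed.

Lemma nonlocal_near_bound f x (N Q eps k : R) :
  0 <= N -> 0 <= eps -> 0 < k -> measurable_fun setT f ->
  (forall z, enorm z < k -> `|f (x + z) - f x| <= Q) ->
  (forall z, `|f (x + z) + f (x - z) - 2 * f x| <= 2 * N * enorm z ^+ 2) ->
  `|nonlocal_near eps k f x| <= eps * frac_const n * (N * (4 * 4 ^+ n * k)).
Proof.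
move=> N0 e0 k0 mf fQ fN; rewrite /nonlocal_near normrN normrM.
rewrite (ger0_norm (x := eps * _)); last by rewrite mulr_ge0// frac_const_ge0.
rewrite ler_wpM2l//; first by rewrite mulr_ge0// frac_const_ge0.
set F := (F in lim F).
(* A divergent [lim] takes the default value 0, for which the bound is trivial. *)
have [cF|/dvgP ->] := pselect (cvg F); last first.
  by rewrite normr0 !mulr_ge0// ?exprn_ge0// ltW.
have FB : \forall d \near (0 : R)^'+,
    `|kernel_integral [set z | d < enorm z < k] f x| <= N * (4 * 4 ^+ n * k).
  by near=> d; apply: kernel_integral_annulus_bound (fQ) (fN).
rewrite ler_norml; apply/andP; split.
  by apply: limr_ge => //; apply: filterS FB => d; rewrite ler_norml => /andP[].
by apply: limr_le => //; apply: filterS FB => d; rewrite ler_norml => /andP[].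
Unshelve. all: by end_near. Qed.

Lemma nonlocal_far_ge f x (S eps k : R) (G : 'rV[R]_n -> R) :
  0 <= eps -> (forall z, 0 <= G z) -> (forall z, f (x + z) - f x <= G z) ->
  (\int[mu]_(z in [set z | (k <= enorm z)%R]) (G z / enorm z ^+ n.+1)%:E <= S%:E)%E ->
  - (eps * frac_const n * S) <= nonlocal_far eps k f x.
Proof.
move=> e0 G0 fG GS; rewrite /nonlocal_far lerN2 ler_wpM2l//.
  by rewrite mulr_ge0// frac_const_ge0.
apply: Rintegral_le_any GS => z _; first by rewrite divr_ge0// exprn_ge0// enorm_ge0.
by rewrite ler_wpM2r// invr_ge0 exprn_ge0// enorm_ge0.
Qed.

Lemma nonlocal_far_le f x (S eps k : R) (G : 'rV[R]_n -> R) :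
  0 <= eps -> (forall z, 0 <= G z) -> (forall z, f x - f (x + z) <= G z) ->
  (\int[mu]_(z in [set z | (k <= enorm z)%R]) (G z / enorm z ^+ n.+1)%:E <= S%:E)%E ->
  nonlocal_far eps k f x <= eps * frac_const n * S.
Proof.
move=> e0 G0 fG GS; rewrite /nonlocal_far -mulrN ler_wpM2l//.
  by rewrite mulr_ge0// frac_const_ge0.
rewrite lerNl; apply: Rintegral_ge_any GS => z _.
  by rewrite divr_ge0// exprn_ge0// enorm_ge0.
rewrite -mulNr ler_wpM2r//; first by rewrite invr_ge0 exprn_ge0// enorm_ge0.
by rewrite lerNl opprB.
Qed.

End kernel_integrals.

(** * Test functions *)

Section bump_function.
Context {R : realType}.
Implicit Types x s z : R.

(* A smooth step: bounded with bounded derivatives, at least 1/2 off (-1, 1).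
   It localizes maxima without affecting the nonlocal term in the limit. *)
Definition hb x : R := 1 - (1 + x ^+ 2)^-1.
Definition hb' x : R := 2 * x * (1 + x ^+ 2) ^- 2.
Definition hb'' x : R := 2 * (1 + x ^+ 2) ^- 2 - 8 * x ^+ 2 * (1 + x ^+ 2) ^- 3.

Lemma onepsq_gt0 x : 0 < 1 + x ^+ 2.
Proof. by rewrite ltr_wpDr ?sqr_ge0. Qed.

Lemma onepsq_neq0 x : 1 + x ^+ 2 != 0.
Proof. by rewrite gt_eqF// onepsq_gt0. Qed.

Lemma is_derive_onepsq x : is_derive x (1 : R) (fun y : R => 1 + y ^+ 2) (2 * x).
Proof.
have H := is_deriveD (is_derive_cst (1 : R) x 1) (is_deriveX 2 (is_derive_id x (1 : R))).
by apply: (is_derive_eq H); rewrite add0r /= expr1 /GRing.scale/= mulr1.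
Qed.

Lemma is_derive_invsq x : is_derive x (1 : R) (fun y : R => (1 + y ^+ 2)^-1)
  (- (2 * x * (1 + x ^+ 2) ^- 2)).
Proof.
have H := @is_deriveV R (fun y => 1 + y ^+ 2) x _ 1 (onepsq_neq0 x) (is_derive_onepsq x).
apply: (is_derive_eq H).
by rewrite /GRing.scale/=; ring.
Qed.

Lemma is_derive_hb x : is_derive x 1 hb (hb' x).
Proof.
have H := is_deriveB (is_derive_cst (1 : R) x 1) (is_derive_invsq x).
by apply: (is_derive_eq H); rewrite /hb' sub0r opprK.
Qed.

Lemma is_derive_hb' x : is_derive x 1 hb' (hb'' x).
Proof.
have H1 := is_deriveZ (2 : R) (is_derive_id x (1 : R)).
have H2 := is_deriveX 2 (is_derive_invsq x).
have H := is_deriveM H1 H2.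
have E : hb' = (2 \*: id) * ((fun y : R => (1 + y ^+ 2)^-1) ^+ 2).
  by apply/funext => y; rewrite !fctE /hb' -exprVn.
rewrite E; apply: (is_derive_eq H); rewrite /hb'' /GRing.scale/=.
have := onepsq_neq0 x; set w := 1 + _ => w0.
rewrite (_ : (_ ^+ 2) x = w^-1 ^+ 2)// -[2 *: x]/(2 * x); field.
exact: w0.
Qed.

Lemma hb_ge0 x : 0 <= hb x.
Proof. by rewrite /hb subr_ge0 invf_le1 ?onepsq_gt0// lerDl sqr_ge0. Qed.

Lemma hb_le1 x : hb x <= 1.
Proof. by rewrite /hb gerBl invr_ge0 ltW// onepsq_gt0. Qed.

Lemma hb_ge_half x : 1 <= `|x| -> 1 / 2 <= hb x.
Proof.
move=> x1; have : 1 <= x ^+ 2 by rewrite -real_normK ?num_real// exprn_ege1.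
move=> h; rewrite /hb; have : (1 + x ^+ 2)^-1 <= 2^-1.
  by rewrite lef_pV2 ?posrE ?onepsq_gt0//; lra.
by lra.
Qed.

Lemma hb0 : hb 0 = 0.
Proof. by rewrite /hb expr0n/= addr0 invr1 subrr. Qed.

Lemma hb_lipschitz x s : `|hb s - hb x| <= `|s - x|.
Proof.
have E : hb s - hb x = (s - x) * ((s + x) / ((1 + x ^+ 2) * (1 + s ^+ 2))).
  rewrite /hb; have := onepsq_neq0 x; have := onepsq_neq0 s => a b; field.
  by rewrite a b.
have P : 0 < (1 + x ^+ 2) * (1 + s ^+ 2) by rewrite mulr_gt0 ?onepsq_gt0.
rewrite E normrM ler_piMr// normrM [X in _ * X]ger0_norm ?invr_ge0 ?(ltW P)//.
rewrite ler_pdivrMr// mul1r.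
have := sqr_ge0 (x - 1); have := sqr_ge0 (s - 1); have := sqr_ge0 (x + 1).
have := sqr_ge0 (s + 1); have := mulr_ge0 (sqr_ge0 x) (sqr_ge0 s).
by rewrite ler_norml => *; apply/andP; split; nra.
Qed.

Lemma hb'_bound x : `|hb' x| <= 1.
Proof.
have P : 0 < (1 + x ^+ 2) ^+ 2 by rewrite exprn_gt0 ?onepsq_gt0.
rewrite /hb' normrM [X in _ * X]ger0_norm ?invr_ge0 ?(ltW P)//.
rewrite ler_pdivrMr// mul1r ler_norml; apply/andP; split; nra.
Qed.

(** The first order Taylor remainder is exactly s^2 times a bounded rational function; the linear
    terms at z and -z cancel. *)
Lemma hb_second_difference x z : `|hb (x + z) + hb (x - z) - 2 * hb x| <= 2 * 2 * z ^+ 2.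
Proof.
have A s : `|hb (x + s) - hb x - hb' x * s| <= 2 * s ^+ 2.
  have E : hb (x + s) - hb x - hb' x * s =
      s ^+ 2 * ((1 - x ^+ 2 - 2 * x * (x + s)) / ((1 + x ^+ 2) ^+ 2 * (1 + (x + s) ^+ 2))).
    rewrite /hb /hb'; have := onepsq_neq0 x; have := onepsq_neq0 (x + s) => a b; field.
    by rewrite a b.
  have P : 0 < (1 + x ^+ 2) ^+ 2 * (1 + (x + s) ^+ 2).
    by rewrite mulr_gt0 ?exprn_gt0 ?onepsq_gt0.
  rewrite E normrM ger0_norm ?sqr_ge0// mulrC ler_wpM2r ?sqr_ge0//.
  rewrite normrM [X in _ * X]ger0_norm ?invr_ge0 ?(ltW P)// ler_pdivrMr//.
  set y := x + s; have Q : (1 + x ^+ 2) * (1 + y ^+ 2) <= (1 + x ^+ 2) ^+ 2 * (1 + y ^+ 2).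
    rewrite ler_pM2r ?onepsq_gt0// expr2 ler_peMr ?(ltW (onepsq_gt0 _))//.
    by rewrite lerDl sqr_ge0.
  have Q2 : `|1 - x ^+ 2 - 2 * x * y| <= 2 * ((1 + x ^+ 2) * (1 + y ^+ 2)).
    by rewrite ler_norml; apply/andP; split; nra.
  by lra.
have := A z; have := A (- z); rewrite sqrrN !ler_norml => /andP[a b] /andP[c d].
by apply/andP; split; lra.
Qed.

Lemma continuous_onepsqV k : continuous (fun x : R => (1 + x ^+ 2) ^- k).
Proof.
move=> x; apply: cvgV; first by rewrite expf_neq0 ?onepsq_neq0.
apply: (continuous_comp (f := fun x : R => 1 + x ^+ 2) (g := fun y => y ^+ k)).
  by apply: cvgD; [exact: cvg_cst|exact: exprn_continuous].
exact: exprn_continuous.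
Qed.

Lemma continuous_hb : continuous hb.
Proof.
move=> x; apply: cvgB; first exact: cvg_cst.
exact: (continuous_onepsqV 1).
Qed.

Lemma continuous_hb' : continuous hb'.
Proof.
move=> x; apply: cvgM; last exact: continuous_onepsqV.
by apply: cvgM; [exact: cvg_cst|exact: cvg_id].
Qed.

Lemma continuous_hb'' : continuous hb''.
Proof.
move=> x; apply: cvgB; apply: cvgM.
- exact: cvg_cst.
- exact: continuous_onepsqV.
- by apply: cvgM; [exact: cvg_cst|exact: exprn_continuous].
- exact: continuous_onepsqV.
Qed.

End bump_function.

Lemma is_derive_difference_quotient (R : realType) (f : R -> R) (t l : R) :
  is_derive t (1 : R) f l -> (f s - f t) / (s - t) @[s --> t^'] --> l.
Proof.
move=> [D <-].
have shift0 : (s - t) @[s --> t^'] --> (0 : R)^'.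
  move=> S S0; have : (s - t) @[s --> t] --> t - t.
    by apply: cvgB; [exact: cvg_id|exact: cvg_cst].
  rewrite subrr => /(_ (fun h => h != 0 -> S h) S0) H.
  rewrite /nbhs/= in H; apply: (@filterS _ (nbhs t) _ _ _ _ H) => s /= Hs st.
  by apply: Hs; rewrite subr_eq0.
have := cvg_comp _ _ shift0 D; rewrite -/('D_1 f t); apply: cvg_trans.
apply: near_eq_cvg; near=> s => /=.
by rewrite /GRing.scale/= mulr1 subrK mulrC.
Unshelve. all: by end_near. Qed.

Section separable_functions.
Context {R : realType} {n : nat}.
Implicit Types (k dk : 'I_n -> R -> R) (x : 'rV[R]_n) (i j : 'I_n).

(** Along a coordinate direction only one summand moves, so the difference quotient is literally
    that of a function of one real variable. *)
Lemma is_derive_separable (c : R) k x i (d : R) :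
  is_derive (x ord0 i) 1 (k i) d ->
  is_derive x (delta_mx ord0 i) (fun x : 'rV[R]_n => c + \sum_j k j (x ord0 j)) d.
Proof.
move=> [dk <-].
have E : (fun h : R => h^-1 *: (((fun x : 'rV[R]_n => c + \sum_j k j (x ord0 j)) \o shift x)
     (h *: delta_mx ord0 i) - (c + \sum_j k j (x ord0 j)))) =
   (fun h : R => h^-1 *: ((k i \o shift (x ord0 i)) (h *: 1) - k i (x ord0 i))).
  apply/funext => h /=; congr (_ *: _); rewrite opprD addrACA subrr add0r -sumrB.
  rewrite (bigD1 i)//= big1 ?addr0; last first.
    move=> j ji; rewrite !mxE (negbTE ji) andbF mulr0 add0r subrr//.
  by rewrite !mxE !eqxx.
by apply: DeriveDef; [rewrite /derivable E|rewrite /derive E].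
Qed.

Lemma continuous_coord_comp (f : R -> R) i :
  continuous f -> continuous (fun p : R * 'rV[R]_n => f (p.2 ord0 i)).
Proof.
move=> cf p.
apply: (continuous_comp (f := fun p : R * 'rV[R]_n => p.2 ord0 i) (g := f)); last exact: cf.
apply: (continuous_comp (f := snd) (g := fun x : 'rV[R]_n => x ord0 i)).
  exact: cvg_snd.
exact: coord_continuous.
Qed.

Lemma continuous_time_comp (f : R -> R) :
  continuous f -> continuous (fun p : R * 'rV[R]_n => f p.1).
Proof.
by move=> cf p; apply: (continuous_comp (f := fst) (g := f)); [exact: cvg_fst|exact: cf].
Qed.

End separable_functions.

Lemma continuous_bigsum (R : realType) (X : topologicalType) (I : Type) (s : seq I)
    (f : I -> X -> R) :
  (forall i, continuous (f i)) -> continuous (fun x => \sum_(i <- s) f i x).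
Proof.
move=> cf; elim: s => [|i s IH] x.
  under [fun _ => _]eq_fun do rewrite big_nil.
  exact: cvg_cst.
under [fun _ => _]eq_fun do rewrite big_cons.
by apply: cvgD; [exact: cf|exact: IH].
Qed.

Lemma measurable_fun_bigsum_coord (R : realType) (n : nat) (f : 'I_n -> R -> R) :
  (forall i, continuous (f i)) ->
  measurable_fun [set: 'rV[R]_n] (fun x : 'rV[R]_n => \sum_i f i (x ord0 i)).
Proof.
move=> cf; apply: measurable_sum => i.
apply: (measurableT_comp (f := f i)); last exact: measurable_coord.
exact: continuous_measurable_fun.
Qed.

Section test_functions.
Context {R : realType} {n : nat}.
Variables (c c' a a' : R -> R) (y : 'rV[R]_n) (B : R) (z0 : 'rV[R]_n) (r : R).
Hypothesis dc : forall t : R, is_derive t (1 : R) c (c' t).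
Hypothesis da : forall t : R, is_derive t (1 : R) a (a' t).
Hypothesis cc' : continuous c'.
Hypothesis ca' : continuous a'.
Hypothesis r0 : 0 < r.

(** Every test function of the proof is a function of time, plus a time-dependent multiple of |x -
    y|^2, plus a bump centred at [z0]. This class is a sum over coordinates and is stable under
    change of sign. *)
Definition tcomp (t : R) (i : 'I_n) (s : R) : R :=
  a t * (s - y ord0 i) ^+ 2 + B * hb ((s - z0 ord0 i) / r).

Definition tfun (t : R) (x : 'rV[R]_n) : R := c t + \sum_i tcomp t i (x ord0 i).

Definition tcomp' (t : R) (i : 'I_n) (s : R) : R :=
  2 * a t * (s - y ord0 i) + B / r * hb' ((s - z0 ord0 i) / r).

Definition tcomp'' (t : R) (i : 'I_n) (s : R) : R :=
  2 * a t + B / r ^+ 2 * hb'' ((s - z0 ord0 i) / r).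

Lemma is_derive_affine (u s : R) : is_derive s (1 : R) (fun s : R => (s - u) / r) r^-1.
Proof.
have H := is_deriveM (is_deriveB (is_derive_id s (1 : R)) (is_derive_cst u s (1 : R)))
  (is_derive_cst r^-1 s (1 : R)).
by apply: (is_derive_eq H); rewrite /GRing.scale/= mulr0 add0r subr0 mulr1.
Qed.

Lemma is_derive_tcomp t i s : is_derive s (1 : R) (tcomp t i) (tcomp' t i s).
Proof.
have L : is_derive s (1 : R) (fun s : R => s - y ord0 i) 1.
  have H := is_deriveB (is_derive_id s (1 : R)) (is_derive_cst (y ord0 i) s (1 : R)).
  by apply: (is_derive_eq H); rewrite subr0.
have H1 := is_deriveZ (a t) (is_deriveX 2 L).
have H2 := is_deriveZ B (@is_derive1_comp R hb (fun s => (s - z0 ord0 i) / r) s _ _ (is_derive_hb ((s - z0 ord0 i) / r))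
  (is_derive_affine (z0 ord0 i) s)).
apply: (is_derive_eq (is_deriveD H1 H2)).
by rewrite /tcomp' /GRing.scale/=; ring.
Qed.

Lemma is_derive_tcomp' t i s : is_derive s (1 : R) (tcomp' t i) (tcomp'' t i s).
Proof.
have L : is_derive s (1 : R) (fun s : R => s - y ord0 i) 1.
  have H := is_deriveB (is_derive_id s (1 : R)) (is_derive_cst (y ord0 i) s (1 : R)).
  by apply: (is_derive_eq H); rewrite subr0.
have H1 := is_deriveZ (2 * a t) L.
have H2 := is_deriveZ (B / r) (@is_derive1_comp R hb' (fun s => (s - z0 ord0 i) / r) s _ _ (is_derive_hb' ((s - z0 ord0 i) / r))
  (is_derive_affine (z0 ord0 i) s)).
apply: (is_derive_eq (is_deriveD H1 H2)).
rewrite /tcomp'' /GRing.scale/=; field.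
by rewrite gt_eqF.
Qed.

Lemma is_derive_tfun t x i :
  is_derive x (delta_mx ord0 i) (tfun t) (tcomp' t i (x ord0 i)).
Proof. by apply: is_derive_separable; exact: is_derive_tcomp. Qed.

Lemma partial_tfun t i : partial i (tfun t) = fun x => tcomp' t i (x ord0 i).
Proof. by apply/funext => x; have [_] := is_derive_tfun t x i. Qed.

Lemma grad_tfun t x : grad (tfun t) x = \row_i tcomp' t i (x ord0 i).
Proof. by apply/rowP => i; rewrite !mxE partial_tfun. Qed.

Lemma is_derive_partial_tfun t x i j :
  is_derive x (delta_mx ord0 j) (partial i (tfun t))
    (if j == i then tcomp'' t i (x ord0 i) else 0).
Proof.
rewrite partial_tfun.
have -> : (fun x : 'rV[R]_n => tcomp' t i (x ord0 i)) =
    (fun x => 0 + \sum_j (if j == i then tcomp' t i else cst 0) (x ord0 j)).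
  apply/funext => u; rewrite add0r (bigD1 i)//= eqxx big1 ?addr0// => l li.
  by rewrite (negbTE li).
apply: (is_derive_separable 0 (fun j => if j == i then tcomp' t i else cst 0)).
case: eqP => [->|_]; first exact: is_derive_tcomp'.
exact: is_derive_cst.
Qed.

Lemma continuous_a : continuous a.
Proof.
move=> t; apply: differentiable_continuous; apply/derivable1_diffP.
by have [] := da t.
Qed.

Lemma continuous_c : continuous c.
Proof.
move=> t; apply: differentiable_continuous; apply/derivable1_diffP.
by have [] := dc t.
Qed.

Lemma continuous_affine (u : R) : continuous (fun s : R => (s - u) / r).
Proof.
by move=> s; apply: cvgM; [apply: cvgB; [exact: cvg_id|exact: cvg_cst]|exact: cvg_cst].
Qed.

Lemma continuous_tcomp_pair i : continuous (fun p : R * 'rV[R]_n => tcomp p.1 i (p.2 ord0 i)).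
Proof.
move=> p; apply: cvgD; apply: cvgM.
- exact: (continuous_time_comp _ continuous_a).
- apply: (continuous_coord_comp (fun s => (s - y ord0 i) ^+ 2)) => s.
  apply: (continuous_comp (f := fun s : R => s - y ord0 i) (g := fun u => u ^+ 2)).
    by apply: cvgB; [exact: cvg_id|exact: cvg_cst].
  exact: exprn_continuous.
- exact: cvg_cst.
- apply: (continuous_coord_comp (fun s => hb ((s - z0 ord0 i) / r))) => s.
  apply: (continuous_comp (f := fun s : R => (s - z0 ord0 i) / r) (g := hb)); first exact: continuous_affine.
  exact: continuous_hb.
Qed.

Lemma continuous_tfun : continuous (fun p : R * 'rV[R]_n => tfun p.1 p.2).
Proof.
move=> p; apply: cvgD; first exact: (continuous_time_comp _ continuous_c).
by apply: continuous_bigsum => i; exact: continuous_tcomp_pair.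
Qed.

Lemma is_derive_tfun_time (t : R) x :
  is_derive t (1 : R) (fun s => tfun s x) (c' t + a' t * \sum_i (x ord0 i - y ord0 i) ^+ 2).
Proof.
have E : (fun s => tfun s x) = (c + (fun s => a s * \sum_i (x ord0 i - y ord0 i) ^+ 2))
    + cst (\sum_i B * hb ((x ord0 i - z0 ord0 i) / r)).
  apply/funext => s; rewrite !fctE /tfun /tcomp big_split/= mulr_sumr addrA//.
rewrite E.
have H := is_deriveD (is_deriveD (dc t) (is_deriveM (da t)
  (is_derive_cst (\sum_i (x ord0 i - y ord0 i) ^+ 2) t (1 : R))))
  (is_derive_cst (\sum_i B * hb ((x ord0 i - z0 ord0 i) / r)) t (1 : R)).
by apply: (is_derive_eq H); rewrite addr0 /GRing.scale/= mulr0 add0r mulrC.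
Qed.

Lemma derive1_tfun t x : derive1 (fun s => tfun s x) t =
  c' t + a' t * \sum_i (x ord0 i - y ord0 i) ^+ 2.
Proof. by rewrite derive1E; have [] := is_derive_tfun_time t x. Qed.

Lemma C12_tfun (T : R) : C12 T tfun.
Proof.
split.
- by apply: continuous_subspaceT; exact: continuous_tfun.
- exists (fun t x => c' t + a' t * \sum_i (x ord0 i - y ord0 i) ^+ 2); split.
    apply: continuous_subspaceT => p; apply: cvgD.
      exact: (continuous_time_comp _ cc').
    apply: cvgM; first exact: (continuous_time_comp _ ca').
    apply: continuous_bigsum => i.
    apply: (continuous_coord_comp (fun s => (s - y ord0 i) ^+ 2)) => s.
    apply: (continuous_comp (f := fun s : R => s - y ord0 i) (g := fun u => u ^+ 2)).
      by apply: cvgB; [exact: cvg_id|exact: cvg_cst].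
    exact: exprn_continuous.
  move=> t x _; apply: cvg_within_filter.
  exact: is_derive_difference_quotient (is_derive_tfun_time t x).
- move=> i; split.
    by move=> t x _; have [] := is_derive_tfun t x i.
  apply: continuous_subspaceT => p.
  under [fun _ => _]eq_fun do rewrite partial_tfun.
  apply: cvgD; apply: cvgM.
  + apply: cvgM; first exact: cvg_cst.
    exact: (continuous_time_comp _ continuous_a).
  + apply: (continuous_coord_comp (fun s => s - y ord0 i)) => s.
    by apply: cvgB; [exact: cvg_id|exact: cvg_cst].
  + exact: cvg_cst.
  + apply: (continuous_coord_comp (fun s => hb' ((s - z0 ord0 i) / r))) => s.
    apply: (continuous_comp (f := fun s : R => (s - z0 ord0 i) / r) (g := hb')); first exact: continuous_affine.
    exact: continuous_hb'.
- move=> i j; split.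
    by move=> t x _; have [] := is_derive_partial_tfun t x i j.
  apply: continuous_subspaceT.
  rewrite (_ : (fun p => _) = fun p : R * 'rV[R]_n =>
      if j == i then tcomp'' p.1 i (p.2 ord0 i) else 0); last first.
    by apply/funext => p; have [_] := is_derive_partial_tfun p.1 p.2 i j.
  move=> p; case: eqP => _; last exact: cvg_cst.
  apply: cvgD; apply: cvgM.
  + exact: cvg_cst.
  + exact: (continuous_time_comp _ continuous_a).
  + exact: cvg_cst.
  + apply: (continuous_coord_comp (fun s => hb'' ((s - z0 ord0 i) / r))) => s.
    apply: (continuous_comp (f := fun s : R => (s - z0 ord0 i) / r) (g := hb'')); first exact: continuous_affine.
    exact: continuous_hb''.
Qed.

Lemma measurable_tfun t : measurable_fun [set: 'rV[R]_n] (tfun t).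
Proof.
apply: measurable_funD => //; apply: measurable_fun_bigsum_coord => i s.
apply: differentiable_continuous; apply/derivable1_diffP.
by have [] := is_derive_tcomp t i s.
Qed.

Lemma tfun_second_difference t x z :
  `|tfun t (x + z) + tfun t (x - z) - 2 * tfun t x| <=
  2 * (`|a t| + 2 * `|B| / r ^+ 2) * enorm z ^+ 2.
Proof.
have -> : tfun t (x + z) + tfun t (x - z) - 2 * tfun t x =
    \sum_i (tcomp t i (x ord0 i + z ord0 i) + tcomp t i (x ord0 i - z ord0 i)
      - 2 * tcomp t i (x ord0 i)).
  rewrite sumrB big_split/= -mulr_sumr /tfun.
  have -> : \sum_i tcomp t i ((x + z) ord0 i) = \sum_i tcomp t i (x ord0 i + z ord0 i).
    by apply: eq_bigr => i _; rewrite mxE.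
  have -> : \sum_i tcomp t i ((x - z) ord0 i) = \sum_i tcomp t i (x ord0 i - z ord0 i).
    by apply: eq_bigr => i _; rewrite !mxE.
  by ring.
rewrite enorm_sqr mulr_sumr; apply: (le_trans (ler_norm_sum _ _ _)).
apply: ler_sum => i _; set s := x ord0 i; set w := z ord0 i.
have -> : tcomp t i (s + w) + tcomp t i (s - w) - 2 * tcomp t i s =
    a t * (2 * w ^+ 2) + B * (hb ((s - z0 ord0 i) / r + w / r) +
      hb ((s - z0 ord0 i) / r - w / r) - 2 * hb ((s - z0 ord0 i) / r)).
  have e1 : (s + w - z0 ord0 i) / r = (s - z0 ord0 i) / r + w / r by ring.
  have e2 : (s - w - z0 ord0 i) / r = (s - z0 ord0 i) / r - w / r by ring.
  by rewrite /tcomp e1 e2; ring.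
apply: (le_trans (ler_normD _ _)); rewrite (normrM (a t)) (normrM B).
rewrite (ger0_norm (x := 2 * w ^+ 2)); last by rewrite mulr_ge0// sqr_ge0.
have H := hb_second_difference ((s - z0 ord0 i) / r) (w / r).
have : `|B| * `|hb ((s - z0 ord0 i) / r + w / r) +
      hb ((s - z0 ord0 i) / r - w / r) - 2 * hb ((s - z0 ord0 i) / r)|
    <= `|B| * (2 * 2 * (w / r) ^+ 2) by rewrite ler_wpM2l.
rewrite exprMn exprVn; set q := (r ^+ 2)^-1 => H2; nra.
Qed.

(** Supplies the local bound [Q] of [nonlocal_near_bound]; its value is irrelevant there. *)
Lemma tfun_diff_bound t x k : exists Q, forall z, enorm z < k ->
  `|tfun t (x + z) - tfun t x| <= Q.
Proof.
exists (\sum_i (`|a t| * (k * (2 * `|x ord0 i - y ord0 i| + k)) + `|B|)) => z zk.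
have -> : tfun t (x + z) - tfun t x =
    \sum_i (tcomp t i (x ord0 i + z ord0 i) - tcomp t i (x ord0 i)).
  rewrite sumrB /tfun.
  have -> : \sum_i tcomp t i ((x + z) ord0 i) = \sum_i tcomp t i (x ord0 i + z ord0 i).
    by apply: eq_bigr => i _; rewrite mxE.
  by ring.
apply: (le_trans (ler_norm_sum _ _ _)); apply: ler_sum => i _.
have := le_lt_trans (enorm_coord z i) zk.
set s := x ord0 i; set w := z ord0 i; set v := y ord0 i => wk.
have -> : tcomp t i (s + w) - tcomp t i s = a t * (w * (2 * (s - v) + w)) +
    B * (hb ((s + w - z0 ord0 i) / r) - hb ((s - z0 ord0 i) / r)).
  by rewrite /tcomp -/v; ring.
apply: (le_trans (ler_normD _ _)); rewrite !normrM lerD//.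
  rewrite ler_wpM2l// ler_pM// ?(ltW wk)//.
  by apply: (le_trans (ler_normD _ _)); rewrite normrM ger0_norm// lerD2l ltW.
rewrite ler_piMr// ler_norml.
have := hb_ge0 ((s + w - z0 ord0 i) / r); have := hb_ge0 ((s - z0 ord0 i) / r).
have := hb_le1 ((s + w - z0 ord0 i) / r); have := hb_le1 ((s - z0 ord0 i) / r).
by move=> *; apply/andP; split; lra.
Qed.

End test_functions.

(** * Weak subsolutions *)

Section weak_subsolutions.
Context {R : realType} {n : nat}.
Local Notation mu := (@lebesgue_rV R n).

(* The nonlocal terms are replaced by upper bounds, so that u need not be
   measurable and sub- and supersolutions are exchanged by a sign change. *)
Definition weak_subsolution (T : R) (H : R -> 'rV[R]_n -> R -> 'rV[R]_n -> R)
    (eps : R) (u : R -> 'rV[R]_n -> R) : Prop :=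
  forall (c c' a a' : R -> R) (y : 'rV[R]_n) (B : R) (z0 : 'rV[R]_n) (r : R),
    (forall t : R, is_derive t (1 : R) c (c' t)) ->
    (forall t : R, is_derive t (1 : R) a (a' t)) ->
    continuous c' -> continuous a' -> 0 < r ->
  forall t x, 0 < t < T ->
    (forall s w, 0 <= s <= T ->
      u s w - tfun c a y B z0 r s w <= u t x - tfun c a y B z0 r t x) ->
  forall (k S : R) (G : 'rV[R]_n -> R), 0 < k < 1 ->
    (forall z, 0 <= G z) -> (forall z, u t (x + z) - u t x <= G z) ->
    (\int[mu]_(z in [set z | (k <= enorm z)%R]) (G z / enorm z ^+ n.+1)%:E <= S%:E)%E ->
    c' t + a' t * (\sum_i (x ord0 i - y ord0 i) ^+ 2) +
      H t x (u t x) (\row_i tcomp' a y B z0 r t i (x ord0 i)) <=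
    eps * frac_const n * ((`|a t| + 2 * `|B| / r ^+ 2) * (4 * 4 ^+ n * k) + S).

Definition dual_hamiltonian (H : R -> 'rV[R]_n -> R -> 'rV[R]_n -> R) t x u p :=
  - H t x (- u) (- p).

Lemma subsolution_weak T H eps u : 0 <= eps ->
  viscosity_subsolution T H eps u -> weak_subsolution T H eps u.
Proof.
move=> e0 [_ _ sub] c c' a a' y B z0 r dc da cc' ca' r0 t x tT mx k S G k01 G0 uG GS.
have k0 : 0 < k by case/andP: k01.
have := sub _ (C12_tfun c c' a a' y B z0 r dc da cc' ca' r0 T) t x tT mx k k01.
rewrite /visc_operator (derive1_tfun c c' a a')// grad_tfun//.
have [Q hQ] := tfun_diff_bound c a y B z0 r t x k.
have N0 : 0 <= `|a t| + 2 * `|B| / r ^+ 2.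
  by rewrite addr_ge0// divr_ge0 ?sqr_ge0// mulr_ge0.
have near := nonlocal_near_bound _ x _ Q eps k N0 e0 k0 (measurable_tfun c a y B z0 r t)
  hQ (tfun_second_difference c a y B z0 r t x).
have far := nonlocal_far_ge (u t) x S eps k G e0 G0 uG GS.
move: near; rewrite ler_norml => /andP[near _].
set P := nonlocal_near _ _ _ _ in near *; set F := nonlocal_far _ _ _ _ in far *.
by rewrite mulrDr; lra.
Qed.

(** A maximum of -u - phi is a minimum of u - (-phi), and -phi is again a [tfun], with [c], [a] and
    [B] negated. *)
Lemma supersolution_weak T H eps u : 0 <= eps ->
  viscosity_supersolution T H eps u ->
  weak_subsolution T (dual_hamiltonian H) eps (fun t x => - u t x).
Proof.
move=> e0 [_ _ sup] c c' a a' y B z0 r dc da cc' ca' r0 t x tT mx k S G k01 G0 uG GS.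
have k0 : 0 < k by case/andP: k01.
have dcN (s : R) : is_derive s (1 : R) (- c) (- c' s) by exact: is_deriveN.
have daN (s : R) : is_derive s (1 : R) (- a) (- a' s) by exact: is_deriveN.
have cc'N : continuous (fun s => - c' s) by move=> s; apply: cvgN; exact: cc'.
have ca'N : continuous (fun s => - a' s) by move=> s; apply: cvgN; exact: ca'.
have tN s w : tfun (- c) (- a) y (- B) z0 r s w = - tfun c a y B z0 r s w.
  rewrite /tfun opprD -sumrN; congr (_ + _); apply: eq_bigr => i _.
  by rewrite /tcomp opprD !mulNr.
have mn s w : 0 <= s <= T ->
    u t x - tfun (- c) (- a) y (- B) z0 r t x <= u s w - tfun (- c) (- a) y (- B) z0 r s w.
  by move=> sT; have := mx s w sT; rewrite !tN; lra.
have := sup _ (C12_tfun _ _ _ _ y (- B) z0 r dcN daN cc'N ca'N r0 T) t x tT mn k k01.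
rewrite /visc_operator (derive1_tfun _ _ _ _ y (- B) z0 r dcN daN)//.
rewrite (grad_tfun _ _ y (- B) z0 r)//.
have [Q hQ] := tfun_diff_bound (- c) (- a) y (- B) z0 r t x k.
have N0 : 0 <= `|a t| + 2 * `|B| / r ^+ 2.
  by rewrite addr_ge0// divr_ge0 ?sqr_ge0// mulr_ge0.
have sd := tfun_second_difference (- c) (- a) y (- B) z0 r t x.
rewrite !normrN in sd.
have near := nonlocal_near_bound _ x _ Q eps k N0 e0 k0
  (measurable_tfun (- c) (- a) y (- B) z0 r t) hQ sd.
have uG' z : u t x - u t (x + z) <= G z by apply: le_trans (uG z); lra.
have far := nonlocal_far_le (u t) x S eps k G e0 G0 uG' GS.
move: near; rewrite ler_norml => /andP[_ near].
rewrite /dual_hamiltonian opprK.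
have -> : - (\row_i tcomp' a y B z0 r t i (x ord0 i)) =
    \row_i tcomp' (- a) y (- B) z0 r t i (x ord0 i).
  by apply/rowP => i; rewrite !mxE /tcomp' opprD !mulNr mulrN mulNr.
set P := nonlocal_near _ _ _ _ in near *; set F := nonlocal_far _ _ _ _ in far *.
by rewrite mulrDr mulNr; lra.
Qed.

End weak_subsolutions.

(** * Uniform continuity at the initial time *)

Section strip_topology.
Context {R : realType} {n : nat}.
Variables (T : R) (u : R -> 'rV[R]_n -> R).
Hypothesis uc : continuous_on_strip T u.

Lemma continuous_on_strip_comp (X : topologicalType) (D : set X) (f : X -> R * 'rV[R]_n) :
  continuous f -> (forall p, D p -> strip T (f p)) ->
  {within D, continuous (fun p => u (f p).1 (f p).2)}.
Proof.
move=> cf fD; apply/subspace_continuousP => p Dp.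
have /subspace_continuousP/(_ _ (fD _ Dp)) := uc.
apply: cvg_comp => S; rewrite /within/= => HS.
have H := cf p _ HS; apply: (@filterS _ (nbhs p) _ _ _ _ H) => q Sq Dq.
by apply: Sq; exact: fD.
Qed.

(** Compactness of the box makes continuity at t = 0 uniform in x. The space point also varies
    within a neighbourhood, hence the two comparisons with [u 0 x], each costing e / 2. *)
Lemma uniform_initial_continuity (x0 : 'rV[R]_n) (r e : R) : 0 <= T -> 0 < e ->
  exists2 tau : R, 0 < tau & forall (t : R) (x : 'rV[R]_n), 0 <= t <= T -> t <= tau ->
    (forall i, `|x ord0 i - x0 ord0 i| <= r) -> `|u t x - u 0 x| <= e.
Proof.
move=> T0 e0.
pose K := [set x : 'rV[R]_n | forall i, `[x0 ord0 i - r, x0 ord0 i + r]%classic (x ord0 i)].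
have cK : compact K.
  apply: (@rV_compact R n (fun i => `[x0 ord0 i - r, x0 ord0 i + r]%classic)) => i.
  exact: segment_compact.
have := (compact_near_coveringP K).1 cK R (nbhs (0 : R))
  (fun t x => 0 <= t <= T -> `|u t x - u 0 x| <= e) _.
case.
  move=> x Kx.
  have S0 (x' : 'rV[R]_n) : strip T (0, x') by split => //=; rewrite in_itv/= lexx.
  have /subspace_continuousP/(_ _ (S0 x)) Hc := uc.
  have e2 : 0 < e / 2 by rewrite divr_gt0.
  move/cvgrPdist_le : Hc => /(_ _ e2)[[P Q] /= [P0 Qx] PQ].
  exists (Q, P) => //= -[x' t] /= [Qx' Pt] tT.
  have St : strip T (t, x') by split => //=; rewrite in_itv.
  have : `|u 0 x - u t x'| <= e / 2 := PQ (t, x') (conj Pt Qx') St.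
  have : `|u 0 x - u 0 x'| <= e / 2 := PQ (0, x') (conj (nbhs_singleton P0) Qx') (S0 x').
  rewrite !ler_norml => /andP[h1 h2] /andP[h3 h4]; apply/andP; split; lra.
move=> tau /= tau0 H.
exists (tau / 2); first by rewrite divr_gt0.
move=> t x /andP[t0 tT] tt Kx; apply: (H t) => //=.
- by rewrite /ball_/= sub0r normrN ger0_norm//; lra.
- by move=> i; rewrite /= in_itv/=; have := Kx i; rewrite ler_norml => /andP[a b]; apply/andP; split; lra.
- by rewrite t0.
Qed.
End strip_topology.

(** * Nonlocal contribution of the localizing bump *)

Section far_bump.
Context {R : realType} {n : nat}.
Local Notation mu := (@lebesgue_rV R n).

Lemma measurable_invkernel (D : set 'rV[R]_n) :
  measurable_fun D (fun z : 'rV[R]_n => (enorm z ^+ n.+1)^-1).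
Proof.
have := @measurable_kernel R n 0 D; apply: eq_measurable_fun => z _.
by rewrite expr0 mul1r.
Qed.

(** The integral is split at |z| = [rho]. Inside, the second argument of the minimum is at most 1 /
    [rho]; outside, the kernel itself has mass of order 1 / [rho]. This is why the bump has width
    [rho ^+ 2] rather than [rho]. *)
Lemma far_bump_integral (k rho c : R) : 0 <= c -> 0 < k -> k <= rho -> 0 < rho ->
  (\int[mu]_(z in [set z | (k <= enorm z)%R])
     (c * Num.min 1 (enorm z / rho ^+ 2) / enorm z ^+ n.+1)%:E
   <= (c * (2 * 4 ^+ n) * (k^-1 + 1) / rho)%:E)%E.
Proof.
move=> c0 k0 kr r0.
have mF D : measurable_fun D (fun z : 'rV[R]_n => c * Num.min 1 (enorm z / rho ^+ 2) / enorm z ^+ n.+1).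
  apply: measurable_funM; last exact: measurable_invkernel.
  apply: measurable_funM => //; apply: measurable_minr => //.
  by apply: measurable_funM => //; exact: measurable_enorm.
have F0 (z : 'rV[R]_n) : 0 <= c * Num.min 1 (enorm z / rho ^+ 2) / enorm z ^+ n.+1.
  rewrite divr_ge0 ?exprn_ge0 ?enorm_ge0// mulr_ge0// le_min ler01/=.
  by rewrite divr_ge0 ?exprn_ge0 ?enorm_ge0// ltW.
have -> : [set z : 'rV[R]_n | k <= enorm z] = annulus k rho `|` [set z | rho <= enorm z].
  apply/seteqP; split => z /=.
    move=> kz; have [h|h] := ltP (enorm z) rho; first by left; apply/andP.
    by right.
  by move=> [/andP[]//|]; exact: le_trans.
rewrite ge0_integral_setU//=; first last.
- apply/disj_setPRL => z /= h; rewrite /annulus/=; apply/negP; rewrite negb_and -!leNgt.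
  by rewrite h orbT.
- by move=> z _; rewrite lee_fin.
- exact/measurable_EFinP.
- exact: measurable_enorm_ge.
- exact: measurable_annulus.
rewrite mulrDr mulrDl EFinD; apply: leeD.
  apply: (@le_trans _ _ (\int[mu]_(z in annulus k rho)
     ((c / rho) * (enorm z ^+ 0 / enorm z ^+ n.+1))%:E)%E).
    apply: ge0_le_integral_any => z /=; first by rewrite lee_fin.
    move=> /andP[_ zr]; rewrite lee_fin expr0 mul1r ler_wpM2r ?invr_ge0 ?exprn_ge0 ?enorm_ge0//.
    rewrite ler_wpM2l// ge_min; apply/orP; right.
    rewrite expr2 invfM mulrA ler_piMl ?invr_ge0 ?(ltW r0)//.
    by rewrite ler_pdivrMr// mul1r ltW.
  have -> : c * (2 * 4 ^+ n) * k^-1 / rho = (c / rho) * (2 * 4 ^+ n / k) by ring.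
  apply: kernel_integralZ_le; first by rewrite divr_ge0// ltW.
    exact: measurable_annulus.
  apply: le_trans (kernel_tail _ k0); apply: ge0_subset_integral => //.
  - exact: measurable_annulus.
  - exact: measurable_enorm_ge.
  - by apply/measurable_EFinP; exact: measurable_kernel.
  - by move=> z _; rewrite lee_fin kernel_ge0.
  - by move=> z /andP[].
apply: (@le_trans _ _ (\int[mu]_(z in [set z | (rho <= enorm z)%R])
     (c * (enorm z ^+ 0 / enorm z ^+ n.+1))%:E)%E).
  apply: ge0_le_integral_any => z /=; first by rewrite lee_fin.
  move=> zr; rewrite lee_fin expr0 mul1r ler_wpM2r ?invr_ge0 ?exprn_ge0 ?enorm_ge0//.
  by rewrite ler_piMr// ge_min lexx.
have -> : c * (2 * 4 ^+ n) * 1 / rho = c * (2 * 4 ^+ n / rho) by ring.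
by apply: kernel_integralZ_le => //; [exact: measurable_enorm_ge|exact: kernel_tail].
Qed.

End far_bump.

Lemma enormZ (R : realType) (n : nat) (c : R) (x : 'rV[R]_n) :
  enorm (c *: x) = `|c| * enorm x.
Proof.
rewrite /enorm -(sqrtr_sqr c) -sqrtrM ?sqr_ge0// mulr_sumr; congr Num.sqrt.
by apply: eq_bigr => i _; rewrite mxE exprMn.
Qed.

(** * Structure of the Hamiltonian *)

Section hamiltonian.
Context {R : realType} {n : nat}.

Definition admissible (lambda L : R) (A : R -> R)
    (H : R -> 'rV[R]_n -> R -> 'rV[R]_n -> R) : Prop :=
  [/\ forall (t : R) (x p : 'rV[R]_n) (u v : R),
         H t x v p - H t x u p = lambda * (v - u),
      forall (t s u : R) (x y p : 'rV[R]_n),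
         `|H t x u p - H s y u p| <=
           L * (1 + enorm p) * (enorm (x - y) + `|t - s|) &
      forall r : R, 0 < r -> forall (t : R) (x : 'rV[R]_n) (u : R)
         (p q : 'rV[R]_n), enorm p < r -> enorm q < r ->
         `|H t x u p - H t x u q| <= A r * enorm (p - q)].

Lemma admissible_dual lambda L A H :
  admissible lambda L A H -> admissible lambda L A (dual_hamiltonian H).
Proof.
move=> [h2 h3 h4]; split; rewrite /dual_hamiltonian.
- move=> t x p u v; have := h2 t x (- p) (- u) (- v); lra.
- move=> t s u x y p; have := h3 t s (- u) x y (- p).
  by rewrite enormN => h; rewrite -normrN opprB opprK addrC.
- move=> r r0 t x u p q pr qr; have := h4 r r0 t x (- u) (- q) (- p).
  have -> : - q - - p = p - q by rewrite opprK addrC.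
  by rewrite !enormN => /(_ qr pr); rewrite opprK addrC.
Qed.

(** The gradient, the point and the value are changed one after the other, by local Lipschitz
    continuity in p, by (A3), and by monotonicity in the value, where [v <= u] is used. The gradient
    of the penalty has norm 2 [al] |x - y|, which turns (A3) into a linear and a quadratic term in
    |x - y|. *)
Lemma hamiltonian_doubling lambda L A H (t s u v al r0 : R) (x y p' : 'rV[R]_n) :
  admissible lambda L A H -> 0 <= lambda -> 0 <= L -> 0 <= al -> v <= u ->
  0 < r0 -> enorm ((2 * al) *: (x - y)) < r0 -> enorm p' < r0 ->
  - (L * enorm (x - y) + 2 * L * al * enorm (x - y) ^+ 2) - L * (1 + r0) * `|t - s|
    - `|A r0| * enorm (p' - (2 * al) *: (x - y))
  <= H t x u p' - H s y v ((2 * al) *: (x - y)).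
Proof.
move=> [h2 h3 h4] l0 L0 al0 vu r00 pr pr'.
set p := (2 * al) *: (x - y) in pr *; set d := enorm (x - y).
have d0 : 0 <= d by exact: enorm_ge0.
have pE : enorm p = 2 * al * d by rewrite enormZ ger0_norm// mulr_ge0.
have a2 := h2 s y p v u.
have a3 := h3 t s u x y p.
have a4 := h4 r0 r00 t x u p' p pr' pr.
have a5 : 0 <= lambda * (u - v) by rewrite mulr_ge0// subr_ge0.
have a6 : A r0 * enorm (p' - p) <= `|A r0| * enorm (p' - p).
  by rewrite ler_wpM2r ?enorm_ge0// ler_norm.
have a7 : L * (1 + enorm p) * `|t - s| <= L * (1 + r0) * `|t - s|.
  by rewrite ler_wpM2r// ler_wpM2l// lerD2l ltW.
have a8 : L * (1 + enorm p) * d = L * d + 2 * L * al * d ^+ 2 by rewrite pE; ring.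
move: a3; rewrite mulrDr -/d a8 ler_norml => /andP[a3 _].
move: a4; rewrite ler_norml => /andP[a4 _].
lra.
Qed.

End hamiltonian.

Ltac nneg := repeat first [ done | by apply: ltW | exact: normr_ge0 | exact: enorm_ge0
  | exact: sqr_ge0 | exact: ler0n | apply: addr_ge0 | apply: divr_ge0 | apply: mulr_ge0
  | apply: exprn_ge0 ].

(** * Comparison by doubling of variables *)

Lemma le_sqr_add1 {R : realType} {d c : R} : d ^+ 2 <= c -> d <= c + 1.
Proof. by move=> h; have := sqr_ge0 (d - 1); nra. Qed.

Lemma dist_transl {R : realType} {x y z r s : R} :
  `|x - z| <= r -> `|x - y| <= s -> `|y - z| <= r + s.
Proof.
move=> h1 h2; apply: (le_trans (ler_distD x _ _)).
by rewrite addrC lerD// distrC.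
Qed.

Lemma invsq_absorption {R : realType} {B rho : R} : 0 <= B -> 1 <= rho ->
  B / rho ^+ 2 <= B / rho.
Proof.
move=> B0 rho1; have rho0 : 0 < rho by exact: lt_le_trans rho1.
rewrite ler_wpM2l// lef_pV2 ?posrE ?exprn_gt0// expr2 ler_peMr//; exact: ltW.
Qed.

Lemma rate_absorption {R : realType} {B K rho : R} (C : R) :
  0 <= B -> 0 <= K -> 1 <= rho ->
  2 * (4 * B) / (rho ^+ 2) ^+ 2 * K + C / rho <= (2 * (4 * B) * K + `|C|) / rho.
Proof.
move=> B0 K0 rho1; have rho0 : 0 < rho by exact: lt_le_trans rho1.
have h : ((rho ^+ 2) ^+ 2)^-1 <= rho^-1.
  by rewrite -exprM lef_pV2 ?posrE ?exprn_gt0// exprS ler_peMr ?(ltW rho0)// exprn_ege1.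
rewrite [X in _ <= X]mulrDl; apply: lerD.
  by rewrite mulrAC ler_wpM2l// !mulr_ge0.
by rewrite ler_wpM2r ?invr_ge0 ?(ltW rho0)// ler_norm.
Qed.

Lemma third_of_le {R : realType} {L r e d : R} : 0 < L -> 0 <= r ->
  d <= e / (3 * L * (1 + r)) -> L * (1 + r) * d <= e / 3.
Proof.
move=> L0 r0; have P : 0 < 3 * L * (1 + r) by rewrite !mulr_gt0// ltr_wpDr.
rewrite ler_pdivlMr// => h; lra.
Qed.

Lemma two_thirds_contradiction {R : realType} {e X Y : R} :
  0 < e -> e <= X + e / 3 + Y -> X + Y <= e / 3 -> False.
Proof. by move=> e0 h1 h2; lra. Qed.

Section doubling.
Context {R : realType} {n : nat}.
Local Notation mu := (@lebesgue_rV R n).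
Variables (T lambda L : R) (A : R -> R) (H : R -> 'rV[R]_n -> R -> 'rV[R]_n -> R).
Variables (u w : R -> 'rV[R]_n -> R) (M0 B0 delta eps kappa sigma S0 : R).
Variable G0 : 'rV[R]_n -> R.
Hypotheses (T_gt0 : 0 < T) (lambda_ge0 : 0 <= lambda) (L_gt0 : 0 < L).
Hypothesis HA : admissible lambda L A H.
Hypotheses (uc : continuous_on_strip T u) (wc : continuous_on_strip T w).
Hypothesis uB : forall t x, 0 <= t <= T -> `|u t x| <= B0.
Hypothesis wB : forall t x, 0 <= t <= T -> `|w t x| <= B0.
Hypothesis usub : weak_subsolution T H eps u.
Hypothesis wsub : weak_subsolution T (dual_hamiltonian H) 0 w.
Hypothesis init : forall x y : 'rV[R]_n, u 0 x + w 0 y <= M0 * enorm (x - y).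
Hypotheses (delta_gt0 : 0 < delta) (eps_ge0 : 0 <= eps) (kappa01 : 0 < kappa < 1).
Hypotheses (mG0 : measurable_fun setT G0) (G0_ge0 : forall z, 0 <= G0 z).
Hypothesis wG0 : forall t x z, 0 <= t <= T -> w t x - w t (x + z) <= G0 z.
Hypothesis G0S0 :
  (\int[mu]_(z in [set z | (kappa <= enorm z)%R]) (G0 z / enorm z ^+ n.+1)%:E <= S0%:E)%E.
Hypothesis sigma_ge :
  eps * frac_const n * (expR (3 * L * T) / (2 * delta) * (4 * 4 ^+ n * kappa) + S0) <= sigma.

Let q (x y : 'rV[R]_n) : R := \sum_i (x ord0 i - y ord0 i) ^+ 2.
(** The exponent yields a gain of 3 L [al] |x - y|^2. Two thirds pay for the quadratic error of
    [hamiltonian_doubling]; the last third pays for L |x - y|, up to L [delta] / 2, by Young's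
    inequality. *)
Let al (t : R) : R := expR (3 * L * t) / (2 * delta).

Let qE x y : q x y = enorm (x - y) ^+ 2.
Proof. by rewrite enorm_sqr; apply: eq_bigr => i _; rewrite !mxE. Qed.

Let is_derive_al (t : R) : is_derive t (1 : R) al (3 * L * al t).
Proof.
have D : is_derive t (1 : R) (fun s : R => 3 * L * s) (3 * L).
  have E := is_deriveZ (3 * L) (is_derive_id t (1 : R)).
  by apply: (is_derive_eq E); rewrite /GRing.scale/= mulr1.
have E := is_deriveM (@is_derive1_comp R expR (fun s => 3 * L * s) t _ _ (is_derive_expR _) D)
  (is_derive_cst (2 * delta)^-1 t (1 : R)).
apply: (is_derive_eq E); rewrite /al /GRing.scale/= mulr0 add0r; ring.
Qed.

Let al_gt0 t : 0 < al t.
Proof. by rewrite divr_gt0 ?expR_gt0 ?mulr_gt0. Qed.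

Let al_ge t : 0 <= t -> 1 / (2 * delta) <= al t.
Proof.
move=> t0; rewrite ler_pM2r ?invr_gt0 ?mulr_gt0//.
by rewrite (le_trans _ (expR_ge1Dx _))// lerDl !mulr_ge0// ltW.
Qed.

Let al_le t : t <= T -> al t <= al T.
Proof.
move=> tT; rewrite ler_pM2r ?invr_gt0 ?mulr_gt0// ler_expR ler_pM2l//.
by rewrite mulr_gt0.
Qed.

Let far_tail : exists Cb : R, forall (rho : R), 1 <= rho ->
  (\int[mu]_(z in [set z | (kappa <= enorm z)%R])
     ((4 * B0 * n%:R * Num.min 1 (enorm z / rho ^+ 2)) / enorm z ^+ n.+1)%:E
   <= (Cb / rho)%:E)%E.
Proof.
have B00 : 0 <= B0 by apply: le_trans (uB 0 0 _) => //; rewrite lexx ltW.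
have [k0 k1] := andP kappa01.
exists (4 * B0 * n%:R * (2 * 4 ^+ n) * (kappa^-1 + 1)) => rho rho1.
apply: far_bump_integral => //; first by rewrite !mulr_ge0.
  by rewrite (le_trans (ltW k1)).
exact: lt_le_trans rho1.
Qed.

Let bump_increment (x0 x z : 'rV[R]_n) (rho : R) : 1 <= rho ->
  \sum_i hb (((x + z) ord0 i - x0 ord0 i) / rho ^+ 2) -
  \sum_i hb ((x ord0 i - x0 ord0 i) / rho ^+ 2) <=
  n%:R * Num.min 1 (enorm z / rho ^+ 2).
Proof.
move=> rho1; rewrite -sumrB.
have -> : n%:R * Num.min 1 (enorm z / rho ^+ 2) =
    \sum_(i < n) Num.min 1 (enorm z / rho ^+ 2).
  by rewrite sumr_const card_ord mulr_natl.
apply: ler_sum => i _; rewrite le_min; apply/andP; split.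
  have := hb_ge0 ((x ord0 i - x0 ord0 i) / rho ^+ 2).
  have := hb_le1 (((x + z) ord0 i - x0 ord0 i) / rho ^+ 2); lra.
apply: (le_trans (ler_norm _)); apply: (le_trans (hb_lipschitz _ _)).
rewrite -mulrBl mxE.
have -> : x ord0 i + z ord0 i - x0 ord0 i - (x ord0 i - x0 ord0 i) = z ord0 i by ring.
rewrite normrM (ger0_norm (x := _^-1)) ?invr_ge0 ?sqr_ge0//.
by rewrite ler_wpM2r ?invr_ge0 ?sqr_ge0// enorm_coord.
Qed.

(** [delta * M0 ^+ 2 / 2] absorbs the initial Lipschitz bound, [delta * L * t / 2] what Young's
    inequality leaves of L |x - y|, and [sigma * t] the nonlocal terms. The slope [e] is the strict
    excess that is contradicted. *)
Let theta (e t : R) : R := delta * (M0 ^+ 2 + L * t) / 2 + sigma * t + e * t.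

(* [g] grows steeply near [T] and keeps a maximum away from the final time; the
   bump confines it to a box around [x0] and its contribution to the equation
   vanishes as [rho] tends to infinity. *)
Let Phi (g : R -> R) (x0 : 'rV[R]_n) (rho eta e t : R) (x : 'rV[R]_n) (s : R)
    (y : 'rV[R]_n) : R :=
  u t x + w s y - al t * q x y - theta e t - g t - g s - (t - s) ^+ 2 / (2 * eta)
  - 4 * B0 * \sum_i hb ((x ord0 i - x0 ord0 i) / rho ^+ 2).

Let is_derive_theta e (t : R) :
  is_derive t (1 : R) (theta e) (delta * L / 2 + sigma + e).
Proof.
have E := is_deriveD (is_derive_cst (delta * M0 ^+ 2 / 2) t (1 : R))
  (is_deriveZ (delta * L / 2 + sigma + e) (is_derive_id t (1 : R))).
have -> : theta e = cst (delta * M0 ^+ 2 / 2) + (delta * L / 2 + sigma + e) \*: id.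
  by apply/funext => s; rewrite !fctE /theta/= /GRing.scale/=; ring.
by apply: (is_derive_eq E); rewrite add0r /GRing.scale/= mulr1.
Qed.

Let is_derive_time_gap (eta s : R) (t : R) :
  is_derive t (1 : R) (fun t => (t - s) ^+ 2 / (2 * eta)) ((t - s) / eta).
Proof.
have D := is_deriveB (is_derive_id t (1 : R)) (is_derive_cst s t (1 : R)).
have E := is_deriveM (is_deriveX 2 D) (is_derive_cst (2 * eta)^-1 t (1 : R)).
apply: (is_derive_eq E); rewrite /GRing.scale/= !fctE/= subr0 mulr0 add0r !mulr1 expr1.
(* Both sides vanish at [eta = 0], the inverse of 0 being 0. *)
have [->|e0] := eqVneq eta 0; first by rewrite mulr0 invr0 !mulr0 mul0r.
by field.
Qed.

Let tfun_split c a (y z0 : 'rV[R]_n) B r t x :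
  tfun c a y B z0 r t x =
  c t + a t * q x y + B * \sum_i hb ((x ord0 i - z0 ord0 i) / r).
Proof. by rewrite /tfun /tcomp big_split/= -!mulr_sumr addrA. Qed.

(* The nonlocal term only involves the increments of [u], and at a maximum of
   [Phi] those are bounded by the increments of [w]: moving [x] and [y] by the
   same vector leaves the quadratic penalty unchanged. *)
Let doubling_interior (g g' : R -> R) (x0 : 'rV[R]_n) (rho eta e r0 Cb t s : R)
    (x y : 'rV[R]_n) :
  (forall t : R, is_derive t (1 : R) g (g' t)) -> continuous g' ->
  (forall t, 0 <= t <= T -> 0 <= g' t) -> 1 <= rho -> 0 < eta ->
  (\int[mu]_(z in [set z | (kappa <= enorm z)%R])
     ((4 * B0 * n%:R * Num.min 1 (enorm z / rho ^+ 2)) / enorm z ^+ n.+1)%:E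
   <= (Cb / rho)%:E)%E ->
  0 < t < T -> 0 < s < T ->
  (forall t' x' s' y', 0 <= t' <= T -> 0 <= s' <= T ->
     Phi g x0 rho eta e t' x' s' y' <= Phi g x0 rho eta e t x s y) ->
  - w s y <= u t x ->
  n.+1%:R * enorm ((2 * al t) *: (x - y)) + 4 * B0 * n%:R < r0 ->
  e <= eps * frac_const n * (2 * (4 * B0) / (rho ^+ 2) ^+ 2 * (4 * 4 ^+ n * kappa) + Cb / rho)
       + L * (1 + r0) * `|t - s| + `|A r0| * (4 * B0 * n%:R / rho ^+ 2).
Proof.
move=> dg cg' g'0 rho1 eta0 HCb tT sT mx uw r0H.
have tT' : 0 <= t <= T by case/andP: tT => a b; rewrite !ltW.
have sT' : 0 <= s <= T by case/andP: sT => a b; rewrite !ltW.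
have B00 : 0 <= B0 by apply: le_trans (uB 0 0 _) => //; rewrite lexx ltW.
have rho2 : 0 < rho ^+ 2 by rewrite exprn_gt0// (lt_le_trans _ rho1).
(* With (s, y) frozen, the penalties of [Phi] form a test function touching [u] at (t, x). *)
pose c t' := theta e t' + g t' + (t' - s) ^+ 2 / (2 * eta).
have dc (t' : R) : is_derive t' (1 : R) c (delta * L / 2 + sigma + e + g' t' + (t' - s) / eta).
  exact: is_deriveD (is_deriveD (is_derive_theta e t') (dg t')) (is_derive_time_gap eta s t').
have cal' : continuous (fun t => 3 * L * al t).
  move=> t'; apply: cvgM; first exact: cvg_cst.
  apply: differentiable_continuous; apply/derivable1_diffP.
  by have [] := is_derive_al t'.
have cgap (s' : R) : continuous (fun t' : R => (t' - s') / eta).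
  by move=> t'; apply: cvgM; [apply: cvgB; [exact: cvg_id|exact: cvg_cst]|exact: cvg_cst].
have cc' : continuous (fun t' => delta * L / 2 + sigma + e + g' t' + (t' - s) / eta).
  move=> t'; apply: cvgD; last exact: cgap.
  by apply: cvgD; [exact: cvg_cst|exact: cg'].
have mxu s' x' : 0 <= s' <= T -> u s' x' - tfun c al y (4 * B0) x0 (rho ^+ 2) s' x' <=
    u t x - tfun c al y (4 * B0) x0 (rho ^+ 2) t x.
  move=> s'T; have := mx s' x' s y s'T sT'; rewrite /Phi !tfun_split /c.
  by move=> *; lra.
have qshift z : q (x + z) (y + z) = q x y.
  by rewrite !qE; congr (enorm _ ^+ 2); apply/rowP => i; rewrite !mxE; ring.
(* Majorant of the increments of [u]: the decrease of [w] under the same translation, plus the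
   increment of the bump. *)
pose G z := G0 z + 4 * B0 * n%:R * Num.min 1 (enorm z / rho ^+ 2).
have minz (z : 'rV[R]_n) : 0 <= Num.min 1 (enorm z / rho ^+ 2).
  by rewrite le_min ler01/= divr_ge0 ?enorm_ge0// ltW.
have Bz (z : 'rV[R]_n) : 0 <= 4 * B0 * n%:R * Num.min 1 (enorm z / rho ^+ 2).
  by apply: mulr_ge0 => //; rewrite !mulr_ge0.
have G_ge0 z : 0 <= G z by rewrite addr_ge0.
have uG z : u t (x + z) - u t x <= G z.
  have := mx t (x + z) s (y + z) tT' sT'; rewrite /Phi qshift.
  have := wG0 s y z sT'; have := bump_increment x0 x z _ rho1.
  move=> h1 h2 h3; rewrite /G.
  have h4 : 4 * B0 * (\sum_i hb (((x + z) ord0 i - x0 ord0 i) / rho ^+ 2) -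
    \sum_i hb ((x ord0 i - x0 ord0 i) / rho ^+ 2)) <=
    4 * B0 * (n%:R * Num.min 1 (enorm z / rho ^+ 2)) by rewrite ler_wpM2l// mulr_ge0.
  lra.
have mD : measurable [set z : 'rV[R]_n | kappa <= enorm z] by exact: measurable_enorm_ge.
have GS : (\int[mu]_(z in [set z | (kappa <= enorm z)%R]) (G z / enorm z ^+ n.+1)%:E
    <= (S0 + Cb / rho)%:E)%E.
  rewrite (eq_integral (fun z => (G0 z / enorm z ^+ n.+1)%:E +
     (4 * B0 * n%:R * Num.min 1 (enorm z / rho ^+ 2) / enorm z ^+ n.+1)%:E)%E); last first.
    by move=> z _; rewrite -EFinD -mulrDl.
  rewrite ge0_integralD//; first by rewrite EFinD; exact: leeD.
  - by move=> z _; rewrite lee_fin divr_ge0 ?exprn_ge0 ?enorm_ge0.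
  - apply/measurable_EFinP; apply: measurable_funM; last exact: measurable_invkernel.
    exact: measurable_funTS.
  - by move=> z _; rewrite lee_fin divr_ge0 ?exprn_ge0 ?enorm_ge0.
  - apply/measurable_EFinP; apply: measurable_funM; last exact: measurable_invkernel.
    apply: measurable_funM => //; apply: measurable_minr => //.
    by apply: measurable_funM => //; exact: measurable_enorm.
have Iu := usub c _ al _ y (4 * B0) x0 (rho ^+ 2) dc is_derive_al cc' cal' rho2 t x tT mxu
  kappa _ G kappa01 G_ge0 uG GS.
(* With (t, x) frozen, the coefficient [al t] is constant in s, so its growth in time is felt only
   in the inequality for [u]. *)
pose c2 s' := g s' + (s' - t) ^+ 2 / (2 * eta).
have dc2 (s' : R) : is_derive s' (1 : R) c2 (g' s' + (s' - t) / eta).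
  exact: is_deriveD (dg s') (is_derive_time_gap eta t s').
have cc2' : continuous (fun s' => g' s' + (s' - t) / eta).
  by move=> s'; apply: cvgD; [exact: cg'|exact: cgap].
have qC x' y' : q x' y' = q y' x'.
  by rewrite !qE -enormN opprB.
have mxw s' y' : 0 <= s' <= T -> w s' y' - tfun c2 (cst (al t)) x 0 0 1 s' y' <=
    w s y - tfun c2 (cst (al t)) x 0 0 1 s y.
  move=> s'T; have := mx t x s' y' tT' s'T; rewrite /Phi !tfun_split /c2/=.
  rewrite !mul0r (qC y' x) (qC y x) -(sqrrN (t - s')) -(sqrrN (t - s)) !opprB.
  by move=> *; lra.
(* The inequality for [w] is of first order: the nonlocal bound is multiplied by 0, so any finite
   majorant of the increments serves. *)
have wtail : (\int[mu]_(z in [set z | (kappa <= enorm z)%R])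
    (2 * B0 / enorm z ^+ n.+1)%:E <= (2 * B0 * (2 * 4 ^+ n / kappa))%:E)%E.
  rewrite (eq_integral (fun z => (2 * B0 * (enorm z ^+ 0 / enorm z ^+ n.+1))%:E)); last first.
    by move=> z _; rewrite expr0 mul1r.
  apply: kernel_integralZ_le => //; first by rewrite mulr_ge0.
  by apply: kernel_tail; case/andP: kappa01.
have wG z : w s (y + z) - w s y <= 2 * B0.
  have := wB s (y + z) sT'; have := wB s y sT'; rewrite !ler_norml.
  by move=> /andP[? ?] /andP[? ?]; lra.
have c0' : continuous (fun _ : R => 0 : R) by move=> ?; exact: cvg_cst.
have Iw := wsub c2 _ (cst (al t)) _ x 0 0 1 dc2 (fun t' => is_derive_cst (al t) t' 1)
  cc2' c0' ltr01 s y sT mxw kappa _ (fun=> 2 * B0) kappa01 _ wG wtail.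
have {}Iw := Iw (fun _ => mulr_ge0 (ler0n _ 2) B00).
move: Iw; rewrite !mul0r addr0 /dual_hamiltonian.
have -> : - (\row_i tcomp' (cst (al t)) x 0 0 1 s i (y ord0 i)) = (2 * al t) *: (x - y).
  by apply/rowP => i; rewrite !mxE /tcomp' /=; ring.
move=> Iw.
set p' := \row_i _ in Iu.
set p := (2 * al t) *: (x - y) in r0H Iw *.
(* The two gradients differ only by that of the bump. *)
have pp'sum : \sum_i `|(p' - p) ord0 i| <= 4 * B0 * n%:R / rho ^+ 2.
  have -> : 4 * B0 * n%:R / rho ^+ 2 = \sum_(i < n) (4 * B0 / rho ^+ 2).
    by rewrite sumr_const card_ord -[RHS]mulr_natr mulrAC.
  apply: ler_sum => i _; rewrite !mxE /tcomp'.
  rewrite [X in `|X|](_ : _ = 4 * B0 / rho ^+ 2 * hb' ((x ord0 i - x0 ord0 i) / rho ^+ 2)); last by ring.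
  have b0 : 0 <= 4 * B0 / rho ^+ 2 by nneg.
  by rewrite normrM (ger0_norm b0) ler_piMr// hb'_bound.
have pp' := le_trans (enorm_le_sum (p' - p)) pp'sum.
have rho21 : 1 <= rho ^+ 2 by rewrite exprn_ege1.
have p0 : 0 <= enorm p by exact: enorm_ge0.
have Bn0 : 0 <= 4 * B0 * n%:R by rewrite !mulr_ge0.
have Bn : 4 * B0 * n%:R / rho ^+ 2 <= 4 * B0 * n%:R.
  by rewrite ler_pdivrMr// ler_peMr.
have np : n.+1%:R * enorm p = enorm p + n%:R * enorm p by rewrite -nat1r mulrDl mul1r.
have np0 : 0 <= n%:R * enorm p by rewrite mulr_ge0.
have vE (v v' : 'rV[R]_n) i : v ord0 i = v' ord0 i + (v - v') ord0 i.
  by rewrite !mxE; ring.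
have p'r : enorm p' < r0.
  apply: le_lt_trans r0H; apply: (le_trans (enorm_le_sum _)).
  apply: (@le_trans _ _ (\sum_(i < n) (enorm p + `|(p' - p) ord0 i|))).
    apply: ler_sum => i _; have := enorm_coord p i.
    rewrite (vE p' p i) => h; by apply: (le_trans (ler_normD _ _)); rewrite lerD2r.
  rewrite big_split/= sumr_const card_ord -[enorm p *+ n]mulr_natl; lra.
have pr : enorm p < r0 by lra.
have r00 : 0 < r0 by lra.
have Hd := hamiltonian_doubling lambda L A H t s (u t x) (- w s y) (al t) r0 x y p' HA
  lambda_ge0 (ltW L_gt0) (ltW (al_gt0 t)) uw r00 pr p'r.
rewrite -/p in Hd.
have Ad : `|A r0| * enorm (p' - p) <= `|A r0| * (4 * B0 * n%:R / rho ^+ 2).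
  by rewrite ler_wpM2l.
have [t0 tT1] := andP tT'.
have ef0 : 0 <= eps * frac_const n by rewrite mulr_ge0// frac_const_ge0.
have K0 : 0 <= 4 * 4 ^+ n * kappa.
  by rewrite !mulr_ge0 ?exprn_ge0//; case/andP: kappa01 => /ltW.
have sg : eps * frac_const n * (al t * (4 * 4 ^+ n * kappa) + S0) <= sigma.
  apply: le_trans sigma_ge; rewrite ler_wpM2l// lerD2r ler_wpM2r//.
  exact: al_le.
have d0 : 0 <= enorm (x - y) by exact: enorm_ge0.
(* Young's inequality, with [al t] at least 1 / (2 [delta]). *)
have dq : L * enorm (x - y) <= L * delta / 2 + L * (al t * enorm (x - y) ^+ 2).
  rewrite -mulrA -mulrDr ler_pM2l//.
  have h1 : 1 / (2 * delta) * enorm (x - y) ^+ 2 <= al t * enorm (x - y) ^+ 2.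
    by rewrite ler_wpM2r ?sqr_ge0// al_ge.
  apply: le_trans (lerD (lexx _) h1).
  have h2 : 0 <= (enorm (x - y) - delta) ^+ 2 / (2 * delta).
    by rewrite divr_ge0 ?sqr_ge0// mulr_ge0// ltW.
  have -> : delta / 2 + 1 / (2 * delta) * enorm (x - y) ^+ 2 =
     enorm (x - y) + (enorm (x - y) - delta) ^+ 2 / (2 * delta).
    by field; rewrite gt_eqF.
  by rewrite lerDl.
move: Iu; rewrite -/(q x y) qE (ger0_norm (ltW (al_gt0 t))) (ger0_norm (x := 4 * B0)); last first.
  by rewrite mulr_ge0.
have g't := g'0 t tT'; have g's := g'0 s sT'.
(* The time penalties cancel when the two inequalities are added. *)
have gap : (t - s) / eta + (s - t) / eta = 0 by ring.
move: Iw Hd dq sg Ad g't g's gap.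
set X1 := H t x _ p'; set X2 := H s y _ p.
set d2 := enorm (x - y) ^+ 2; set d := enorm (x - y).
set e1 := (t - s) / eta; set e2 := (s - t) / eta.
set K := 4 * 4 ^+ n * kappa; set c1 := 2 * (4 * B0) / (rho ^+ 2) ^+ 2.
set ef := eps * frac_const n => Iw Hd dq sg Ad g't g's gap Iu.
have E : ef * ((al t + c1) * K + (S0 + Cb / rho)) =
  ef * (al t * K + S0) + ef * (c1 * K + Cb / rho) by ring.
rewrite E in Iu; lra.
Qed.

(** Since u + w is at most 2 [B0], positivity of [Phi] keeps every penalty below 2 [B0]. The weight
    4 [B0] of the bump, which is at least 1/2 outside the box, and the value [g T = 2 * B0] are
    chosen to reach exactly this threshold. *)
Let confinement (g : R -> R) (x0 : 'rV[R]_n) (rho eta e t s : R) (x y : 'rV[R]_n) :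
  (forall t, 0 <= t <= T -> 0 <= g t) -> g T = 2 * B0 -> 1 <= rho -> 0 < eta -> 0 <= e ->
  0 <= sigma -> 0 <= t <= T -> 0 <= s <= T ->
  0 < Phi g x0 rho eta e t x s y ->
  [/\ forall i, `|x ord0 i - x0 ord0 i| <= rho ^+ 2, q x y <= 4 * delta * B0,
      t < T, s < T & (t - s) ^+ 2 <= 4 * B0 * eta].
Proof.
move=> g0 gT rho1 eta0 e0 sg0 tT sT.
have [t0 tT'] := andP tT; have [s0 sT'] := andP sT.
have B00 : 0 <= B0 by apply: le_trans (uB 0 0 _) => //; rewrite lexx ltW.
have rho2 : 0 < rho ^+ 2 by rewrite exprn_gt0// (lt_le_trans _ rho1).
have q0 : 0 <= q x y by rewrite qE sqr_ge0.
have P1 : 1 / (2 * delta) * q x y <= al t * q x y by rewrite ler_wpM2r// al_ge.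
have P1' : 0 <= 1 / (2 * delta) * q x y by rewrite mulr_ge0// divr_ge0// mulr_ge0// ltW.
have P2 : 0 <= theta e t.
  rewrite /theta !addr_ge0// ?mulr_ge0// ?addr_ge0 ?sqr_ge0 ?mulr_ge0 ?(ltW L_gt0)//.
  exact: ltW.
have P5 : 0 <= (t - s) ^+ 2 / (2 * eta) by rewrite divr_ge0 ?sqr_ge0// mulr_ge0// ltW.
have S0' : 0 <= \sum_i hb ((x ord0 i - x0 ord0 i) / rho ^+ 2).
  by apply: sumr_ge0 => i _; exact: hb_ge0.
have P6 : 0 <= 4 * B0 * \sum_i hb ((x ord0 i - x0 ord0 i) / rho ^+ 2).
  by rewrite mulr_ge0// mulr_ge0.
have gt := g0 t tT; have gs := g0 s sT.
have [ut1 ut2] := andP (etrans (esym (ler_norml _ _)) (uB t x tT)).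
have [ws1 ws2] := andP (etrans (esym (ler_norml _ _)) (wB s y sT)).
rewrite /Phi => P.
split.
- move=> i; rewrite leNgt; apply/negP => xi.
  have : 1 / 2 <= hb ((x ord0 i - x0 ord0 i) / rho ^+ 2).
    apply: hb_ge_half; rewrite normrM (ger0_norm (x := _^-1)) ?invr_ge0 ?(ltW rho2)//.
    by rewrite ler_pdivlMr// mul1r ltW.
  have : hb ((x ord0 i - x0 ord0 i) / rho ^+ 2) <=
      \sum_i hb ((x ord0 i - x0 ord0 i) / rho ^+ 2).
    by rewrite [leRHS](bigD1 i)//= lerDl sumr_ge0// => j _; exact: hb_ge0.
  set S := \sum_i _ in P6 P *; set h := hb _ => h1 h2.
  have : 4 * B0 * (1 / 2) <= 4 * B0 * S by rewrite ler_wpM2l ?mulr_ge0//; lra.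
  lra.
- have : 1 / (2 * delta) * q x y <= 2 * B0 by lra.
  rewrite mulrC mulrA mulr1 ler_pdivrMr ?mulr_gt0//; lra.
- rewrite lt_neqAle tT' andbT; apply/eqP => tE; have : g t = 2 * B0 by rewrite tE.
  lra.
- rewrite lt_neqAle sT' andbT; apply/eqP => sE; have : g s = 2 * B0 by rewrite sE.
  lra.
- have : (t - s) ^+ 2 / (2 * eta) <= 2 * B0 by lra.
  rewrite ler_pdivrMr ?mulr_gt0//; lra.
Qed.

Let Phi_continuous (g : R -> R) (x0 : 'rV[R]_n) (rho eta e : R) (D : set ((R * 'rV[R]_n) * (R * 'rV[R]_n))) :
  continuous g -> 0 < rho ^+ 2 ->
  (forall p, D p -> strip T p.1 /\ strip T p.2) ->
  {within D, continuous (fun p => Phi g x0 rho eta e p.1.1 p.1.2 p.2.1 p.2.2)}.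
Proof.
move=> cg rho2 DS.
have cf1 (f : R * 'rV[R]_n -> R) : continuous f ->
    continuous (fun p : (R * 'rV[R]_n) * (R * 'rV[R]_n) => f p.1).
  by move=> cf p; apply: (continuous_comp (f := fst) (g := f)); [exact: cvg_fst|exact: cf].
have cf2 (f : R * 'rV[R]_n -> R) : continuous f ->
    continuous (fun p : (R * 'rV[R]_n) * (R * 'rV[R]_n) => f p.2).
  by move=> cf p; apply: (continuous_comp (f := snd) (g := f)); [exact: cvg_snd|exact: cf].
pose rest (p : (R * 'rV[R]_n) * (R * 'rV[R]_n)) : R :=
  al p.1.1 * q p.1.2 p.2.2 + theta e p.1.1 + g p.1.1 + g p.2.1
  + (p.1.1 - p.2.1) ^+ 2 / (2 * eta)
  + 4 * B0 * \sum_i hb ((p.1.2 ord0 i - x0 ord0 i) / rho ^+ 2).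
have sqc (f : (R * 'rV[R]_n) * (R * 'rV[R]_n) -> R) : continuous f ->
    continuous (fun p => f p ^+ 2).
  move=> cf p; apply: (continuous_comp (f := f) (g := fun v => v ^+ 2)); first exact: cf.
  exact: exprn_continuous.
have crest : continuous rest.
  have id_c (f : R -> R) (f' : R -> R) : (forall t : R, is_derive t (1 : R) f (f' t)) ->
      continuous f.
    move=> df t; apply: differentiable_continuous; apply/derivable1_diffP.
    by have [] := df t.
  have cal := id_c _ _ is_derive_al; have cth := id_c _ _ (is_derive_theta e).
  have ccoord i : continuous (fun p : R * 'rV[R]_n => p.2 ord0 i).
    by apply: (continuous_coord_comp id) => ?; exact: cvg_id.
  move=> p; apply: cvgD; first apply: cvgD; first apply: cvgD; first apply: cvgD;
    first apply: cvgD; first apply: cvgM.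
  - exact: (cf1 _ (continuous_time_comp _ cal)).
  - apply: continuous_bigsum => i; apply: sqc => p'.
    by apply: cvgB; [exact: (cf1 _ (ccoord i))|exact: (cf2 _ (ccoord i))].
  - exact: (cf1 _ (continuous_time_comp _ cth)).
  - exact: (cf1 _ (continuous_time_comp _ cg)).
  - exact: (cf2 _ (continuous_time_comp _ cg)).
  - apply: cvgM; last exact: cvg_cst.
    apply: sqc => p'; apply: cvgB; first by apply: (cf1 fst) => ?; exact: cvg_fst.
    by apply: (cf2 fst) => ?; exact: cvg_fst.
  - apply: cvgM; first exact: cvg_cst.
    apply: continuous_bigsum => i.
    apply: (cf1 (fun p => hb ((p.2 ord0 i - x0 ord0 i) / rho ^+ 2))).
    apply: (continuous_coord_comp (fun s => hb ((s - x0 ord0 i) / rho ^+ 2))) => s.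
    apply: (continuous_comp (f := fun s : R => (s - x0 ord0 i) / rho ^+ 2) (g := hb)).
      exact: continuous_affine.
    exact: continuous_hb.
rewrite (_ : (fun p => _) = (fun p => u p.1.1 p.1.2 + w p.2.1 p.2.2 - rest p)); last first.
  by apply/funext => p; rewrite /Phi /rest; ring.
have cu : {within D, continuous (fun p => u p.1.1 p.1.2)}.
  apply: (continuous_on_strip_comp _ _ uc _ D fst) => [p|p /DS[]//].
  exact: cvg_fst.
have cw : {within D, continuous (fun p => w p.2.1 p.2.2)}.
  apply: (continuous_on_strip_comp _ _ wc _ D snd) => [p|p /DS[]//].
  exact: cvg_snd.
have cr : {within D, continuous rest} by exact: continuous_subspaceT.
by move=> p; apply: cvgB; [apply: cvgD; [exact: cu|exact: cw]|exact: cr].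
Qed.

(** The function is 2 [B0] (t/T)^k with k large: nearly 0 at [t0], but 2 [B0] at [T]. Unlike a
    penalty blowing up at [T], it is smooth on the closed interval, as test functions must be. *)
Let power_penalty (t0 e : R) : 0 < t0 < T -> 0 < e -> 0 <= B0 ->
  exists g g' : R -> R,
  [/\ forall t : R, is_derive t (1 : R) g (g' t), continuous g',
      forall t, 0 <= t <= T -> 0 <= g t /\ 0 <= g' t,
      g T = 2 * B0 & g t0 <= e].
Proof.
move=> /andP[t00 t0T] e0 B00.
have z1 : `|t0 / T| < 1.
  by rewrite ger0_norm ?divr_ge0 ?ltW// ltr_pdivrMr// mul1r.
have /cvgrPdist_le/(_ _ e0)[k _ /(_ k (leqnn k))] := cvg_geometric (2 * B0) z1.
rewrite /= sub0r normrN => gk.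
exists (fun t => 2 * B0 / T ^+ k * t ^+ k), (fun t => 2 * B0 / T ^+ k * (k%:R * t ^+ k.-1)).
have c0 : 0 <= 2 * B0 / T ^+ k by rewrite divr_ge0 ?mulr_ge0// exprn_ge0// ltW.
split.
- move=> t; have E := is_deriveZ (2 * B0 / T ^+ k) (is_deriveX k (is_derive_id t (1 : R))).
  rewrite (_ : (fun t => _) = (2 * B0 / T ^+ k) \*: (id ^+ k : R -> R)); last first.
    by apply/funext => v; rewrite !fctE.
  by apply: (is_derive_eq E); rewrite /GRing.scale/= mulr1.
- move=> t; apply: cvgM; first exact: cvg_cst.
  by apply: cvgM; [exact: cvg_cst|exact: exprn_continuous].
- by move=> t /andP[t_ge0 _]; split; rewrite mulr_ge0// ?mulr_ge0// exprn_ge0.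
- by rewrite divfK// expf_neq0// gt_eqF.
- apply: le_trans gk; rewrite exprMn exprVn.
  by rewrite mulrAC -mulrA ler_norm.
Qed.

(** All penalties being nonnegative, u + w is positive where [Phi] is. This is the ordering that
    [hamiltonian_doubling] asks for. *)
Let ordered_values (g : R -> R) (x0 : 'rV[R]_n) (rho eta e t s : R) (x y : 'rV[R]_n) :
  0 <= g t -> 0 <= g s -> 0 < eta -> 0 <= e -> 0 <= sigma -> 0 <= t -> 0 <= B0 ->
  0 < Phi g x0 rho eta e t x s y -> - w s y <= u t x.
Proof.
move=> gt gs eta0 e0 sg0 t0 B00.
have P1 : 0 <= al t * q x y.
  by apply: mulr_ge0; [exact: ltW (al_gt0 t)|rewrite qE sqr_ge0].
have P2 : 0 <= theta e t by rewrite /theta; nneg.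
have P5 : 0 <= (t - s) ^+ 2 / (2 * eta) by nneg.
have P6 : 0 <= 4 * B0 * \sum_i hb ((x ord0 i - x0 ord0 i) / rho ^+ 2).
  by rewrite !mulr_ge0// sumr_ge0// => i _; exact: hb_ge0.
by rewrite /Phi; lra.
Qed.

(** Near t = s = 0 the hypothesis [init] leaves M0 |x - y|, which Young's inequality bounds by the
    quadratic penalty plus the constant [delta * M0 ^+ 2 / 2] of [theta]. *)
Let initial_bound (g : R -> R) (x0 : 'rV[R]_n) (rho eta e e1 t s : R) (x y : 'rV[R]_n) :
  0 <= g t -> 0 <= g s -> 0 < eta -> 0 <= e -> 0 <= sigma -> 0 <= t -> 0 <= B0 ->
  `|u t x - u 0 x| <= e1 -> `|w s y - w 0 y| <= e1 ->
  Phi g x0 rho eta e t x s y <= 2 * e1.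
Proof.
move=> gt gs eta0 e0 sg0 t0 B00 hu hw.
have d0 : 0 <= enorm (x - y) by exact: enorm_ge0.
have P1 : 1 / (2 * delta) * q x y <= al t * q x y.
  by rewrite ler_wpM2r ?al_ge// qE sqr_ge0.
have P2 : delta * M0 ^+ 2 / 2 <= theta e t.
  have : 0 <= delta * (L * t) / 2 by rewrite divr_ge0// !mulr_ge0// ltW.
  have : 0 <= sigma * t by rewrite mulr_ge0.
  have : 0 <= e * t by rewrite mulr_ge0.
  by rewrite /theta; lra.
have P5 : 0 <= (t - s) ^+ 2 / (2 * eta) by rewrite divr_ge0 ?sqr_ge0// mulr_ge0// ltW.
have P6 : 0 <= 4 * B0 * \sum_i hb ((x ord0 i - x0 ord0 i) / rho ^+ 2).
  by rewrite !mulr_ge0// sumr_ge0// => i _; exact: hb_ge0.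
have P7 : M0 * enorm (x - y) <= 1 / (2 * delta) * q x y + delta * M0 ^+ 2 / 2.
  rewrite qE; have h2 : 0 <= (enorm (x - y) - delta * M0) ^+ 2 / (2 * delta).
    by rewrite divr_ge0 ?sqr_ge0// mulr_ge0// ltW.
  have -> : 1 / (2 * delta) * enorm (x - y) ^+ 2 + delta * M0 ^+ 2 / 2 =
     M0 * enorm (x - y) + (enorm (x - y) - delta * M0) ^+ 2 / (2 * delta).
    by field; rewrite gt_eqF.
  by rewrite lerDl.
have P8 := init x y.
have {}hu := le_trans (ler_norm _) hu; have {}hw := le_trans (ler_norm _) hw.
by rewrite /Phi; lra.
Qed.

Let doubling_comparison_lt (t0 : R) (x0 y0 : 'rV[R]_n) : 0 < t0 < T ->
  u t0 x0 + w t0 y0 <= al t0 * q x0 y0 + delta * (M0 ^+ 2 + L * t0) / 2 + sigma * t0.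
Proof.
move=> t0T; rewrite leNgt; apply/negP => ex.
have [t00 t0T1] := andP t0T.
have t0T' : 0 <= t0 <= T by rewrite !ltW.
(* A quarter of the excess to be contradicted: the slope [e' := e / T] costs at most [e] at [t0],
   the two values of [g] cost at most [e] together, and [2 * e] remains for [Phi]. *)
set e := (u t0 x0 + w t0 y0 - (al t0 * q x0 y0 + delta * (M0 ^+ 2 + L * t0) / 2 + sigma * t0)) / 4.
have e0 : 0 < e by rewrite /e; lra.
have B00 : 0 <= B0 by apply: le_trans (uB 0 0 _) => //; rewrite lexx ltW.
have [k0 k1] := andP kappa01.
have S00 : 0 <= S0.
  rewrite -lee_fin; apply: le_trans G0S0; apply: integral_ge0 => z _.
  by rewrite lee_fin divr_ge0 ?exprn_ge0 ?enorm_ge0.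
have ef0 : 0 <= eps * frac_const n by rewrite mulr_ge0// frac_const_ge0.
set K4 := 4 * 4 ^+ n * kappa.
have K40 : 0 <= K4 by rewrite !mulr_ge0 ?exprn_ge0// ltW.
have sigma0 : 0 <= sigma.
  apply: le_trans sigma_ge; rewrite mulr_ge0// addr_ge0// mulr_ge0//.
  exact: ltW (al_gt0 T).
have [|g [g' [dg cg' gg' gT gt0]]] := power_penalty t0 (e / 2) t0T _ B00.
  by rewrite divr_gt0.
set e' := e / T.
have e'0 : 0 < e' by rewrite divr_gt0.
have [Cb0 HCb0] := far_tail.
set Cb := `|Cb0|.
pose rho1 := 4 * delta * B0 + 1.
have rho1_gt0 : 0 < rho1 by rewrite ltr_wpDl// !mulr_ge0// ltW.
(* A bound on both gradients that does not depend on [rho], so that the constant [A r0] is fixed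
   before [rho] is chosen. *)
pose r0 := n.+1%:R * (2 * al T * rho1) + 4 * B0 * n%:R + 1.
have alT := al_gt0 T.
have r00 : 0 <= r0.
  have a1 := mulr_ge0 (mulr_ge0 (ler0n R 2) (ltW alT)) (ltW rho1_gt0).
  have a2 := mulr_ge0 (ler0n R n.+1) a1.
  have a3 := mulr_ge0 (mulr_ge0 (ler0n R 4) B00) (ler0n R n).
  by rewrite /r0 addr_ge0// addr_ge0.
pose C1 := eps * frac_const n * (2 * (4 * B0) * K4 + Cb) + `|A r0| * (4 * B0 * n%:R).
have C10 : 0 <= C1 by rewrite /C1 /Cb; nneg.
(* Makes all errors due to the bump at most e' / 3. *)
pose rho := 1 + 3 * C1 / e'.
have rho_ge1 : 1 <= rho by rewrite /rho lerDl; nneg.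
have rho_gt0 : 0 < rho by exact: lt_le_trans rho_ge1.
have C1rho : C1 / rho <= e' / 3.
  rewrite ler_pdivrMr// /rho mulrDr mulr1.
  have -> : e' / 3 * (3 * C1 / e') = C1 by field; rewrite gt_eqF.
  by rewrite lerDr; nneg.
have T0 : 0 <= T by exact: ltW.
have e4 : 0 < e / 4 by rewrite divr_gt0.
have [tau1 tau10 Htau1] := uniform_initial_continuity T u uc x0 (rho ^+ 2) (e / 4) T0 e4.
have [tau2 tau20 Htau2] := uniform_initial_continuity T w wc x0 (rho ^+ 2 + rho1) (e / 4) T0 e4.
(* Admissible time gap: small enough for continuity at the initial time, and for the time dependence
   of the Hamiltonian to cost at most e' / 3. [eta] then forces |t - s| below [om] through
   [confinement]; the added 1 in its denominator covers B0 = 0. *)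
pose om := Num.min (Num.min tau1 tau2) (e' / (3 * L * (1 + r0))).
have Lr0 : 0 < 3 * L * (1 + r0) by rewrite !mulr_gt0// ltr_wpDr.
have om0 : 0 < om by rewrite !lt_min tau10 tau20 divr_gt0.
pose eta := om ^+ 2 / (4 * B0 + 1).
have B1 : 0 < 4 * B0 + 1 by rewrite ltr_wpDl// mulr_ge0.
have eta0 : 0 < eta by rewrite divr_gt0// exprn_gt0.
have Beta : 4 * B0 * eta <= om ^+ 2.
  rewrite /eta mulrA ler_pdivrMr// mulrC ler_wpM2l ?sqr_ge0//; lra.
pose F := Phi g x0 rho eta e'.
have Ftarget : 2 * e <= F t0 x0 t0 y0.
  rewrite /F /Phi subrr expr0n/= mul0r (eq_bigr (fun=> 0)); last first.
    by move=> i _; rewrite subrr mul0r hb0.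
  rewrite big1// mulr0 !subr0 /theta.
  have : e' * t0 <= e by rewrite /e' -mulrA ler_piMr ?(ltW e0)// mulrC ler_pdivrMr// mul1r ltW.
  have : u t0 x0 + w t0 y0 = 4 * e + (al t0 * q x0 y0 + delta * (M0 ^+ 2 + L * t0) / 2 + sigma * t0).
    by rewrite /e; field.
  lra.
have conf t s x y := confinement g x0 rho eta e' t s x y
  (fun t tT => proj1 (gg' t tT)) gT rho_ge1 eta0 (ltW e'0) sigma0.
have near_xy (x y : 'rV[R]_n) i : q x y <= 4 * delta * B0 -> `|x ord0 i - y ord0 i| <= rho1.
  rewrite qE => h; have := enorm_coord (x - y) i; rewrite !mxE => h2.
  exact: le_trans h2 (le_sqr_add1 h).
pose Bx : set 'rV[R]_n := [set x | forall i, `[x0 ord0 i - rho ^+ 2, x0 ord0 i + rho ^+ 2]%classic (x ord0 i)].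
pose By : set 'rV[R]_n := [set y | forall i,
  `[x0 ord0 i - (rho ^+ 2 + rho1), x0 ord0 i + (rho ^+ 2 + rho1)]%classic (y ord0 i)].
(* Contains every point of the doubled strip where [Phi] is positive; the box for y is wider by
   [rho1], the bound on |x - y|. A maximum over [D] is thus global. *)
pose D : set ((R * 'rV[R]_n) * (R * 'rV[R]_n)) := (`[0, T]%classic `*` Bx) `*` (`[0, T]%classic `*` By).
have cD : compact D.
  apply: compact_setX; apply: compact_setX.
  - exact: segment_compact.
  - apply: (@rV_compact R n (fun i => `[x0 ord0 i - rho ^+ 2, x0 ord0 i + rho ^+ 2]%classic)) => i.
    exact: segment_compact.
  - exact: segment_compact.
  - apply: (@rV_compact R n (fun i => `[x0 ord0 i - (rho ^+ 2 + rho1),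
      x0 ord0 i + (rho ^+ 2 + rho1)]%classic)) => i.
    exact: segment_compact.
have inD t x s y : 0 <= t <= T -> 0 <= s <= T -> 0 < F t x s y -> D ((t, x), (s, y)).
  move=> tT sT /(conf t s x y tT sT)[h1 h2 _ _ _].
  split; split; rewrite /= ?in_itv//= => i; rewrite /= in_itv/=.
    by rewrite -ler_distl.
  by rewrite -ler_distl; exact: dist_transl (h1 i) (near_xy x y i h2).
have DS p : D p -> strip T p.1 /\ strip T p.2.
  by move=> [[h1 _] [h2 _]]; split; split.
have cg : continuous g.
  move=> t; apply: differentiable_continuous; apply/derivable1_diffP.
  by have [] := dg t.
have cF := Phi_continuous g x0 rho eta e' D cg (exprn_gt0 2 rho_gt0) DS.
have Ft0 : 0 < F t0 x0 t0 y0 by apply: lt_le_trans Ftarget; rewrite mulr_gt0.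
have D0 : D !=set0 by exists ((t0, x0), (t0, y0)); exact: inD.
have [[[t x] [s y]] /set_mem Dc mx] := compact_EVT_max D0 cD cF.
have tT : 0 <= t <= T by case: Dc => [[h _] _]; move: h; rewrite /= in_itv.
have sT : 0 <= s <= T by case: Dc => [_ [h _]]; move: h; rewrite /= in_itv.
have {}mx t' x' s' y' : 0 <= t' <= T -> 0 <= s' <= T -> F t' x' s' y' <= F t x s y.
  move=> t'T s'T; have [h|h] := ltP 0 (F t' x' s' y').
    by apply: (mx ((t', x'), (s', y'))); apply/mem_set; exact: inD.
  apply: (le_trans h); apply: (le_trans (ltW Ft0)).
  by apply: (mx ((t0, x0), (t0, y0))); apply/mem_set; exact: inD.
have Fmax : 2 * e <= F t x s y by apply: (le_trans Ftarget); exact: mx.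
have F0 : 0 < F t x s y by apply: lt_le_trans Fmax; rewrite mulr_gt0.
have [c1 c2 tlt slt c5] := conf t s x y tT sT F0.
have ts : `|t - s| <= om.
  rewrite -ler_sqr ?nnegrE ?(ltW om0)// real_normK ?num_real//.
  exact: le_trans c5 Beta.
have [t_ge0 _] := andP tT; have [s_ge0 _] := andP sT.
have [omt1 omt2] : om <= tau1 /\ om <= tau2.
  by rewrite !ge_min !lexx/= orbT.
have d0 : 0 <= enorm (x - y) by exact: enorm_ge0.
have d_le : enorm (x - y) <= rho1.
  by apply: le_sqr_add1; rewrite -qE.
(* If one time is 0, both are at most [om], and [initial_bound] gives 2e <= e / 2, which is absurd.
   Otherwise both times are interior, since [confinement] excludes [T]. *)
have [H0|[tp sp]] : (t = 0 \/ s = 0) \/ (0 < t /\ 0 < s).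
  have [->|t1] := eqVneq t 0; first by left; left.
  have [->|s1] := eqVneq s 0; first by left; right.
  by right; rewrite !lt0r t1 s1 t_ge0.
- have [tom som] : t <= om /\ s <= om.
    by case: H0 ts => ->; rewrite ?subr0 ?sub0r ?normrN ger0_norm// => ->; rewrite (ltW om0).
  have hu := Htau1 t x tT (le_trans tom omt1) c1.
  have hw : `|w s y - w 0 y| <= e / 4.
    apply: Htau2 => //; first exact: le_trans som omt2.
    by move=> i; exact: dist_transl (c1 i) (near_xy x y i c2).
  have := initial_bound g x0 rho eta e' (e / 4) t s x y (proj1 (gg' t tT)) (proj1 (gg' s sT))
    eta0 (ltW e'0) sigma0 t_ge0 B00 hu hw.
  move=> h; have : 2 * e <= 2 * (e / 4) := le_trans Fmax h.
  by rewrite ler_pM2l// leNgt ltr_pdivrMr// ltr_pMr// ltr1n.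
have Hr0 : n.+1%:R * enorm ((2 * al t) *: (x - y)) + 4 * B0 * n%:R < r0.
  rewrite /r0 enormZ (ger0_norm (mulr_ge0 (ler0n R 2) (ltW (al_gt0 t)))).
  apply: (@le_lt_trans _ _ (n.+1%:R * (2 * al T * rho1) + 4 * B0 * n%:R)); last by rewrite ltrDl.
  rewrite lerD2r; apply: ler_wpM2l; first exact: ler0n.
  apply: ler_pM => //; first by apply: mulr_ge0 => //; exact: ltW (al_gt0 t).
  by apply: ler_wpM2l => //; exact: al_le (ltW tlt).
have tT1 : 0 < t < T by rewrite tp.
have sT1 : 0 < s < T by rewrite sp.
have uw := ordered_values g x0 rho eta e' t s x y (proj1 (gg' t tT)) (proj1 (gg' s sT))
  eta0 (ltW e'0) sigma0 t_ge0 B00 F0.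
have main := doubling_interior g g' x0 rho eta e' r0 Cb0 t s x y dg cg' (fun t tT => proj2 (gg' t tT))
  rho_ge1 eta0 (HCb0 rho rho_ge1) tT1 sT1 mx uw Hr0.
have h2 := ler_wpM2l ef0 (rate_absorption Cb0 B00 K40 rho_ge1).
have h3 := ler_wpM2l (normr_ge0 (A r0))
  (invsq_absorption (mulr_ge0 (mulr_ge0 (ler0n R 4) B00) (ler0n R n)) rho_ge1).
have h4 : L * (1 + r0) * `|t - s| <= e' / 3.
  have h5 : `|t - s| <= e' / (3 * L * (1 + r0)) by rewrite (le_trans ts)// ge_min lexx orbT.
  exact: third_of_le L_gt0 r00 h5.
(* The time gap costs at most e' / 3 and the bump terms together at most e' / 3, whereas [main] says
   that they add up to at least e'. *)
have fin := le_trans main (lerD (lerD h2 h4) h3).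
apply: (two_thirds_contradiction e'0 fin); move: C1rho.
by rewrite /C1 [X in X <= _]mulrDl -(mulrA (eps * frac_const n)) -(mulrA `|A r0|).
Qed.

(** [w] is minus the function with which [u] is compared. [G0] majorizes its decreases in space,
    with kernel integral at most [S0], and [sigma] is the resulting nonlocal error per unit of
    time. *)
Lemma doubling_comparison (t : R) (x y : 'rV[R]_n) : 0 <= t <= T ->
  u t x + w t y <= expR (3 * L * t) / (2 * delta) * (\sum_i (x ord0 i - y ord0 i) ^+ 2)
    + delta * (M0 ^+ 2 + L * t) / 2 + sigma * t.
Proof.
rewrite -/(al t) -/(q x y) => /andP[t_ge0 t_leT].
have [->|t0] := eqVneq t 0.
  apply: (le_trans (init x y)); rewrite /al !mulr0 expR0 addr0 addr0 qE.
  have h2 : 0 <= (enorm (x - y) - delta * M0) ^+ 2 / (2 * delta) by nneg.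
  have -> : 1 / (2 * delta) * enorm (x - y) ^+ 2 + delta * M0 ^+ 2 / 2 =
     M0 * enorm (x - y) + (enorm (x - y) - delta * M0) ^+ 2 / (2 * delta).
    by field; rewrite gt_eqF.
  by rewrite lerDl.
have {t0}t_gt0 : 0 < t by rewrite lt0r t0.
(* The viscosity inequalities hold at times strictly below [T]; the final time is reached as a left
   limit. *)
have [tE|tT] := eqVneq t T; last first.
  by apply: doubling_comparison_lt; rewrite t_gt0 lt_neqAle tT.
rewrite {t t_ge0 t_leT t_gt0}tE.
pose f s := al s * q x y + delta * (M0 ^+ 2 + L * s) / 2 + sigma * s.
have left_limit (v : R -> 'rV[R]_n -> R) z : continuous_on_strip T v ->
    v s z @[s --> T^'-] --> v T z.
  move=> cv; have /(continuous_within_itvP _ T_gt0)[_ _ ] :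
      {within `[0, T], continuous (fun s => v s z)}.
    apply: (continuous_on_strip_comp T v cv _ _ (fun s : R => (s, z))).
      by move=> s; exact: (cvg_pair (f := id) (g := cst z) cvg_id (cvg_cst z)).
    by move=> s sT; split.
  by [].
have cf : f s @[s --> T^'-] --> f T.
  apply: cvg_at_left_filter; apply: cvgD; first apply: cvgD.
  - apply: cvgM; last exact: cvg_cst.
    apply: differentiable_continuous; apply/derivable1_diffP.
    by have [] := is_derive_al T.
  - apply: cvgM; last exact: cvg_cst.
    apply: cvgM; first exact: cvg_cst.
    apply: cvgD; first exact: cvg_cst.
    by apply: cvgM; [exact: cvg_cst|exact: cvg_id].
  - by apply: cvgM; [exact: cvg_cst|exact: cvg_id].
have cu := left_limit u x uc; have cw := left_limit w y wc.
have H1 : f s - (u s x + w s y) @[s --> T^'-] --> f T - (u T x + w T y).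
  by apply: cvgB => //; apply: cvgD.
rewrite -subr_ge0 -/(f T) -(cvg_lim _ H1)//; apply: limr_ge.
  by apply/cvg_ex; exists (f T - (u T x + w T y)).
near=> s; rewrite subr_ge0; apply: doubling_comparison_lt.
apply/andP; split; near: s; [exact: nbhs_left_gt|exact: nbhs_left_lt].
Unshelve. all: by end_near. Qed.

End doubling.

(** * Smooth compactly supported functions *)

Section flat_functions.
Context {R : realType}.
Implicit Types (m : nat) (s x : R).

(** The index [m] makes the family stable under differentiation: the derivative is a combination of
    the members m + 2 and m + 1. Smoothness of all orders then follows by one induction valid for
    every [m]. *)
Definition flat m s : R := if 0 < s then s^-1 ^+ m * expR (- s^-1) else 0.

Lemma flat_le0 m s : s <= 0 -> flat m s = 0.
Proof. by rewrite /flat leNgt => /negbTE ->. Qed.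

Lemma flat_ge0 m s : 0 <= flat m s.
Proof.
rewrite /flat; case: ifP => // s0.
by rewrite mulr_ge0 ?expR_ge0// exprn_ge0// invr_ge0 ltW.
Qed.

Lemma flat_shift m s : flat m s = flat m.+1 s * s.
Proof.
rewrite /flat; case: ifP => s0; last by rewrite mul0r.
by rewrite exprSr -!mulrA; congr (_ * _); rewrite mulrCA mulVf ?mulr1// gt_eqF.
Qed.

(** With x = 1/s this is x^m <= m^m e^x, the m-th power of x/m <= e^(x/m). For m = 0 it relies on
    0^0 = 1. *)
Lemma flat_bound m s : flat m s <= m%:R ^+ m.
Proof.
rewrite /flat; case: ifP => s0; last by rewrite exprn_ge0.
have x0 : 0 < s^-1 by rewrite invr_gt0.
rewrite expRN ler_pdivrMr ?expR_gt0//; move: x0; move: (s^-1) => x x0.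
case: m => [|m]; first by rewrite !expr0 mul1r (le_trans _ (expR_ge1Dx _))// lerDl ltW.
have -> : expR x = expR (x / m.+1%:R) ^+ m.+1.
  by rewrite -expRM_natr divfK// pnatr_eq0.
rewrite -exprMn lerXn2r ?nnegrE ?mulr_ge0 ?expR_ge0 ?(ltW x0)//.
rewrite -ler_pdivrMl// mulrC (le_trans _ (expR_ge1Dx _))// lerDr//.
Qed.

Lemma continuous_flat0 m : {for (0 : R), continuous (flat m)}.
Proof.
rewrite /prop_for /continuous_at (flat_le0 m 0)//; apply/cvgr0Pnorm_le => e e0.
have c0 : 0 < m.+1%:R ^+ m.+1 :> R by rewrite exprn_gt0.
exists (e / m.+1%:R ^+ m.+1) => /=; first by rewrite divr_gt0.
move=> s /=; rewrite sub0r normrN => h.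
rewrite flat_shift normrM (ger0_norm (flat_ge0 _ _)).
apply: (le_trans (ler_wpM2r (normr_ge0 s) (flat_bound m.+1 s))).
by rewrite mulrC -ler_pdivlMr// ltW.
Qed.

Lemma is_derive_flat m s :
  is_derive s (1 : R) (flat m) (flat m.+2 s - m%:R * flat m.+1 s).
Proof.
have [s0|s0|->] := ltgtP s 0.
- apply: (near_eq_is_derive (f := cst 0)).
    near=> t; rewrite flat_le0//; apply: ltW; near: t; exact: lt_nbhsl.
  rewrite !flat_le0 ?(ltW s0)// mulr0 subr0; exact: is_derive_cst.
- apply: (near_eq_is_derive (f := ((fun y : R => y^-1) ^+ m) * (expR \o (fun y : R => - y^-1)))).
    near=> t; rewrite !fctE /flat ifT//; near: t; exact: lt_nbhsr.
  have sn : s != 0 by rewrite gt_eqF.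
  have V := @is_deriveV R id s _ 1 sn (is_derive_id s (1 : R)).
  have H := is_deriveM (is_deriveX m V)
    (@is_derive1_comp R expR (fun y : R => - y^-1) s _ _ (is_derive_expR _) (is_deriveN V)).
  apply: (is_derive_eq H); rewrite /flat s0 !fctE/= /GRing.scale/= mulr1.
  rewrite -exprVn; move: (expR _) => E; move: (s^-1) => x.
  case: m {H} => [|m] /=; first by rewrite !mul0r !expr0 !mulr0 subr0 addr0; ring.
  by rewrite !exprS; ring.
(* At 0 the slope function is [flat m.+1], by [flat_shift]; it is continuous there with value 0. *)
- apply/is_derive1_caratheodory; exists (flat m.+1); split.
  + by move=> z; rewrite (flat_le0 m 0)// !subr0 -flat_shift.
  + exact: continuous_flat0.
  + by rewrite !flat_le0// mulr0 subr0.
Unshelve. all: by end_near. Qed.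

Lemma is_derive_lipschitz (f f' : R -> R) (C x y : R) :
  (forall t : R, is_derive t (1 : R) f (f' t)) -> (forall t, `|f' t| <= C) ->
  `|f y - f x| <= C * `|y - x|.
Proof.
move=> df bf.
have cf : continuous f.
  move=> t; apply: differentiable_continuous; apply/derivable1_diffP.
  by have [] := df t.
wlog xy : x y / x <= y.
  by case: (leP x y) => [|/ltW] h H; [exact: H|rewrite distrC (distrC y) H].
have [c _ ->] := MVT_segment xy (fun t _ => df t) (continuous_subspaceT cf).
by rewrite normrM ler_wpM2r.
Qed.

(** The mean value theorem for [f], followed by the Lipschitz bound for [f']; the sharp factor 1/2
    is given up. *)
Lemma taylor1_bound (f f' f'' : R -> R) (C x h : R) :
  (forall t : R, is_derive t (1 : R) f (f' t)) ->
  (forall t : R, is_derive t (1 : R) f' (f'' t)) ->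
  (forall t, `|f'' t| <= C) ->
  `|f (x + h) - f x - h * f' x| <= C * h ^+ 2.
Proof.
move=> df df' bf''.
have C0 : 0 <= C by exact: le_trans (bf'' 0).
have cf : continuous f.
  move=> t; apply: differentiable_continuous; apply/derivable1_diffP.
  by have [] := df t.
have [xi [hxi ->]] : exists xi, `|xi - x| <= `|h| /\ f (x + h) - f x = h * f' xi.
  have [h0|/ltW h0] := leP 0 h.
    have xh : x <= x + h by rewrite lerDl.
    have [c] := MVT_segment xh (fun t _ => df t) (continuous_subspaceT cf).
    rewrite in_itv/= => /andP[a b] E; exists c; split.
      by rewrite !ger0_norm// ?subr_ge0// lerBlDl.
    by rewrite E addrAC subrr add0r mulrC.
  have xh : x + h <= x by rewrite gerDl.
  have [c] := MVT_segment xh (fun t _ => df t) (continuous_subspaceT cf).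
  rewrite in_itv/= => /andP[a b] E; exists c; split.
    by rewrite !ler0_norm ?subr_le0//; lra.
  by rewrite -opprB E; ring.
rewrite -mulrBr normrM expr2 -[h * h]ger0_norm -?expr2 ?sqr_ge0// expr2 normrM mulrCA.
rewrite ler_wpM2l//; apply: le_trans (is_derive_lipschitz _ _ _ _ _ df' bf'') _.
by rewrite ler_wpM2l.
Qed.

(** Cutting the segment into N equal pieces leaves the linear terms unchanged in total, while the
    quadratic ones add up to B h^2 / N. *)
Lemma lipschitz_of_increments (Phi : R -> R) (A B : R) : 0 <= B ->
  (forall s h, `|h| <= 1 -> `|Phi (s + h) - Phi s| <= A * `|h| + B * h ^+ 2) ->
  forall h, `|Phi h - Phi 0| <= A * `|h|.
Proof.
move=> B0 H h; apply/ler_addgt0Pr => d d0.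
have [N N1 N2] : exists2 N, `|h| <= N.+1%:R & B * h ^+ 2 <= d * N.+1%:R.
  exists (Num.truncn (Num.max `|h| (B * h ^+ 2 / d))).
    by apply: le_trans (ltW (truncnS_gt _)); rewrite le_max lexx.
  rewrite -ler_pdivrMl// mulrC.
  by apply: le_trans (ltW (truncnS_gt _)); rewrite le_max lexx orbT.
have N0 : 0 < N.+1%:R :> R by [].
pose s := h / N.+1%:R.
have s1 : `|s| <= 1 by rewrite normrM normfV (ger0_norm (ltW N0)) ler_pdivrMr// mul1r.
have S k : `|Phi (k%:R * s) - Phi 0| <= k%:R * (A * `|s| + B * s ^+ 2).
  elim: k => [|k IH]; first by rewrite !mul0r subrr normr0.
  have -> : Phi (k.+1%:R * s) - Phi 0 = (Phi (k%:R * s + s) - Phi (k%:R * s)) + (Phi (k%:R * s) - Phi 0).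
    by rewrite -natr1 mulrDl mul1r; ring.
  apply: le_trans (ler_normD _ _) _; rewrite -natr1 mulrDl mul1r addrC.
  by apply: lerD => //; exact: H.
have := S N.+1; rewrite /s mulrCA divff ?gt_eqF// mulr1 => /le_trans; apply.
rewrite normrM normfV (ger0_norm (ltW N0)) expr_div_n mulrDr; apply: lerD.
  by rewrite [X in X <= _](_ : _ = A * `|h|)//; field; rewrite ?natr1 gt_eqF.
rewrite [X in X <= _](_ : _ = B * h ^+ 2 / N.+1%:R).
  by rewrite ler_pdivrMr.
by field; rewrite ?natr1 gt_eqF.
Qed.

Definition bump s : R := flat 0 s * flat 0 (1 - s).
Definition bump' s : R := flat 2 s * flat 0 (1 - s) - flat 0 s * flat 2 (1 - s).
Definition bump'' s : R :=
  (flat 4 s - 2 * flat 3 s) * flat 0 (1 - s) - 2 * (flat 2 s * flat 2 (1 - s))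
  + flat 0 s * (flat 4 (1 - s) - 2 * flat 3 (1 - s)).

Lemma is_derive_flat_rev m s : is_derive s (1 : R) (fun t => flat m (1 - t))
  (- (flat m.+2 (1 - s) - m%:R * flat m.+1 (1 - s))).
Proof.
have D := is_deriveB (is_derive_cst (1 : R) s (1 : R)) (is_derive_id s (1 : R)).
have E := @is_derive1_comp R (flat m) (fun t => 1 - t) s _ _ (is_derive_flat m (1 - s)) D.
by apply: (is_derive_eq E); rewrite sub0r mulrN1.
Qed.

Lemma is_derive_bump s : is_derive s (1 : R) bump (bump' s).
Proof.
apply: (is_derive_eq (is_deriveM (is_derive_flat 0 s) (is_derive_flat_rev 0 s))).
by rewrite /bump' /GRing.scale/=; ring.
Qed.

Lemma is_derive_bump' s : is_derive s (1 : R) bump' (bump'' s).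
Proof.
have H := is_deriveB (is_deriveM (is_derive_flat 2 s) (is_derive_flat_rev 0 s))
  (is_deriveM (is_derive_flat 0 s) (is_derive_flat_rev 2 s)).
by apply: (is_derive_eq H); rewrite /bump'' /GRing.scale/=; ring.
Qed.

Lemma bump_ge0 s : 0 <= bump s.
Proof. by rewrite mulr_ge0 ?flat_ge0. Qed.

Lemma bump_le1 s : bump s <= 1.
Proof.
have := flat_bound 0 s; have := flat_bound 0 (1 - s); rewrite expr0 => a b.
by rewrite mulr_ile1// flat_ge0.
Qed.

Lemma bump_out s : ~~ (0 < s < 1) -> [/\ bump s = 0, bump' s = 0 & bump'' s = 0].
Proof.
rewrite negb_and -!leNgt => /orP[h|h].
  by rewrite /bump /bump' /bump'' !(flat_le0 _ _ h) !(mul0r, mulr0, subr0, addr0).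
have h' : 1 - s <= 0 by rewrite subr_le0.
by rewrite /bump /bump' /bump'' !(flat_le0 _ _ h') !(mul0r, mulr0, subr0, addr0).
Qed.

Lemma bump_gt0 s : 0 < s < 1 -> 0 < bump s.
Proof.
move=> /andP[s0 s1]; rewrite /bump /flat s0 subr_gt0 s1 !expr0 !mul1r.
by rewrite mulr_gt0 ?expR_gt0.
Qed.

Lemma bump''_bounded : exists C, forall s, `|bump'' s| <= C.
Proof.
pose b m : R := m%:R ^+ m.
have F m s : `|flat m s| <= b m by rewrite ger0_norm ?flat_ge0// flat_bound.
exists ((b 4%N + 2 * b 3%N) * b 0%N + 2 * (b 2%N * b 2%N) + b 0%N * (b 4%N + 2 * b 3%N)) => s.
have G t : `|flat 4 t - 2 * flat 3 t| <= b 4%N + 2 * b 3%N.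
  apply: (le_trans (ler_normB _ _)); rewrite lerD//.
  by rewrite normrM ger0_norm// ler_wpM2l.
apply: (le_trans (ler_normD _ _)); apply: lerD; last by rewrite normrM ler_pM.
apply: (le_trans (ler_normB _ _)); apply: lerD; first by rewrite normrM ler_pM.
by rewrite normrM ger0_norm// ler_wpM2l// normrM ler_pM.
Qed.

End flat_functions.

(** * Closure properties of [Ck] *)

Section smooth_functions.
Context {R : realType} {n : nat}.
Implicit Types (f g : 'rV[R]_n -> R) (k : nat).

Lemma CkW k f : Ck k.+1 f -> Ck k f.
Proof.
elim: k f => [|k IH] f [cf H]; split => // i.
by have [df Hf] := H i; split => //; exact: IH.
Qed.

Lemma Ck_cst k (c : R) : Ck k (cst c : 'rV[R]_n -> R).
Proof.
have C c' : continuous (cst c' : 'rV[R]_n -> R) by exact: cst_continuous.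
elim: k c => [|k IH] c; split => //.
move=> i; split; first by move=> x; have [] := is_derive_cst c x (delta_mx ord0 i : 'rV[R]_n).
rewrite (_ : partial i _ = cst 0); first exact: IH.
by apply/funext => x; rewrite /partial derive_cst.
Qed.

Lemma CkD k f g : Ck k f -> Ck k g -> Ck k (f \+ g).
Proof.
elim: k f g => [|k IH] f g [cf Hf] [cg Hg]; split.
- by move=> x; exact: (continuousD (cf x) (cg x)).
- by [].
- by move=> x; exact: (continuousD (cf x) (cg x)).
- move=> i; have [df Cf] := Hf i; have [dg Cg] := Hg i; split.
    by move=> x; exact: derivableD.
  rewrite (_ : partial i _ = partial i f \+ partial i g); first exact: IH.
  by apply/funext => x; rewrite /partial deriveD.
Qed.

Lemma CkM k f g : Ck k f -> Ck k g -> Ck k (f \* g).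
Proof.
elim: k f g => [|k IH] f g Cf Cg; have [cf Hf] := Cf; have [cg Hg] := Cg; split.
- by move=> x; exact: (continuousM (cf x) (cg x)).
- by [].
- by move=> x; exact: (continuousM (cf x) (cg x)).
- move=> i; have [df Cpf] := Hf i; have [dg Cpg] := Hg i; split.
    by move=> x; exact: derivableM.
  rewrite (_ : partial i _ = (f \* partial i g) \+ (g \* partial i f)).
    by apply: CkD; apply: IH => //; exact: CkW.
  by apply/funext => x; rewrite /partial deriveM.
Qed.

Lemma is_derive_coord (h : R -> R) (x : 'rV[R]_n) (i j : 'I_n) (d : R) :
  is_derive (x ord0 j) (1 : R) h d ->
  is_derive x (delta_mx ord0 i) (fun x : 'rV[R]_n => h (x ord0 j)) (if i == j then d else 0).
Proof.
move=> dh.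
have -> : (fun x : 'rV[R]_n => h (x ord0 j)) =
    (fun x => 0 + \sum_l (if l == j then h else cst 0) (x ord0 l)).
  apply/funext => u; rewrite add0r (bigD1 j)//= eqxx big1 ?addr0// => l li.
  by rewrite (negbTE li).
apply: (is_derive_separable 0 (fun l => if l == j then h else cst 0)).
by case: eqP => [->|_]; [exact: dh|exact: is_derive_cst].
Qed.

Lemma Ck_flat k m (a c : R) (j : 'I_n) : Ck k (fun x : 'rV[R]_n => flat m (a * x ord0 j + c)).
Proof.
have D m' (s : R) : is_derive s (1 : R) (fun s => flat m' (a * s + c))
    (a * (flat m'.+2 (a * s + c) - m'%:R * flat m'.+1 (a * s + c))).
  have D1 := is_deriveD (is_deriveZ a (is_derive_id s (1 : R))) (is_derive_cst c s (1 : R)).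
  have E := @is_derive1_comp R (flat m') (fun s => a * s + c) s _ _ (is_derive_flat m' _) D1.
  by apply: (is_derive_eq E); rewrite addr0 /GRing.scale/= mulr1 mulrC.
have C m' : continuous (fun x : 'rV[R]_n => flat m' (a * x ord0 j + c)).
  move=> x; apply: (continuous_comp (f := fun x : 'rV[R]_n => x ord0 j)
    (g := fun s => flat m' (a * s + c))); first exact: coord_continuous.
  by apply: differentiable_continuous; apply/derivable1_diffP; have [] := D m' (x ord0 j).
elim: k m => [|k IH] m; split => // i; split.
  by move=> x; have [] := is_derive_coord _ x i j _ (D m (x ord0 j)).
rewrite (_ : partial i _ = (cst (if i == j then a else 0)) \*
   ((fun x => flat m.+2 (a * x ord0 j + c)) \+
    (cst (- m%:R) \* (fun x => flat m.+1 (a * x ord0 j + c))))).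
  by apply: CkM (Ck_cst _ _) (CkD _ _ _ (IH _) (CkM _ _ _ (Ck_cst _ _) (IH _))).
apply/funext => x; have [_] := is_derive_coord _ x i j _ (D m (x ord0 j)).
rewrite /partial => -> /=; rewrite mulNr.
by case: eqP => // _; rewrite mul0r.
Qed.

Lemma Ck_prod k (I : Type) (s : seq I) (f : I -> 'rV[R]_n -> R) :
  (forall i, Ck k (f i)) -> Ck k (fun x => \prod_(i <- s) f i x).
Proof.
move=> Cf; elim: s => [|i s IH].
  rewrite (_ : (fun x => _) = cst 1); first exact: Ck_cst.
  by apply/funext => x; rewrite big_nil.
rewrite (_ : (fun x => _) = f i \* (fun x => \prod_(j <- s) f j x)); first exact: CkM.
by apply/funext => x; rewrite big_cons.
Qed.

End smooth_functions.

(** * Lipschitz bound for the initial datum *)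

Section mollification.
Context {R : realType} {n : nat}.
Local Notation mu := (@lebesgue_rV R n).
Implicit Types (x y z : 'rV[R]_n) (i j : 'I_n).

Definition box (a b : 'rV[R]_n) : set 'rV[R]_n :=
  [set x | forall i, a ord0 i <= x ord0 i <= b ord0 i].

Lemma box_measure_lty (a b : 'rV[R]_n) : (mu (box a b) < +oo)%E.
Proof.
have [ab|/existsNP[i ab]] := pselect (forall i, a ord0 i <= b ord0 i).
  by rewrite (lebesgue_rV_box ab) ltry.
rewrite (_ : box a b = set0) ?measure0//.
by apply/seteqP; split => z // /(_ i) /andP[h1 h2]; apply: ab; exact: le_trans h2.
Qed.

Lemma box_measure_gt0 (a b : 'rV[R]_n) : (forall i, a ord0 i < b ord0 i) -> (0 < mu (box a b))%E.
Proof.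
move=> ab; rewrite (lebesgue_rV_box (fun i => ltW (ab i))) lte_fin.
by apply: prodr_gt0 => i _; rewrite subr_gt0.
Qed.

Lemma ae_exists_in_box (Q : 'rV[R]_n -> Prop) (a b : 'rV[R]_n) :
  (\forall z \ae mu, Q z) -> (forall i, a ord0 i < b ord0 i) ->
  exists2 z, box a b z & Q z.
Proof.
move=> aeQ ab; apply: contrapT => H.
have := box_measure_gt0 _ _ ab; rewrite measure_negligible ?ltxx//.
  exact: measurable_box.
apply: negligibleS aeQ => z Bz Qz; apply: H; exists z => //.
Qed.

Lemma integrable_bounded_support (F : 'rV[R]_n -> R) (M : R) (a b : 'rV[R]_n) :
  measurable_fun setT F -> (forall z, `|F z| <= M) -> (forall z, ~ box a b z -> F z = 0) ->
  mu.-integrable setT (EFin \o F).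
Proof.
move=> mF FM F0.
have -> : EFin \o F = (EFin \o F) \_ (box a b).
  apply/funext => z; rewrite patchE; case: ifPn => //= /negP zb.
  by rewrite F0// => Bz; apply: zb; exact/mem_set.
rewrite -integrable_mkcond; last exact: measurable_box.
apply: measurable_bounded_integrable.
- exact: measurable_box.
- exact: box_measure_lty.
- exact: measurable_funTS.
- by exists M; split; [exact: num_real|move=> N MN z _; exact: le_trans (FM z) (ltW MN)].
Qed.

Lemma Rintegral_bounded_support (F : 'rV[R]_n -> R) (M : R) (a b : 'rV[R]_n) :
  0 <= M -> measurable_fun setT F -> (forall z, `|F z| <= M) ->
  (forall z, ~ box a b z -> F z = 0) ->
  `|\int[mu]_z F z| <= M * fine (mu (box a b)).
Proof.
move=> M0 mF FM F0.
have muE : mu (box a b) = (fine (mu (box a b)))%:E.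
  by rewrite fineK// ge0_fin_numE ?box_measure_lty.
have B : (\int[mu]_(z in setT) (M * \1_(box a b) z)%:E <= (M * fine (mu (box a b)))%:E)%E.
  have mb : measurable (box a b) by exact: measurable_box.
  have -> : (\int[mu]_z (M * \1_(box a b) z)%:E = \int[mu]_(z in box a b) M%:E)%E.
    rewrite [RHS]integral_mkcond; apply: eq_integral => z _.
    by rewrite patchE indicE; case: ifPn => _; rewrite ?mulr1 ?mulr0.
  by rewrite integral_cst// EFinM -muE.
have G0 z : setT z -> 0 <= M * \1_(box a b) z by move=> _; rewrite mulr_ge0// indicE.
have FG z : `|F z| <= M * \1_(box a b) z.
  rewrite indicE; have [|/negP h] := boolP (z \in box a b); first by rewrite mulr1.
  by rewrite F0 ?normr0 ?mulr0// => Bz; apply: h; exact/mem_set.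
rewrite ler_norml; apply/andP; split.
  by apply: Rintegral_ge_any B => // z _; rewrite lerNl; apply: le_trans (FG z); rewrite -normrN ler_norm.
by apply: Rintegral_le_any B => // z _; apply: le_trans (FG z); exact: ler_norm.
Qed.

Lemma ge0_integral_shift (F : 'rV[R]_n -> \bar R) (c : 'rV[R]_n) :
  measurable_fun setT F -> (forall z, 0 <= F z)%E ->
  (\int[mu]_z F (z + c)%R = \int[mu]_z F z)%E.
Proof.
move=> mF F0.
have E : forall A, measurable A -> A `<=` [set: 'rV[R]_n] ->
    mu A = pushforward mu (fun z : 'rV[R]_n => z + c) A.
  by move=> A mA _; rewrite /pushforward lebesgue_rV_shift.
rewrite [RHS](eq_measure_integral _ E); first exact: measurable_shift_rV.
by move=> ms; rewrite [RHS](ge0_integral_pushforward ms)// preimage_setT.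
Qed.

Lemma measurable_fun_coord_comp (f : R -> R) j : continuous f ->
  measurable_fun setT (fun z : 'rV[R]_n => f (z ord0 j)).
Proof.
move=> cf; apply: (measurableT_comp (f := f)); last exact: measurable_coord.
exact: continuous_measurable_fun.
Qed.

(** Lets [partial_mollifier] replace the product by its slice in one variable, the other factors
    being frozen. *)
Lemma is_derive_line (f g : 'rV[R]_n -> R) x (v : 'rV[R]_n) (d : R) :
  (forall h : R, f (h *: v + x) = g (h *: v + x)) -> is_derive x v g d ->
  is_derive x v f d.
Proof.
move=> fg [dg <-].
have fgx : f x = g x by have := fg 0; rewrite scale0r add0r.
have E : (fun h : R => h^-1 *: ((f \o shift x) (h *: v) - f x)) =
         (fun h : R => h^-1 *: ((g \o shift x) (h *: v) - g x)).
  by apply/funext => h; rewrite /= fg fgx.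
by apply: DeriveDef; [rewrite /derivable E|rewrite /derive E].
Qed.

Variable eps : R.
Hypothesis eps_gt0 : 0 < eps.

(** Left unnormalized: its positive mass appears as a factor in every estimate and is divided out in
    [weak_partial_lipschitz]. The support is the cube with lower corner [y] and side [eps]. *)
Definition mollifier y z : R := \prod_(j < n) bump ((z ord0 j - y ord0 j) / eps).

Lemma mollifier_split y z i : mollifier y z =
  bump ((z ord0 i - y ord0 i) / eps) * \prod_(j < n | j != i) bump ((z ord0 j - y ord0 j) / eps).
Proof. by rewrite /mollifier (bigD1 i). Qed.

Lemma mollifier_ge0 y z : 0 <= mollifier y z.
Proof. by apply: prodr_ge0 => j _; exact: bump_ge0. Qed.

Let rest01 y z i : 0 <= \prod_(j < n | j != i) bump ((z ord0 j - y ord0 j) / eps) <= 1.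
Proof.
apply/andP; split; first by apply: prodr_ge0 => j _; exact: bump_ge0.
by apply: prodr_ile1 => j _; rewrite bump_ge0 bump_le1.
Qed.

Lemma mollifier_le1 y z : mollifier y z <= 1.
Proof. by apply: prodr_ile1 => j _; rewrite bump_ge0 bump_le1. Qed.

Lemma mollifier_support y z : mollifier y z != 0 ->
  forall i, y ord0 i < z ord0 i < y ord0 i + eps.
Proof.
move=> P i; apply/negPn/negP => H; move/negP: P; apply; apply/eqP.
rewrite (mollifier_split y z i).
have /bump_out[-> _ _] : ~~ (0 < (z ord0 i - y ord0 i) / eps < 1); last by rewrite mul0r.
apply: contra H => /andP[]; rewrite pmulr_lgt0 ?invr_gt0// subr_gt0 => -> /=.
by rewrite ltr_pdivrMr// mul1r ltrBlDl.
Qed.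

Lemma Ck_mollifier k y : Ck k (mollifier y).
Proof.
apply: Ck_prod => j.
rewrite (_ : (fun z => _) = (fun z => flat 0 (eps^-1 * z ord0 j + - (y ord0 j / eps)))
   \* (fun z => flat 0 (- eps^-1 * z ord0 j + (1 + y ord0 j / eps)))).
  by apply: CkM; exact: Ck_flat.
by apply/funext => z; rewrite /bump /=; congr (flat 0 _ * flat 0 _); ring.
Qed.

Lemma compact_box a b : compact (box a b).
Proof.
rewrite (_ : box a b = [set v | forall i, `[a ord0 i, b ord0 i]%classic (v ord0 i)]).
  apply: (@rV_compact R n (fun i => `[a ord0 i, b ord0 i]%classic)) => i.
  exact: segment_compact.
by apply/seteqP; split => v h i; have := h i; rewrite /= in_itv.
Qed.

Lemma test_function_mollifier y : test_function (mollifier y).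
Proof.
split; first by move=> k; exact: Ck_mollifier.
have cb := compact_box y (y + const_mx eps).
apply: (subclosed_compact _ cb); first exact: closed_closure.
have : closed (box y (y + const_mx eps)) by apply: compact_closed cb; exact: norm_hausdorff.
move=> /closure_id ->; apply: closure_subset => z /= /mollifier_support H i.
by have /andP[h1 h2] := H i; rewrite !mxE !ltW.
Qed.

Definition dmollifier i y z : R :=
  bump' ((z ord0 i - y ord0 i) / eps) / eps *
  \prod_(j < n | j != i) bump ((z ord0 j - y ord0 j) / eps).

Lemma partial_mollifier i y : partial i (mollifier y) = dmollifier i y.
Proof.
apply/funext => z.
pose c := \prod_(j < n | j != i) bump ((z ord0 j - y ord0 j) / eps).
have D : is_derive (z ord0 i) (1 : R) (fun s => c * bump ((s - y ord0 i) / eps))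
    (c * (bump' ((z ord0 i - y ord0 i) / eps) / eps)).
  have E := is_deriveZ c (@is_derive1_comp R bump (fun s => (s - y ord0 i) / eps) _ _ _
    (is_derive_bump _) (is_derive_affine eps (y ord0 i) (z ord0 i))).
  exact: (is_derive_eq E).
have := is_derive_line (mollifier y) _ z (delta_mx ord0 i) _ _
  (is_derive_coord _ z i i _ D).
rewrite eqxx; case; last by move=> _; rewrite /partial => ->; rewrite /dmollifier -/c mulrC.
move=> h; rewrite (mollifier_split _ _ i) mulrC; congr (_ * _).
apply: eq_bigr => j ji; congr (bump ((_ - _) / _)).
by rewrite !mxE (negbTE ji) andbF mulr0 add0r.
Qed.

Let measurable_scaled (f f' : R -> R) y j : (forall s : R, is_derive s (1 : R) f (f' s)) ->
  measurable_fun setT (fun z : 'rV[R]_n => f ((z ord0 j - y ord0 j) / eps)).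
Proof.
move=> df; apply: (measurable_fun_coord_comp (fun s : R => f ((s - y ord0 j) / eps))) => s.
apply: (continuous_comp (f := fun s : R => (s - y ord0 j) / eps) (g := f)).
  exact: continuous_affine.
by apply: differentiable_continuous; apply/derivable1_diffP; have [] := df ((s - y ord0 j) / eps).
Qed.

Lemma measurable_mollifier y : measurable_fun setT (mollifier y).
Proof. by apply: measurable_prod => j _; exact: measurable_scaled is_derive_bump. Qed.

Lemma measurable_dmollifier i y : measurable_fun setT (dmollifier i y).
Proof.
apply: measurable_funM.
  by apply: measurable_funM => //; exact: measurable_scaled is_derive_bump'.
under eq_fun do rewrite big_mkcond.
apply: measurable_prod => j _; case: (j != i) => //.
exact: measurable_scaled is_derive_bump.
Qed.

(** The mollifier depends on z - y only, so a derivative in y is minus the derivative in z; hence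
    the plus sign before [h * dmollifier i y z]. *)
Lemma mollifier_taylor : exists2 C, 0 <= C & forall i y z (h : R),
  `|mollifier (y + h *: delta_mx ord0 i) z - mollifier y z + h * dmollifier i y z| <= C * h ^+ 2.
Proof.
have [C HC] := @bump''_bounded R.
have C0 : 0 <= C by exact: le_trans (HC 0).
exists (C / eps ^+ 2); first by rewrite divr_ge0 ?sqr_ge0.
move=> i y z h.
have [r0 r1] := andP (rest01 y z i).
rewrite (mollifier_split _ _ i) (mollifier_split y z i) /dmollifier.
have -> : \prod_(j < n | j != i) bump ((z ord0 j - (y + h *: delta_mx ord0 i) ord0 j) / eps) =
    \prod_(j < n | j != i) bump ((z ord0 j - y ord0 j) / eps).
  apply: eq_bigr => j ji; congr (bump ((_ - _) / _)).
  by rewrite !mxE (negbTE ji) andbF mulr0 addr0.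
set r := \prod_(j < n | j != i) _ in r0 r1 *.
set s := (z ord0 i - y ord0 i) / eps.
have -> : (z ord0 i - (y + h *: delta_mx ord0 i) ord0 i) / eps = s + (- (h / eps)).
  by rewrite !mxE !eqxx mulr1 /s; ring.
have := taylor1_bound bump bump' bump'' C s (- (h / eps)) is_derive_bump is_derive_bump' HC.
rewrite sqrrN expr_div_n => T.
have -> : bump (s + - (h / eps)) * r - bump s * r + h * (bump' s / eps * r) =
  (bump (s + - (h / eps)) - bump s - - (h / eps) * bump' s) * r by ring.
rewrite normrM (ger0_norm r0) mulrAC -mulrA.
by apply: le_trans T; rewrite ler_piMr.
Qed.

Definition mollifier_mass y : R := \int[mu]_z mollifier y z.

Lemma integral_mollifier y : (\int[mu]_z (mollifier y z)%:E = (mollifier_mass y)%:E)%E.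
Proof.
rewrite /mollifier_mass /Rintegral fineK//; apply: integrable_fin_num => //.
apply: (integrable_bounded_support _ 1 y (y + const_mx eps)).
- exact: measurable_mollifier.
- by move=> z; rewrite ger0_norm ?mollifier_ge0 ?mollifier_le1.
- move=> z Bz; apply/eqP/negPn/negP => /mollifier_support H; apply: Bz => i.
  by have /andP[h1 h2] := H i; rewrite !mxE !ltW.
Qed.

Lemma mollifier_mass_shift y c : mollifier_mass (y + c) = mollifier_mass y.
Proof.
apply/EFin_inj; rewrite -!integral_mollifier.
rewrite -[RHS](ge0_integral_shift _ (- c)).
- apply: eq_integral => z _; congr EFin; apply: eq_bigr => j _; congr (bump (_ / _)).
  by rewrite !mxE; ring.
- by apply/measurable_EFinP; exact: measurable_mollifier.
- by move=> z; rewrite lee_fin mollifier_ge0.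
Qed.

Lemma mollifier_mass_gt0 y : 0 < mollifier_mass y.
Proof.
have m0 : 0 <= mollifier_mass y.
  by rewrite -lee_fin -integral_mollifier; apply: integral_ge0 => z _; rewrite lee_fin mollifier_ge0.
rewrite lt0r m0 andbT; apply/eqP => E.
have := integral_mollifier y; rewrite E => J.
have : (\int[mu]_z `|(mollifier y z)%:E| = 0)%E.
  by apply: etrans J; apply: eq_integral => z _; rewrite gee0_abs// lee_fin mollifier_ge0.
have mm : measurable_fun setT (EFin \o mollifier y).
  by apply/measurable_EFinP; exact: measurable_mollifier.
move/(ae_eq_integral_abs mu measurableT mm) => H.
(* A zero integral would force a zero of the mollifier in this box, on which it is strictly
   positive. *)
have [] := ae_exists_in_box (fun z => mollifier y z = 0) (y + const_mx (eps / 4))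
  (y + const_mx (eps / 2)).
- by apply: filterS H => z /(_ Logic.I) [].
- by move=> i; rewrite !mxE ltrD2l ltr_pM2l// ltf_pV2 ?posrE// ltr_nat.
- move=> z Bz /eqP; rewrite gt_eqF//; apply: prodr_gt0 => j _; apply: bump_gt0.
  have := Bz j; rewrite !mxE => /andP[h1 h2].
  have e4 : 0 < eps / 4 by rewrite divr_gt0.
  have e2 : eps / 2 < eps by rewrite ltr_pdivrMr// ltr_pMr// ltr1n.
  by rewrite divr_gt0 ?ltr_pdivrMr//; lra.
Qed.

Variables (f g : 'rV[R]_n -> R) (K0 : R) (i : 'I_n).
Hypothesis mf : measurable_fun setT f.
Hypothesis mg : measurable_fun setT g.
Hypothesis fK0 : forall z, `|f z| <= K0.
Hypothesis gK0 : \forall z \ae mu, `|g z| <= K0.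
Hypothesis fg : weak_partial i f g.

Let e : 'rV[R]_n := delta_mx ord0 i.
Let K0_ge0 : 0 <= K0. Proof. exact: le_trans (fK0 0). Qed.

Lemma Rintegral_mollifier_ae y : `|\int[mu]_z (g z * mollifier y z)| <= K0 * mollifier_mass y.
Proof.
have B : (\int[mu]_z `|g z * mollifier y z|%:E <= (K0 * mollifier_mass y)%:E)%E.
  rewrite EFinM -integral_mollifier -ge0_integralZl_EFin//; last 2 first.
  - by move=> z _; rewrite lee_fin mollifier_ge0.
  - by apply/measurable_EFinP; exact: measurable_mollifier.
  apply: ae_ge0_le_integral => //.
  - apply/measurable_EFinP; apply: measurableT_comp => //.
    by apply: measurable_funM => //; exact: measurable_mollifier.
  - by move=> z _; rewrite mule_ge0 ?lee_fin ?mollifier_ge0.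
  - apply/measurable_EFinP; apply: measurable_funM => //; exact: measurable_mollifier.
  - apply: filterS gK0 => z gz _; rewrite -EFinM lee_fin normrM.
    by rewrite (ger0_norm (mollifier_ge0 y z)) ler_wpM2r ?mollifier_ge0.
rewrite ler_norml; apply/andP; split.
  by apply: Rintegral_ge_any B => // z _; rewrite lerNl -normrN ler_norm.
by apply: Rintegral_le_any B => // z _; exact: ler_norm.
Qed.

Let F y : R := \int[mu]_z (f z * mollifier y z).

(** The margin 1 gives one box for all shifts with |h| <= 1, hence a constant independent of h in
    [mollified_increment]. *)
Let mollifier_out y z : ~ box (y - const_mx 1) (y + const_mx (eps + 1)) z ->
  forall h, `|h| <= 1 -> mollifier (y + h *: e) z = 0.
Proof.
move=> Bz h h1; apply/eqP/negPn/negP => /mollifier_support H; apply: Bz => j.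
have := H j; rewrite !mxE.
have : `|h * ((ord0 == ord0 :> 'I_1) && (j == i))%:R| <= 1.
  by rewrite normrM; case: (_ && _); rewrite ?normr1 ?mulr1// normr0 mulr0.
rewrite ler_norml => /andP[a b] /andP[c d]; apply/andP; split; lra.
Qed.

(** The mollifier vanishes at [z] for all small shifts, so [mollifier_taylor] bounds the derivative
    there by C h for every small positive h. *)
Let dmollifier_out y z : ~ box (y - const_mx 1) (y + const_mx (eps + 1)) z ->
  dmollifier i y z = 0.
Proof.
move=> Bz; have [C C0 HC] := mollifier_taylor.
have P h : `|h| <= 1 -> mollifier (y + h *: e) z = 0 by exact: mollifier_out.
have P0 : mollifier y z = 0 by have := P 0; rewrite normr0 scale0r addr0; apply.
have Q h : 0 < h <= 1 -> `|dmollifier i y z| <= C * h.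
  move=> /andP[h0 h1]; have := HC i y z h; rewrite P0 P; last by rewrite gtr0_norm.
  rewrite subrr add0r.
  by rewrite normrM gtr0_norm// expr2 mulrCA ler_pM2l.
apply/eqP; rewrite -normr_le0; apply/ler_addgt0Pr => d d0; rewrite add0r.
have C1 : 0 < C + 1 + d by lra.
have := Q (d / (C + 1 + d)); rewrite divr_gt0// ler_pdivrMr// mul1r => H.
apply: le_trans (H _) _; first by lra.
by rewrite mulrCA ler_piMr ?(ltW d0)// ler_pdivrMr//; lra.
Qed.

Let measurable_fM (k : 'rV[R]_n -> R) : measurable_fun setT k ->
  measurable_fun setT (fun z => f z * k z).
Proof. by move=> mk; exact: measurable_funM. Qed.

(** [mollifier_taylor] with h = 1, the mollifier taking values in [0, 1]. *)
Lemma dmollifier_bounded y : exists M, forall z, `|dmollifier i y z| <= M.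
Proof.
have [C C0 HC] := mollifier_taylor; exists (C + 1 + 1) => z.
have := HC i y z 1; rewrite mul1r expr1n mulr1.
have := mollifier_le1 y z; have := mollifier_ge0 y z.
have := mollifier_le1 (y + 1 *: delta_mx ord0 i) z; have := mollifier_ge0 (y + 1 *: delta_mx ord0 i) z.
by rewrite !ler_norml => ? ? ? ? /andP[? ?]; apply/andP; split; lra.
Qed.

Lemma integrable_fM (k : 'rV[R]_n -> R) (M : R) a b : measurable_fun setT k ->
  (forall z, `|k z| <= M) -> (forall z, ~ box a b z -> k z = 0) ->
  mu.-integrable setT (EFin \o (fun z => f z * k z)).
Proof.
move=> mk kM k0; apply: (integrable_bounded_support _ (K0 * M) a b).
- exact: measurable_fM.
- by move=> z; rewrite normrM ler_pM.
- by move=> z /k0 ->; rewrite mulr0.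
Qed.

(* The weak derivative bounds the first order term by [K0] times the mass of
   the mollifier; the quadratic error disappears by subdividing the segment, see
   [lipschitz_of_increments]. *)
Lemma mollified_increment : exists2 C, 0 <= C & forall y (h : R), `|h| <= 1 ->
  `|F (y + h *: e) - F y| <= K0 * mollifier_mass 0 * `|h| + C * h ^+ 2.
Proof.
have [C C0 HC] := mollifier_taylor.
exists (K0 * C * (eps + 2) ^+ n).
  by apply: mulr_ge0; [exact: mulr_ge0|rewrite exprn_ge0// addr_ge0 ?ltW].
move=> y h h1.
set a := y - const_mx 1; set b := y + const_mx (eps + 1).
have V : fine (mu (box a b)) = (eps + 2) ^+ n.
  rewrite lebesgue_rV_box/=; last first.
    by move=> j; rewrite !mxE lerD2l; apply: (@le_trans _ _ 0); rewrite ?lerN10// addr_ge0// ltW.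
  rewrite (eq_bigr (fun=> eps + 2)) ?prodr_const ?card_ord//.
  by move=> j _; rewrite !mxE; ring.
(* Integration by parts, with the mollifier as test function, moves the derivative onto [f], where
   the almost everywhere bound on [g] applies. *)
have D0 : `|\int[mu]_z (f z * dmollifier i y z)| <= K0 * mollifier_mass 0.
  rewrite -(mollifier_mass_shift 0 y) add0r -normrN.
  have := fg (mollifier y) (test_function_mollifier y).
  by rewrite partial_mollifier => ->; rewrite opprK; exact: Rintegral_mollifier_ae.
have [M HM] := dmollifier_bounded y.
have I1 : mu.-integrable setT (EFin \o (fun z => f z * mollifier (y + h *: e) z)).
  apply: (integrable_fM _ 1 a b); first exact: measurable_mollifier.
    by move=> z; rewrite ger0_norm ?mollifier_ge0 ?mollifier_le1.
  by move=> z /mollifier_out; apply.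
have I2 : mu.-integrable setT (EFin \o (fun z => f z * mollifier y z)).
  apply: (integrable_fM _ 1 a b); first exact: measurable_mollifier.
    by move=> z; rewrite ger0_norm ?mollifier_ge0 ?mollifier_le1.
  by move=> z /mollifier_out /(_ 0); rewrite scale0r addr0 normr0; apply.
have I3 : mu.-integrable setT (EFin \o (fun z => f z * dmollifier i y z)).
  by apply: (integrable_fM _ M a b) => //; [exact: measurable_dmollifier|exact: dmollifier_out].
have I4 : mu.-integrable setT (EFin \o (fun z => h * (f z * dmollifier i y z))).
  exact: (integrableZl measurableT h I3).
have I5 : mu.-integrable setT (EFin \o (fun z => f z * mollifier (y + h *: e) z - f z * mollifier y z)).
  exact: (integrableB measurableT I1 I2).
have E : F (y + h *: e) - F y + h * \int[mu]_z (f z * dmollifier i y z) =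
   \int[mu]_z (f z * (mollifier (y + h *: e) z - mollifier y z + h * dmollifier i y z)).
  rewrite -RintegralZl// -RintegralB// -RintegralD//.
  by apply: eq_Rintegral => z _; ring.
have B : `|F (y + h *: e) - F y + h * \int[mu]_z (f z * dmollifier i y z)| <=
    K0 * (C * h ^+ 2) * (eps + 2) ^+ n.
  rewrite E -V; apply: Rintegral_bounded_support.
  - by apply: mulr_ge0 => //; apply: mulr_ge0 => //; exact: sqr_ge0.
  - apply: measurable_fM; apply: measurable_funD.
      by apply: measurable_funB; exact: measurable_mollifier.
    by apply: measurable_funM => //; exact: measurable_dmollifier.
  - by move=> z; rewrite normrM; apply: ler_pM => //; exact: HC.
  - move=> z Bz; rewrite dmollifier_out// mollifier_out//.
    by have := mollifier_out _ _ Bz 0; rewrite scale0r addr0 normr0 => ->//; ring.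
have := ler_normB (F (y + h *: e) - F y + h * \int[mu]_z (f z * dmollifier i y z))
  (h * \int[mu]_z (f z * dmollifier i y z)); rewrite addrK => /le_trans; apply.
rewrite addrC; apply: lerD.
  by rewrite normrM mulrC ler_wpM2r.
by rewrite (_ : K0 * C * _ * _ = K0 * (C * h ^+ 2) * (eps + 2) ^+ n)//; ring.
Qed.

Lemma mollified_lipschitz y h : `|F (y + h *: e) - F y| <= K0 * mollifier_mass 0 * `|h|.
Proof.
have [C C0 HC] := mollified_increment.
have := lipschitz_of_increments (fun s => F (y + s *: e)) (K0 * mollifier_mass 0) C C0 _ h.
rewrite scale0r addr0; apply => s k k1.
by rewrite scalerDl addrA; exact: HC.
Qed.

Lemma mollified_close y (om : R) : (forall z, (forall j, `|z ord0 j - y ord0 j| <= eps) -> `|f z - f y| <= om) ->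
  `|F y - f y * mollifier_mass 0| <= om * mollifier_mass 0.
Proof.
move=> fom.
have om0 : 0 <= om by apply: le_trans (fom y _) => // j; rewrite subrr normr0 ltW.
rewrite -(mollifier_mass_shift 0 y) add0r.
have I1 : mu.-integrable setT (EFin \o (fun z => mollifier y z)).
  apply: (integrable_bounded_support _ 1 y (y + const_mx eps)).
  - exact: measurable_mollifier.
  - by move=> z; rewrite ger0_norm ?mollifier_ge0 ?mollifier_le1.
  - move=> z Bz; apply/eqP/negPn/negP => /mollifier_support H; apply: Bz => j.
    by have /andP[h1 h2] := H j; rewrite !mxE !ltW.
have I2 : mu.-integrable setT (EFin \o (fun z => f z * mollifier y z)).
  apply: (integrable_fM _ 1 y (y + const_mx eps)).
  - exact: measurable_mollifier.
  - by move=> z; rewrite ger0_norm ?mollifier_ge0 ?mollifier_le1.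
  - move=> z Bz; apply/eqP/negPn/negP => /mollifier_support H; apply: Bz => j.
    by have /andP[h1 h2] := H j; rewrite !mxE !ltW.
have I3 : mu.-integrable setT (EFin \o (fun z => f y * mollifier y z)).
  exact: (integrableZl measurableT (f y) I1).
have -> : F y - f y * mollifier_mass y = \int[mu]_z (f z * mollifier y z - f y * mollifier y z).
  by rewrite RintegralB// RintegralZl.
have B : (\int[mu]_z (om * mollifier y z)%:E <= (om * mollifier_mass y)%:E)%E.
  rewrite EFinM -integral_mollifier -ge0_integralZl_EFin//.
  - by move=> z _; rewrite lee_fin mollifier_ge0.
  - by apply/measurable_EFinP; exact: measurable_mollifier.
have G0 z : setT z -> 0 <= om * mollifier y z by move=> _; rewrite mulr_ge0// mollifier_ge0.
have FG z : `|f z * mollifier y z - f y * mollifier y z| <= om * mollifier y z.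
  rewrite -mulrBl normrM (ger0_norm (mollifier_ge0 y z)).
  have [->|/mollifier_support H] := eqVneq (mollifier y z) 0; first by rewrite !mulr0.
  rewrite ler_wpM2r ?mollifier_ge0//; apply: fom => j.
  by have /andP[h1 h2] := H j; rewrite ger0_norm; lra.
rewrite ler_norml; apply/andP; split.
  by apply: Rintegral_ge_any B => // z _; rewrite lerNl; apply: le_trans (FG z); rewrite -normrN ler_norm.
by apply: Rintegral_le_any B => // z _; apply: le_trans (FG z); exact: ler_norm.
Qed.

End mollification.

(** * From weak derivatives to pointwise Lipschitz bounds *)

Section W1inf.
Context {R : realType} {n : nat}.
Local Notation mu := (@lebesgue_rV R n).
Implicit Types (x y z : 'rV[R]_n) (i j : 'I_n).

Lemma continuous_coordwise (f : 'rV[R]_n -> R) y (om : R) : continuous f -> 0 < om ->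
  exists2 r, 0 < r & forall z, (forall j, `|z ord0 j - y ord0 j| <= r) -> `|f z - f y| <= om.
Proof.
move=> /(_ y) /cvgrPdist_le cf om0; have /nbhs_ballP[r /= r0 H] := cf om om0.
exists (r / 2); first by rewrite divr_gt0.
move=> z zr; rewrite distrC; apply: H; split=> // k j; rewrite /ball /= ord1 distrC.
by apply: le_lt_trans (zr j) _; lra.
Qed.

(** The mollified function satisfies the bound at every scale and, by continuity of [f], is close to
    [f] at the two end points when the scale is small. *)
Lemma weak_partial_lipschitz (f g : 'rV[R]_n -> R) (K0 : R) i x h :
  continuous f -> measurable_fun setT f -> measurable_fun setT g ->
  (forall z, `|f z| <= K0) -> (\forall z \ae mu, `|g z| <= K0) -> weak_partial i f g ->
  `|f (x + h *: delta_mx ord0 i) - f x| <= K0 * `|h|.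
Proof.
move=> cf mf mg fK0 gK0 fg; apply/ler_addgt0Pr => d d0.
have d2 : 0 < d / 2 by rewrite divr_gt0.
have [r1 r10 H1] := continuous_coordwise f x (d / 2) cf d2.
have [r2 r20 H2] := continuous_coordwise f (x + h *: delta_mx ord0 i) (d / 2) cf d2.
pose eps := Num.min r1 r2.
have eps0 : 0 < eps by rewrite lt_min r10.
have m0 := mollifier_mass_gt0 eps eps0 (0 : 'rV[R]_n).
have e1 : eps <= r1 by rewrite ge_min lexx.
have e2 : eps <= r2 by rewrite ge_min lexx orbT.
have L := mollified_lipschitz eps eps0 f g K0 i mf mg fK0 gK0 fg x h.
have C1 := mollified_close eps eps0 f K0 mf fK0 x (d / 2)
  (fun z H => H1 z (fun j => le_trans (H j) e1)).
have C2 := mollified_close eps eps0 f K0 mf fK0 (x + h *: delta_mx ord0 i) (d / 2)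
  (fun z H => H2 z (fun j => le_trans (H j) e2)).
move: L C1 C2; set I1 := Rintegral _ _ _; set I2 := Rintegral _ _ _.
move: I1 I2 (f _) (f x) (mollifier_mass _ _) m0 => I1 I2 fh fx m m0 L C1 C2.
rewrite -(ler_pM2r m0) -[X in _ * X <= _](gtr0_norm m0) -normrM mulrBl.
move: L C1 C2; rewrite !ler_norml => /andP[? ?] /andP[? ?] /andP[? ?].
by apply/andP; split; lra.
Qed.

(** The points are joined by a path of [n] steps parallel to the axes, each of length at most |x -
    y|; hence the factor [n]. *)
Lemma coordinatewise_lipschitz (f : 'rV[R]_n -> R) (M : R) :
  (forall i x h, `|f (x + h *: delta_mx ord0 i) - f x| <= M * `|h|) ->
  forall x y, `|f x - f y| <= n%:R * M * enorm (x - y).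
Proof.
move=> fM x y; rewrite distrC.
have P (s : seq 'I_n) : `|f (x + \sum_(j <- s) (y - x) ord0 j *: delta_mx ord0 j) - f x| <=
    \sum_(j <- s) M * enorm (x - y).
  elim: s => [|i s IH]; first by rewrite !big_nil addr0 subrr normr0.
  rewrite !big_cons [X in x + X]addrC addrA.
  set v := x + _ in IH *; rewrite -(subrK (f v) (f (v + _))) -addrA.
  apply: le_trans (ler_normD _ _) _; apply: lerD => //.
  apply: le_trans (fM _ _ _) _.
  have M0 : 0 <= M by have := fM i x 1; rewrite normr1 mulr1; exact: le_trans.
  by rewrite ler_wpM2l// -(enormN (x - y)) opprB; exact: enorm_coord.
have := P (index_enum 'I_n); rewrite sumr_const card_ord -row_sum_delta.
by rewrite [x + _]addrC subrK -[M * _ *+ n]mulr_natl mulrA.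
Qed.

(** Each summand of the norm is at most [K0]. Continuity upgrades the essential bound on [f] to all
    points, because small boxes have positive measure. *)
Lemma W1inf_lipschitz (f : 'rV[R]_n -> R) (K0 : R) : continuous f -> W1inf_norm_le f K0 ->
  (forall x, `|f x| <= K0) /\ forall x y, `|f x - f y| <= n%:R * K0 * enorm (x - y).
Proof.
move=> cf [mf [g [mg fg Nle]]].
have mu0 : (0 < mu setT)%E.
  apply: lt_le_trans (box_measure_gt0 (0 : 'rV[R]_n) (const_mx 1) _) _.
    by move=> j; rewrite !mxE.
  by apply: le_measure => //; rewrite inE//; exact: measurable_box.
have S0 : (0 <= \sum_(i < n) 'N[mu]_(+oo)[EFin \o g i])%E.
  by apply: sume_ge0 => i _; exact: Lnorm_ge0.
have ae (k : 'rV[R]_n -> R) : ('N[mu]_(+oo)[EFin \o k] <= K0%:E)%E -> \forall z \ae mu, `|k z| <= K0.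
  by rewrite Lnorm.unlock mu0 => /ess_supP; apply: filterS => z; rewrite /= lee_fin.
have aef : \forall z \ae mu, `|f z| <= K0.
  by apply: ae; apply: le_trans Nle; rewrite leeDl.
have aeg i : \forall z \ae mu, `|g i z| <= K0.
  apply: ae; apply: le_trans Nle; rewrite (bigD1 i)//=; apply: le_trans (leeDr _ (Lnorm_ge0 _ _ _)).
  by rewrite leeDl// sume_ge0// => j _; exact: Lnorm_ge0.
have fK0 x : `|f x| <= K0.
  apply/ler_addgt0Pr => d d0.
  have [r r0 H] := continuous_coordwise f x d cf d0.
  have [|z Bz fz] := ae_exists_in_box _ x (x + const_mx r) aef.
    by move=> j; rewrite !mxE ltrDl.
  have /H : forall j, `|z ord0 j - x ord0 j| <= r.
    move=> j; have := Bz j; rewrite !mxE => /andP[h1 h2].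
    by rewrite ger0_norm; lra.
  have := ler_normB (f z) (f z - f x); rewrite opprB addrC subrK => h1 h2.
  by apply: le_trans h1 _; exact: lerD.
split=> //; apply: coordinatewise_lipschitz => i x h.
exact: (weak_partial_lipschitz f (g i)).
Qed.

End W1inf.

(** * Bounds on the first order solution and rate of convergence *)

Section barrier.
Context {R : realType} {n : nat}.
Implicit Types (H : R -> 'rV[R]_n -> R -> 'rV[R]_n -> R) (u w : R -> 'rV[R]_n -> R).

(** The barrier is smooth, so at a touching point the test function has zero space gradient and time
    derivative -K. The claim reduces to H(t, x, K0 + K t, 0) >= -K, which follows from (A1) and
    monotonicity in the value. *)
Lemma barrier_weak_subsolution (T lambda K K0 : R) H :
  0 <= lambda -> 0 <= K -> 0 <= K0 ->
  (forall (t : R) (x p : 'rV[R]_n) (u v : R), H t x v p - H t x u p = lambda * (v - u)) ->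
  (forall t x, 0 <= t <= T -> `|H t x 0 0| <= K) ->
  weak_subsolution T (dual_hamiltonian H) 0 (fun t _ => - (K0 + K * t)).
Proof.
move=> lambda0 K_ge0 K0_ge0 Hlin HK c c' a a' y B z0 r dc da _ _ r0 t x /andP[t0 tT] mx k S G _ _ _ _.
rewrite !mul0r /dual_hamiltonian.
have tT' : 0 <= t <= T by rewrite !ltW.
have grad0 : \row_i tcomp' a y B z0 r t i (x ord0 i) = 0.
  apply/rowP => i; rewrite !mxE.
  have D s := is_derive_tcomp a y B z0 r t i s.
  suff E : is_derive (x ord0 i) (1 : R) (tcomp a y B z0 r t i) 0.
    by have [_ <-] := D (x ord0 i); have [_ ->] := E.
  (* The barrier does not depend on x, so the i-th component of the test function has a minimum at
     the i-th coordinate of [x]. *)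
  apply: (@derive1_at_min R _ (x ord0 i - 1) (x ord0 i + 1)).
  - by lra.
  - by move=> s _; have [] := D s.
  - by rewrite in_itv/=; apply/andP; split; lra.
  - move=> s _; have := mx t (x + (s - x ord0 i) *: delta_mx ord0 i) tT'.
    rewrite lerD2l lerN2 /tfun lerD2l (bigD1 i)//= [X in _ <= X](bigD1 i)//=.
    rewrite !mxE !eqxx mulr1 [x ord0 i + _]addrC subrK [X in _ <= X -> _](_ : _ = tcomp a y B z0 r t i s +
      \sum_(j < n | j != i) tcomp a y B z0 r t j (x ord0 j)); last first.
      congr (_ + _); apply: eq_bigr => j ji.
      by rewrite !mxE (negbTE ji) andbF mulr0 addr0.
    by rewrite lerD2r.
have time : c' t + a' t * (\sum_i (x ord0 i - y ord0 i) ^+ 2) = - K.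
  have D s := is_derive_tfun_time c c' a a' y B z0 r dc da s x.
  have D2 (s : R) : is_derive s (1 : R) (fun s => - (K0 + K * s) - tfun c a y B z0 r s x)
      (- K - (c' s + a' s * (\sum_i (x ord0 i - y ord0 i) ^+ 2))).
    have D1 := is_deriveN (is_deriveD (is_derive_cst K0 s (1 : R)) (is_deriveZ K (is_derive_id s (1 : R)))).
    by apply: (is_derive_eq (is_deriveB D1 (D s))); rewrite add0r /GRing.scale/= mulr1.
  have E : is_derive t (1 : R) (fun s => - (K0 + K * s) - tfun c a y B z0 r s x) 0.
    apply: (@derive1_at_max R _ 0 T).
    - by lra.
    - by move=> s _; have [] := D2 s.
    - by rewrite in_itv/= t0.
    - by move=> s; rewrite in_itv/= => /andP[s0 sT]; apply: mx; rewrite !ltW.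
  have [_ e1] := D2 t; have [_ e2] := E.
  by move: e1; rewrite e2; lra.
rewrite grad0 time oppr0 opprK.
have := Hlin t x 0 0 (K0 + K * t); rewrite subr0 => /eqP; rewrite subr_eq => /eqP ->.
have := HK t x tT'; rewrite ler_norml => /andP[h _].
have : 0 <= lambda * (K0 + K * t) by rewrite mulr_ge0// addr_ge0// mulr_ge0// ltW.
lra.
Qed.

Variables (T lambda L : R) (A : R -> R).
Hypothesis T_gt0 : 0 < T.
Hypothesis lambda_ge0 : 0 <= lambda.
Hypothesis L_gt0 : 0 < L.

Lemma bounded_on_stripN u : bounded_on_strip T u -> bounded_on_strip T (fun t x => - u t x).
Proof. by move=> [M uM]; exists M => t x tT; rewrite normrN uM. Qed.

Lemma continuous_on_stripN u : continuous_on_strip T u ->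
  continuous_on_strip T (fun t x => - u t x).
Proof. by move=> uc p; apply: cvgN; exact: uc. Qed.

(** [doubling_comparison] on the diagonal with [eps], [sigma], [M0] and [G0] all zero: the barrier
    is constant in space, and only [delta * (L * t) / 2] remains, which is arbitrarily small. *)
Lemma weak_subsolution_le_barrier (K K0 : R) H u : 0 <= K -> 0 <= K0 ->
  admissible lambda L A H -> (forall t x, 0 <= t <= T -> `|H t x 0 0| <= K) ->
  continuous_on_strip T u -> bounded_on_strip T u -> weak_subsolution T H 0 u ->
  (forall x, u 0 x <= K0) ->
  forall t x, 0 <= t <= T -> u t x <= K0 + K * t.
Proof.
move=> K_ge0 K0_ge0 HA HK uc [M uM] usub u0 t x tT.
pose w (t : R) (_ : 'rV[R]_n) : R := - (K0 + K * t).
have wc : continuous_on_strip T w.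
  apply: continuous_subspaceT => p; apply: cvgN; apply: cvgD; first exact: cvg_cst.
  by apply: cvgM; [exact: cvg_cst|exact: cvg_fst].
have [Hlin _ _] := HA.
have wsub := barrier_weak_subsolution T lambda K K0 H lambda_ge0 K_ge0 K0_ge0 Hlin HK.
pose B0 := Num.max M (K0 + K * T).
have uB s z : 0 <= s <= T -> `|u s z| <= B0 by move=> sT; rewrite le_max uM.
have wB s z : 0 <= s <= T -> `|w s z| <= B0.
  move=> /andP[s0 sT]; rewrite le_max /w normrN ger0_norm ?lerD2l ?ler_wpM2l ?orbT//.
  by rewrite addr_ge0// mulr_ge0.
have half : 0 < (2^-1 : R) < 1 by rewrite invr_gt0 invf_lt1// ltr1n ltr0n.
have wG s (z z' : 'rV[R]_n) : 0 <= s <= T -> w s z - w s (z + z') <= cst 0 z'.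
  by move=> _; rewrite /w subrr.
have init (z z' : 'rV[R]_n) : u 0 z + w 0 z' <= 0 * enorm (z - z').
  by rewrite mul0r /w mulr0 addr0 subr_le0.
have G0S0 : (\int[lebesgue_rV n]_(z in [set z : 'rV[R]_n | (2^-1 <= enorm z)%R])
    (cst 0 z / enorm z ^+ n.+1)%:E <= 0%:E)%E.
  by under eq_integral do rewrite /= mul0r; rewrite integral0.
apply/ler_addgt0Pr => e e0.
pose d := e / (L * T).
have d0 : 0 < d by rewrite divr_gt0// mulr_gt0.
have sd : 0 * frac_const n * (expR (3 * L * T) / (2 * d) * (4 * 4 ^+ n * 2^-1) + 0) <= (0 : R).
  by rewrite !mul0r.
have := doubling_comparison T lambda L A H u w 0 B0 d 0 2^-1 0 0 (cst 0) T_gt0 lambda_ge0 L_gt0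
  HA uc wc uB wB usub wsub init d0 (lexx 0) half (measurable_cst _) (fun=> lexx 0) wG G0S0 sd t x x tT.
rewrite mul0r addr0 expr0n/= add0r big1 ?mulr0 ?add0r; last by move=> i _; rewrite subrr expr0n.
move=> h; have : d * (L * t) / 2 <= e.
  have -> : d * (L * t) / 2 = e * (t / T) / 2 by rewrite /d; field; rewrite !gt_eqF.
  case/andP: tT => t0 tT; have : t / T <= 1 by rewrite ler_pdivrMr// mul1r.
  have q0 : 0 <= t / T by rewrite divr_ge0// ltW.
  by move=> q1; apply: le_trans (_ : e * 1 / 2 <= e); [rewrite ler_pM2r// ler_pM2l|lra].
by move: h; rewrite /w; lra.
Qed.

End barrier.

(** * Regularity of the first order solution and the one-sided rate *)

Section solutions.
Context {R : realType} {n : nat}.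
Implicit Types (H : R -> 'rV[R]_n -> R -> 'rV[R]_n -> R) (u w : R -> 'rV[R]_n -> R).
Variables (T lambda L : R) (A : R -> R).
Hypothesis T_gt0 : 0 < T.
Hypothesis lambda_ge0 : 0 <= lambda.
Hypothesis L_gt0 : 0 < L.

Lemma viscosity_solution_weak (eps : R) H (u0 : 'rV[R]_n -> R) u : 0 <= eps -> viscosity_solution T H eps u0 u ->
  weak_subsolution T H eps u /\ weak_subsolution T (dual_hamiltonian H) eps (fun t x => - u t x).
Proof.
by move=> e0 [_ _ sub sup _]; split; [exact: subsolution_weak|exact: supersolution_weak].
Qed.

Lemma viscosity_solution_bound (K K0 : R) H (u0 : 'rV[R]_n -> R) u : 0 <= K -> 0 <= K0 ->
  admissible lambda L A H -> (forall t x, 0 <= t <= T -> `|H t x 0 0| <= K) ->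
  (forall x, `|u0 x| <= K0) -> viscosity_solution T H 0 u0 u ->
  forall t x, 0 <= t <= T -> `|u t x| <= K0 + K * T.
Proof.
move=> K_ge0 K0_ge0 HA HK u0K usol t x tT.
have [usub usup] := viscosity_solution_weak 0 H u0 u (lexx 0) usol.
have [ub uc _ _ uini] := usol.
have HKd s z : 0 <= s <= T -> `|dual_hamiltonian H s z 0 0| <= K.
  by move=> sT; rewrite /dual_hamiltonian !oppr0 normrN HK.
have KtT : K * t <= K * T by case/andP: tT => _ tT; exact: ler_wpM2l.
rewrite ler_norml; apply/andP; split.
  rewrite lerNl; apply: le_trans (_ : K0 + K * t <= _); last by rewrite lerD2l.
  apply: (weak_subsolution_le_barrier T lambda L A T_gt0 lambda_ge0 L_gt0 K K0
    (dual_hamiltonian H) (fun t x => - u t x)) => //.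
  - exact: admissible_dual.
  - exact: continuous_on_stripN.
  - exact: bounded_on_stripN.
  - by move=> z; rewrite uini; apply: le_trans (u0K z); rewrite -normrN ler_norm.
apply: le_trans (_ : K0 + K * t <= _); last by rewrite lerD2l.
apply: (weak_subsolution_le_barrier T lambda L A T_gt0 lambda_ge0 L_gt0 K K0 H u) => //.
by move=> z; rewrite uini; apply: le_trans (u0K z); rewrite ler_norm.
Qed.

(** [u] is compared with itself. The choice [delta] = |x - y| makes both |x - y|^2 / [delta] and
    [delta] linear in |x - y|; as [delta] must be positive, x = y is treated apart. *)
Lemma viscosity_solution_lipschitz (M0 : R) H (u0 : 'rV[R]_n -> R) u :
  admissible lambda L A H -> (forall x y, `|u0 x - u0 y| <= M0 * enorm (x - y)) ->
  viscosity_solution T H 0 u0 u ->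
  forall t x y, 0 <= t <= T ->
  u t x - u t y <= (expR (3 * L * T) / 2 + (M0 ^+ 2 + L * T) / 2) * enorm (x - y).
Proof.
move=> HA u0M usol t x y tT.
have [usub usup] := viscosity_solution_weak 0 H u0 u (lexx 0) usol.
have [[B uB] uc _ _ uini] := usol.
have [d0|] := ltP 0 (enorm (x - y)); last first.
  move=> e0; have {}e0 : enorm (x - y) = 0 by apply/eqP; rewrite eq_le e0 enorm_ge0.
  suff -> : x = y by rewrite !subrr mulr_ge0 ?enorm_ge0// addr_ge0 ?divr_ge0 ?expR_ge0//
    addr_ge0 ?sqr_ge0// mulr_ge0 ?ltW.
  apply/rowP => i; have := enorm_coord (x - y) i; rewrite e0 normr_le0 !mxE subr_eq0.
  by move/eqP.
set d := enorm (x - y) in d0 *.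
have half : 0 < (2^-1 : R) < 1 by rewrite invr_gt0 invf_lt1// ltr1n ltr0n.
have sg S0 : 0 * frac_const n * (expR (3 * L * T) / (2 * d) * (4 * 4 ^+ n * 2^-1) + S0) <= (0 : R).
  by rewrite !mul0r.
have wB s z : 0 <= s <= T -> `|- u s z| <= B by move=> sT; rewrite normrN uB.
have wG s (z z' : 'rV[R]_n) : 0 <= s <= T -> - u s z - - u s (z + z') <= cst (B + B) z'.
  move=> sT; rewrite opprK; have := uB s z sT; have := uB s (z + z') sT.
  by rewrite !ler_norml => /andP[? ?] /andP[? ?] /=; lra.
have BB : 0 <= B + B by have := uB t x tT; have := normr_ge0 (u t x); lra.
have init (z z' : 'rV[R]_n) : u 0 z + - u 0 z' <= M0 * enorm (z - z').
  by rewrite !uini; apply: le_trans (u0M z z'); rewrite ler_norm.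
have G0S0 : (\int[lebesgue_rV n]_(z in [set z : 'rV[R]_n | (2^-1 <= enorm z)%R])
    (cst (B + B) z / enorm z ^+ n.+1)%:E <= ((B + B) * (2 * 4 ^+ n / 2^-1))%:E)%E.
  have r0 : 0 < (2^-1 : R) by case/andP: half.
  apply: le_trans (kernel_integralZ_le _ 0 _ _ BB (measurable_enorm_ge _) (kernel_tail _ r0)).
  apply: ge0_le_integral_any => z _; rewrite lee_fin /=.
    by rewrite divr_ge0 ?exprn_ge0 ?enorm_ge0.
  by rewrite expr0 mul1r.
have := doubling_comparison T lambda L A H u (fun t x => - u t x) M0 B d 0 2^-1 0
  ((B + B) * (2 * 4 ^+ n / 2^-1)) (cst (B + B)) T_gt0 lambda_ge0 L_gt0
  HA uc (continuous_on_stripN _ _ uc) uB wB usub usup init d0 (lexx 0) half (measurable_cst _)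
  (fun=> BB) wG G0S0 (sg _) t x y tT.
have -> : \sum_i (x ord0 i - y ord0 i) ^+ 2 = d ^+ 2.
  by rewrite enorm_sqr; apply: eq_bigr => i _; rewrite !mxE.
move=> h; apply: le_trans h _; rewrite mul0r addr0 [X in _ <= X]mulrDl; apply: lerD.
  rewrite [X in X <= _](_ : _ = expR (3 * L * t) / 2 * d); last by field; rewrite gt_eqF.
  rewrite ler_pM2r// ler_pM2r// ler_expR ler_pM2l ?mulr_gt0//.
  by case/andP: tT.
rewrite -mulrA mulrC ler_pM2r// ler_pM2r// lerD2l ler_pM2l//.
by case/andP: tT.
Qed.

Lemma far_increment_integral (M1 B eps : R) : 0 <= M1 -> 0 <= B -> 0 < eps < 1 ->
  (\int[lebesgue_rV n]_(z in [set z : 'rV[R]_n | (eps <= enorm z)%R])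
    (Num.min (M1 * enorm z) B / enorm z ^+ n.+1)%:E <=
  (M1 * (2 * 4 ^+ n * (`|ln eps| / ln 2 + 1)) + B * (2 * 4 ^+ n / 1))%:E)%E.
Proof.
move=> M10 B0 e01; have /andP[e0 e1] := e01.
have mG D : measurable_fun D (fun z : 'rV[R]_n => Num.min (M1 * enorm z) B / enorm z ^+ n.+1).
  apply: measurable_funM; last exact: measurable_invkernel.
  apply: measurable_minr => //.
  by apply: measurable_funM => //; exact: measurable_enorm.
have F0 (z : 'rV[R]_n) : 0 <= Num.min (M1 * enorm z) B / enorm z ^+ n.+1.
  by rewrite divr_ge0 ?exprn_ge0 ?enorm_ge0// le_min B0 mulr_ge0 ?enorm_ge0.
have -> : [set z : 'rV[R]_n | eps <= enorm z] = annulus eps 1 `|` [set z | 1 <= enorm z].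
  apply/seteqP; split => z /=.
    move=> kz; have [h|h] := ltP (enorm z) 1; first by left; apply/andP.
    by right.
  by case=> [/andP[]//|h]; apply: le_trans h; exact: ltW.
rewrite ge0_integral_setU//=; first last.
- by apply/disj_setPRL => z /= h /andP[_]; rewrite ltNge h.
- by move=> z _; rewrite lee_fin.
- by apply/measurable_EFinP; exact: mG.
- exact: measurable_enorm_ge.
- exact: measurable_annulus.
rewrite EFinD; apply: leeD.
  apply: le_trans (kernel_integralZ_le _ 1 M1 _ M10 (measurable_annulus eps 1) (kernel_middle eps e01)).
  apply: ge0_le_integral_any => z _; rewrite lee_fin//.
  by rewrite expr1 mulrA ler_wpM2r ?invr_ge0 ?exprn_ge0 ?enorm_ge0// ge_min lexx.
apply: le_trans (kernel_integralZ_le _ 0 B _ B0 (measurable_enorm_ge 1) (kernel_tail 1 ltr01)).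
apply: ge0_le_integral_any => z _; rewrite lee_fin//.
by rewrite expr0 mul1r ler_wpM2r ?invr_ge0 ?exprn_ge0 ?enorm_ge0// ge_min lexx orbT.
Qed.

(* Both the doubling parameter and the radius splitting the nonlocal operator
   are taken equal to [eps]. *)
Lemma one_sided_rate (M0 M1 B eps : R) H u w :
  0 <= M1 -> 0 <= B -> 0 < eps < expR (- 1) -> admissible lambda L A H ->
  continuous_on_strip T u -> continuous_on_strip T w -> bounded_on_strip T u ->
  weak_subsolution T H eps u -> weak_subsolution T (dual_hamiltonian H) 0 w ->
  (forall t x, 0 <= t <= T -> `|w t x| <= B) ->
  (forall t x y, 0 <= t <= T -> w t x - w t y <= M1 * enorm (x - y)) ->
  (forall x y, u 0 x + w 0 y <= M0 * enorm (x - y)) ->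
  forall t x, 0 <= t <= T -> u t x + w t x <=
    ((M0 ^+ 2 + L * T) / 2 + frac_const n * (2 * 4 ^+ n) *
      (expR (3 * L * T) + M1 * ((ln 2)^-1 + 1) + 2 * B) * T) * (eps * `|ln eps|).
Proof.
move=> M10 B0 /andP[e0 e1] HA uc wc [M uM] usub wsub wB wM init t x tT.
have e01 : 0 < eps < 1.
  by rewrite e0; apply: lt_trans e1 _; rewrite -[X in _ < X]expR0 ltr_expR ltrN10.
(* Here eps < 1/e allows terms of order eps to be absorbed into eps |ln eps|. *)
have l1 : 1 <= `|ln eps|.
  have : ln eps < -1 by rewrite -[X in _ < X]expRK ltr_ln// posrE ?expR_gt0.
  by move=> h; rewrite ltr0_norm; lra.
have ln2 : 0 < ln (2 : R) by rewrite ln_gt0// ltr1n.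
set l := `|ln eps| in l1 *.
set c4 : R := 2 * 4 ^+ n.
have c40 : 0 <= c4 by rewrite mulr_ge0// exprn_ge0.
pose B0' := Num.max M B.
have uB s z : 0 <= s <= T -> `|u s z| <= B0' by move=> sT; rewrite le_max uM.
have wB' s z : 0 <= s <= T -> `|w s z| <= B0' by move=> sT; rewrite le_max wB ?orbT.
pose G0 (z : 'rV[R]_n) := Num.min (M1 * enorm z) (2 * B).
have G0_ge0 z : 0 <= G0 z by rewrite le_min !mulr_ge0 ?enorm_ge0.
have mG0 : measurable_fun setT G0.
  apply: measurable_minr => //.
  by apply: measurable_funM => //; exact: measurable_enorm.
have wG s (z z' : 'rV[R]_n) : 0 <= s <= T -> w s z - w s (z + z') <= G0 z'.
  move=> sT; rewrite le_min; apply/andP; split.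
    by have := wM s z (z + z') sT; rewrite opprD addrA subrr add0r enormN.
  have := wB s z sT; have := wB s (z + z') sT.
  by rewrite !ler_norml => /andP[? ?] /andP[? ?]; lra.
have B20 : 0 <= 2 * B by rewrite mulr_ge0.
have G0S0 := far_increment_integral M1 (2 * B) eps M10 B20 e01.
rewrite -/l -/c4 in G0S0.
set S0 : R := M1 * _ + _ in G0S0.
set D : R := expR (3 * L * T) + M1 * ((ln 2)^-1 + 1) + 2 * B.
(* The near term carries kappa / delta = 1 and is therefore bounded; it and the other terms without
   logarithm are multiplied by [l >= 1]. *)
have sg : eps * frac_const n * (expR (3 * L * T) / (2 * eps) * (4 * 4 ^+ n * eps) + S0)
    <= frac_const n * c4 * D * (eps * l).
  rewrite [X in _ <= X](_ : _ = eps * frac_const n * (c4 * D * l)); last by ring.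
  rewrite ler_wpM2l ?mulr_ge0 ?frac_const_ge0 ?(ltW e0)//.
  have -> : expR (3 * L * T) / (2 * eps) * (4 * 4 ^+ n * eps) = c4 * expR (3 * L * T).
    by rewrite /c4; field; rewrite gt_eqF.
  rewrite /S0 [X in X <= _](_ : _ = c4 * (expR (3 * L * T) + M1 * (l / ln 2 + 1) + 2 * B)); last first.
    by rewrite /c4; field; rewrite gt_eqF.
  rewrite -[X in _ <= X]mulrA ler_wpM2l//.
  have -> : D * l = expR (3 * L * T) * l + M1 * (l / ln 2 + l) + 2 * B * l.
    by rewrite /D; field; rewrite gt_eqF.
  by rewrite !lerD ?ler_peMr ?expR_ge0// ler_wpM2l// lerD2l.
have := doubling_comparison T lambda L A H u w M0 B0' eps eps eps _ S0 G0 T_gt0 lambda_ge0 L_gt0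
  HA uc wc uB wB' usub wsub init e0 (ltW e0) e01 mG0 G0_ge0 wG G0S0 sg t x x tT.
rewrite big1 ?mulr0 ?add0r; last by move=> i _; rewrite subrr expr0n.
move=> h; apply: le_trans h _; rewrite mulrDl; apply: lerD.
  rewrite [X in _ <= X]mulrCA -[X in X <= _]mulrA ler_pM2l//; case/andP: tT => t0 tT.
  have h1 : M0 ^+ 2 + L * t <= M0 ^+ 2 + L * T by rewrite lerD2l ler_pM2l.
  have h2 : 0 <= M0 ^+ 2 + L * T by rewrite addr_ge0 ?sqr_ge0// mulr_ge0 ?ltW.
  apply: le_trans (_ : (M0 ^+ 2 + L * T) / 2 <= _); first by rewrite ler_pM2r.
  by rewrite ler_peMr// divr_ge0.
case/andP: tT => t0 tT; rewrite [X in _ <= X]mulrAC ler_wpM2l//.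
have D0 : 0 <= D.
  rewrite !addr_ge0 ?expR_ge0// mulr_ge0// addr_ge0// invr_ge0 ltW//.
exact: mulr_ge0 (mulr_ge0 (mulr_ge0 (@frac_const_ge0 R n) c40) D0) (mulr_ge0 (ltW e0) (le_trans ler01 l1)).
Qed.

End solutions.

Theorem theorem2p8 (R : realType) (n : nat) (T K lambda L K0 : R) (A : R -> R)
    (n_ge1 : (1 <= n)%N) (T_gt0 : 0 < T) (K_gt0 : 0 < K)
    (lambda_ge0 : 0 <= lambda) (L_gt0 : 0 < L) (K0_gt0 : 0 < K0) :
  exists C : R,
  forall (H : R -> 'rV[R]_n -> R -> 'rV[R]_n -> R) (u0 : 'rV[R]_n -> R)
    (A1_continuous : continuous (fun z : R * 'rV[R]_n * R * 'rV[R]_n =>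
       H z.1.1.1 z.1.1.2 z.1.2 z.2))
    (A1_bound : (ereal_sup [set (`|H p.1 p.2 0 0|)%:E | p in @strip R n T]
       < K%:E)%E)
    (A2 : forall (t : R) (x p : 'rV[R]_n) (u v : R),
       H t x v p - H t x u p = lambda * (v - u))
    (A3 : forall (t s u : R) (x y p : 'rV[R]_n),
       `|H t x u p - H s y u p| <=
         L * (1 + enorm p) * (enorm (x - y) + `|t - s|))
    (A4 : forall r : R, 0 < r -> forall (t : R) (x : 'rV[R]_n) (u : R)
       (p q : 'rV[R]_n), enorm p < r -> enorm q < r ->
       `|H t x u p - H t x u q| <= A r * enorm (p - q))
    (A5 : W1inf_norm_le u0 K0),
  forall eps : R, 0 < eps < expR (- 1) ->
  forall ueps u : R -> 'rV[R]_n -> R,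
    viscosity_solution T H eps u0 ueps ->
    viscosity_solution T H 0 u0 u ->
  forall (t : R) (x : 'rV[R]_n), 0 <= t <= T ->
    `|ueps t x - u t x| <= C * (eps * `|ln eps|).
Proof.
(* [M0] is a Lipschitz constant for the initial datum, [B] a bound for the first order solution and
   [M1] its Lipschitz constant in space; all are fixed before the Hamiltonian is introduced. *)
pose M0 := n%:R * K0; pose B := K0 + K * T.
pose M1 := expR (3 * L * T) / 2 + (M0 ^+ 2 + L * T) / 2.
exists ((M0 ^+ 2 + L * T) / 2 + frac_const n * (2 * 4 ^+ n) *
  (expR (3 * L * T) + M1 * ((ln 2)^-1 + 1) + 2 * B) * T).
move=> H u0 _ A1_bound A2 A3 A4 A5 eps e01 ueps u usol_eps usol t x tT.
have e0 : 0 < eps by case/andP: e01.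
have HA : admissible lambda L A H by split.
have HK s z : 0 <= s <= T -> `|H s z 0 0| <= K.
  move=> sT; rewrite -lee_fin; apply: le_trans (ltW A1_bound); apply: ereal_sup_ubound.
  by exists (s, z) => //; split => //=; rewrite in_itv.
have [ub uc _ _ uini] := usol.
have [vb vc _ _ vini] := usol_eps.
(* The continuous representative comes from the solution itself, whose trace at time 0 is [u0]. *)
have u0c : continuous u0.
  rewrite (_ : u0 = u 0); last by apply/funext => z; rewrite uini.
  apply/continuous_subspace_setT.
  apply: (continuous_on_strip_comp T u uc _ setT (fun z => (0, z))).
    by move=> z; exact: (cvg_pair (F := nbhs z) (f := fun=> 0 : R) (g := id) (cvg_cst _) cvg_id).
  by move=> z _; split => //=; rewrite in_itv/= lexx ltW.
have [u0K u0M] := W1inf_lipschitz u0 K0 u0c A5.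
have B0 : 0 <= B by rewrite addr_ge0 ?mulr_ge0 ?ltW.
have M10 : 0 <= M1 by rewrite addr_ge0 ?divr_ge0 ?expR_ge0// addr_ge0 ?sqr_ge0// mulr_ge0 ?ltW.
have uB := viscosity_solution_bound T lambda L A T_gt0 lambda_ge0 L_gt0 K K0 H u0 u
  (ltW K_gt0) (ltW K0_gt0) HA HK u0K usol.
have uM := viscosity_solution_lipschitz T lambda L A T_gt0 lambda_ge0 L_gt0 M0 H u0 u HA u0M usol.
have [usub usup] := viscosity_solution_weak T 0 H u0 u (lexx 0) usol.
have [vsub vsup] := viscosity_solution_weak T eps H u0 ueps (ltW e0) usol_eps.
(* Duality is an involution, so [u] can serve as the second function when [- ueps] is the first,
   with the dual Hamiltonian. *)
have usub' : weak_subsolution T (dual_hamiltonian (dual_hamiltonian H)) 0 u.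
  rewrite (_ : dual_hamiltonian _ = H)//.
  apply/funext => s; apply/funext => z; apply/funext => v; apply/funext => p.
  by rewrite /dual_hamiltonian !opprK.
rewrite ler_norml; apply/andP; split.
  rewrite lerNl opprB addrC.
  apply: (one_sided_rate T lambda L A T_gt0 lambda_ge0 L_gt0 M0 M1 B eps (dual_hamiltonian H)
    (fun t x => - ueps t x) u) => //.
  - exact: admissible_dual.
  - exact: continuous_on_stripN.
  - exact: bounded_on_stripN.
  - move=> z z'; rewrite vini uini addrC; apply: le_trans (ler_norm _) _.
    by rewrite -(enormN (z - z')) opprB; exact: u0M.
apply: (one_sided_rate T lambda L A T_gt0 lambda_ge0 L_gt0 M0 M1 B eps H
  ueps (fun t x => - u t x)) => //.
- exact: continuous_on_stripN.
- by move=> s z sT; rewrite normrN uB.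
- move=> s z z' sT; rewrite opprK addrC -(enormN (z - z')) opprB; exact: uM.
- by move=> z z'; rewrite vini uini; apply: le_trans (ler_norm _) _; exact: u0M.
Qed.
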